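(* Every 3-connected non-complete planar graph is degree-truncated $11$-choosable, i.e., $\operatorname{ch}^{*}(\mathcal{P}) \le 11$, where $\mathcal{P}$ is the family of all 3-connected non-complete planar graphs and $\operatorname{ch}^{*}$ denotes the degree-truncated choice number.
   Context: Graphs are finite and simple. $d_G(v)$ is the degree of $v$ in $G$, and $\mathbb{N}=\{0,1,\ldots\}$. A list assignment $L$ of $G$ assigns a set $L(v)$ of permissible colours to each vertex $v$. An $L$-colouring of $G$ is a mapping $\phi$ with $\phi(v)\in L(v)$ for every vertex $v$ and $\phi(u)\neq\phi(v)$ for every edge $uv$. For $f:V(G)\to\mathbb{N}$, $G$ is $f$-choosable if $G$ has an $L$-colouring for every list assignment $L$ with $|L(v)|\ge f(v)$ for all $v\in V(G)$. For a positive integer $k$, $G$ is degree-truncated $k$-choosable if $G$ is $f$-choosable for $f(v)=\min\{k,d_G(v)\}$ ($v\in V(G)$). The degree-truncated choice number $\operatorname{ch}^{*}(G)$ (written in the paper as $\operatorname{ch}$ with a struck-through superscript d) is the minimum integer $k$ such that $G$ is degree-truncated $k$-choosable, and for a family $\mathcal{G}$ of graphs, $\operatorname{ch}^{*}(\mathcal{G})=\max\{\operatorname{ch}^{*}(G):G\in\mathcal{G}\}$. *)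

(* Defs.v *)
From HB Require Import structures.
From mathcomp Require Import all_boot all_order all_algebra.
From mathcomp Require Import all_classical all_reals all_analysis.

Set Implicit Arguments.
Unset Strict Implicit.
Unset Printing Implicit Defensive.

Import Order.TTheory GRing.Theory Num.Theory.
Import numFieldNormedType.Exports.

Local Open Scope classical_set_scope.
Local Open Scope card_scope.
Local Open Scope ring_scope.

Record sgraph := SGraph {
  vertex :> finType;
  adj : rel vertex;
  adj_sym : symmetric adj;
  adj_irrefl : irreflexive adj }.

Definition degree (G : sgraph) (v : G) : nat := #|[set u : G | adj v u]%SET|.

Definition complete (G : sgraph) : Prop := forall u v : G, u != v -> adj u v.

Definition connected_without (G : sgraph) (S : {set G}) : Prop :=
  forall u v : G, u \notin S -> v \notin S ->
    connect [rel x y : G | [&& adj x y, x \notin S & y \notin S]] u v.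

Definition k_connected (k : nat) (G : sgraph) : Prop :=
  (k < #|G|)%N /\ forall S : {set G}, (#|S| < k)%N -> connected_without S.

(* Colour sets may be infinite and of any type; `I_n is {0, ..., n-1}, so the
   premise on L below says |L(v)| >= f(v). *)
Definition choosable (G : sgraph) (f : G -> nat) : Prop :=
  forall (C : Type) (L : G -> set C),
    (forall v, `I_(f v) #<= L v) ->
    exists phi : G -> C,
      (forall v, L v (phi v)) /\ (forall u v, adj u v -> phi u <> phi v).

Definition degree_truncated_choosable (k : nat) (G : sgraph) : Prop :=
  choosable (fun v : G => minn k (degree v)).

(* A minimum of natural numbers, taken as an infimum in the extended reals so
   that it is +oo when no k is suitable (as happens for complete graphs). *)
Definition ch_star (R : realType) (G : sgraph) : \bar R :=
  ereal_inf [set k%:R%:E | k in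
    [set k : nat | (0 < k)%N /\ degree_truncated_choosable k G]].

Definition ch_star_family (R : realType) (P : sgraph -> Prop) : \bar R :=
  ereal_sup [set c | exists2 G, P G & ch_star R G = c].

Definition is_arc (R : realType) (A : set (R * R)) (p q : R * R) : Prop :=
  exists gamma : R -> R * R,
    [/\ {within `[0, 1], continuous gamma}, set_inj `[0, 1] gamma,
        gamma 0 = p, gamma 1 = q & gamma @` `[0, 1] = A].

(* Only the values of arc on adjacent pairs matter; arc u v and arc v u are the
   drawing of the same edge. *)
Record plane_drawing (R : realType) (G : sgraph)
    (pt : G -> R * R) (arc : G -> G -> set (R * R)) : Prop := PlaneDrawing {
  drawing_inj : injective pt;
  drawing_sym : forall u v, arc u v = arc v u;
  drawing_arc : forall u v, adj u v -> is_arc (arc u v) (pt u) (pt v);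
  drawing_vertex : forall u v w, adj u v -> arc u v (pt w) -> w = u \/ w = v;
  drawing_cross : forall u v x y, adj u v -> adj x y ->
    [set u; v]%SET != [set x; y]%SET ->
    arc u v `&` arc x y `<=` range pt }.

Definition planar (R : realType) (G : sgraph) : Prop :=
  exists pt arc, @plane_drawing R G pt arc.

Definition planar_family (R : realType) (G : sgraph) : Prop :=
  [/\ k_connected 3 G, ~ complete G & planar R G].

(* Main.v *)
(** Call the vertices of degree at least 11 hubs.  The other vertices have as many colours as
    neighbours, so a component K of the graph they induce is colourable after the hubs unless
    what remains of its lists is tight everywhere.  Tight lists are so rigid that, in a graph
    without K5 and K33 minors, K is colourable as soon as all but two of the neighbouring hubs
    avoid three fixed colours and one of the neighbouring hubs, h, has a colour of its own.
    The bipartite graph of components and hubs has fewer than twice as many edges as vertices,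
    so it can be oriented such that each component exempts at most two hubs and each hub avoids
    the colours of at most two components; 11 - 2 * 3 = 5 colours are left to it.  Contracting
    every component into its vertex h and applying Thomassen's five list colour argument then
    colours the hubs.  This works when deleting a component and a hub does not disconnect the
    graph; otherwise one inducts on such separations, with one precoloured hub and one
    component whose neighbours cannot be exempted.

    A plane drawing excludes K5 and K33 minors by a mod 2 count: along the arcs one finds
    chains of short steps, and the winding numbers mod 2 of two chains which stay apart
    satisfy a relation in terms of their end points; these relations contradict each other
    when summed over all pairs of independent edges of K5 or K33. *)

From mathcomp Require Import all_boot zify.
From mathcomp Require boolp.
Set Implicit Arguments.
Unset Strict Implicit.
Unset Printing Implicit Defensive.

(** * Connected sets and minors *)

(** Everything is phrased with branch sets instead of faces because the argument contracts: the
    class of graphs without [K5] and [K33] minors survives contraction without any redrawing. The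
    private colour of [h] is obtained for free: after the contraction [h] is adjacent to all other
    hubs of its component. The orientation has no room to spare: a bipartite graph of this class has
    at most twice as many edges as vertices minus four, and the four pays exactly for capacity zero
    at two places, the precoloured hub and the distinguished component. The latter is the component
    through which a separation passes. Its removal together with a hub may disconnect the graph, and
    then the analysis that permits two exemptions breaks down; without exemptions it is enough that
    the side to be coloured is connected. *)

Lemma disjP (T : finType) (A B : {set T}) :
  (forall z, z \in A -> z \in B -> False) -> [disjoint A & B].
Proof.
move=> h; rewrite -setI_eq0; apply/eqP/setP => z; rewrite !inE.
by apply/negP => /andP[]; apply: h.
Qed.

Lemma disjE (T : finType) (A B : {set T}) z :
  [disjoint A & B] -> z \in A -> z \in B -> False.
Proof. by move=> /disjointFr h /h ->. Qed.

Section Conn.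
Variable T : finType.
Implicit Types (e : rel T) (X Y Z A K : {set T}).

(** Connectedness without paths: no proper nonempty subset is closed under the edges inside [X]. The
    empty set counts as connected; [bag] excludes it. *)
Definition conn e X := [forall A : {set T},
  [&& A \subset X, A != set0 &
      [forall x in A, forall y in X, e x y ==> (y \in A)]] ==> (A == X)].

Definition touch e X Y := [exists x in X, exists y in Y, e x y].

Definition bag e X := (X != set0) && conn e X.

Lemma connP e X :
  reflect (forall A, A \subset X -> A != set0 ->
    (forall x y, x \in A -> y \in X -> e x y -> y \in A) -> A = X) (conn e X).
Proof.
apply: (iffP forallP) => [h A sA nA cA|h A].
  apply/eqP/(implyP (h A)); rewrite sA nA /=.
  apply/forall_inP => x xA; apply/forall_inP => y yX; apply/implyP; exact: cA.
apply/implyP => /and3P[sA nA /forall_inP cA]; apply/eqP/h => // x y xA yX exy.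
by move/forall_inP: (cA _ xA) => /(_ _ yX)/implyP; apply.
Qed.

Lemma touchP e X Y :
  reflect (exists x y, [/\ x \in X, y \in Y & e x y]) (touch e X Y).
Proof.
apply: (iffP exists_inP) => [[x xX /exists_inP[y yY exy]]|[x [y [xX yY exy]]]].
  by exists x, y.
by exists x => //; apply/exists_inP; exists y.
Qed.

Lemma touch_sym e X Y : symmetric e -> touch e X Y = touch e Y X.
Proof.
move=> es; apply/touchP/touchP => -[x [y [? ?]]]; rewrite es => ?; by exists y, x.
Qed.

Lemma touchS e X Y X' Y' :
  X \subset X' -> Y \subset Y' -> touch e X Y -> touch e X' Y'.
Proof.
move=> sX sY /touchP[x [y [xX yY exy]]]; apply/touchP; exists x, y.
by rewrite (subsetP sX) // (subsetP sY).
Qed.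

Lemma touch1 e x y : touch e [set x] [set y] = e x y.
Proof.
apply/touchP/idP => [[a [b []]]|]; first by rewrite !inE => /eqP-> /eqP->.
by move=> exy; exists x, y; rewrite !inE !eqxx.
Qed.

Lemma touch1P e x Y : reflect (exists2 y, y \in Y & e x y) (touch e [set x] Y).
Proof.
apply: (iffP (touchP _ _ _)) => [[a [b []]]|[y yY exy]].
  by rewrite inE => /eqP-> bY ab; exists b.
by exists x, y; rewrite inE.
Qed.

Lemma conn_cut e X A x0 y0 : conn e X -> A \subset X -> x0 \in A ->
  y0 \in X -> y0 \notin A ->
  exists x y, [/\ x \in A, y \in X, y \notin A & e x y].
Proof.
move=> /connP cX sA xA yX yA.
have [/exists_inP[x x_A /exists_inP[y]]|/exists_inPn h] := boolP
  [exists x in A, exists y in X :\: A, e x y].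
  by rewrite inE => /andP[? ?] ?; exists x, y.
move: yA; rewrite (cX A) ?yX //; first by apply/set0Pn; exists x0.
move=> x y x_A y_X exy; apply/negPn/negP => yA.
by move/exists_inPn: (h _ x_A) => /(_ y); rewrite inE yA y_X exy; move/(_ isT).
Qed.

Lemma disconn e X : ~~ conn e X ->
  exists A : {set T}, [/\ A \subset X, A != set0, exists2 y, y \in X & y \notin A &
    forall x y, x \in A -> y \in X -> e x y -> y \in A].
Proof.
rewrite negb_forall => /existsP[A]; rewrite negb_imply => /andP[/and3P[sA nA cA] neA].
exists A; split=> //.
  have /properP[_ //] : A \proper X by rewrite properEneq neA.
move=> x y xA yX exy; move/forall_inP: cA => /(_ _ xA)/forall_inP/(_ _ yX)/implyP.
exact.
Qed.

Lemma conn1 e x : conn e [set x].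
Proof.
apply/connP => A; rewrite subset1 => /orP[/eqP->//|/eqP-> ]; by rewrite eqxx.
Qed.

Lemma bag1 e x : bag e [set x].
Proof. by rewrite /bag conn1 -card_gt0 cards1. Qed.

Lemma bagP e X x : x \in X -> conn e X -> bag e X.
Proof. by rewrite /bag => xX ->; rewrite andbT; apply/set0Pn; exists x. Qed.

Lemma conn_closed e X A x : conn e X -> A \subset X -> x \in A ->
  (forall x y, x \in A -> y \in X -> e x y -> y \in A) -> A = X.
Proof. by move/connP => cX sA xA; apply: cX => //; apply/set0Pn; exists x. Qed.

Lemma conn_sub e X A x : conn e X -> x \in X -> x \in A ->
  (forall x y, x \in A -> y \in X -> e x y -> y \in A) -> X \subset A.
Proof.
move=> cX xX xA cA; apply/setIidPl; rewrite setIC; apply: (conn_closed cX (x := x)).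
- exact: subsetIr.
- by rewrite inE xA.
- by move=> u v; rewrite !inE => /andP[uA uX] vX euv; rewrite vX (cA _ _ uA vX euv).
Qed.

Lemma connU e X Y : symmetric e -> conn e X -> conn e Y -> touch e X Y ->
  conn e (X :|: Y).
Proof.
move=> es cX cY /touchP[x [y [xX yY exy]]]; apply/connP => A sA /set0Pn[z zA] cA.
have hX u : u \in A -> u \in X -> X \subset A.
  move=> uA uX; apply: (conn_sub cX uX uA) => a b aA bX; apply: cA => //.
  by rewrite inE bX.
have hY u : u \in A -> u \in Y -> Y \subset A.
  move=> uA uY; apply: (conn_sub cY uY uA) => a b aA bY; apply: cA => //.
  by rewrite inE bY orbT.
apply/eqP; rewrite eqEsubset sA /= subUset.
have : z \in X :|: Y by exact: (subsetP sA).
rewrite inE => /orP[zX|zY].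
  have sX := hX _ zA zX; rewrite sX /=; apply: (hY y) => //.
  by apply: (cA x) => //; rewrite ?(subsetP sX) // inE yY orbT.
have sY := hY _ zA zY; rewrite sY andbT; apply: (hX x) => //.
by apply: (cA y) => //; rewrite ?(subsetP sY) // ?inE ?xX // es.
Qed.

Lemma connU1 e X x : symmetric e -> conn e X -> touch e [set x] X ->
  conn e (x |: X).
Proof. by move=> es cX tX; apply: connU => //; apply: conn1. Qed.

Lemma comp_ex e X x : symmetric e -> x \in X -> exists C : {set T},
  [/\ x \in C, C \subset X, conn e C & forall u v, u \in C -> v \in X -> e u v -> v \in C].
Proof.
move=> es xX; pose P := [pred C : {set T} | [&& x \in C, C \subset X & conn e C]].
have P1 : P [set x] by rewrite /P /= !inE eqxx sub1set xX conn1.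
have [C /maxsetP[/and3P[xC sC cC] mC] _] := maxset_exists P1.
exists C; split=> // u v uC vX euv; apply/negPn/negP => vC.
move: (vC); rewrite -(mC (v |: C)) ?setU11 // ?subsetUr //.
rewrite /P /= !inE xC orbT subUset sub1set vX sC connU1 //.
by apply/touch1P; exists u; rewrite // es.
Qed.

(** A maximal connected proper subset containing [X] misses a single vertex, since adding any vertex
    next to it must already give [K]. *)
Lemma conn_noncut e K X : symmetric e -> conn e K -> conn e X -> X \subset K ->
  X != set0 -> X != K -> exists u, [/\ u \in K, u \notin X & conn e (K :\ u)].
Proof.
move=> es cK cX sX nX neX; pose P := [pred C : {set T} | (C \proper K) && conn e C].
have P1 : P X by rewrite /P /= properEneq neX sX.
have [C /maxsetP[/andP[/properP[sC [y yK yC]] cC] mC] sXC] := maxset_exists P1.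
have [x0 x0X] := set0Pn _ nX.
have [x [u [xC uK uC exu]]] := conn_cut cK sC (subsetP sXC _ x0X) yK yC.
have cuC : conn e (u |: C).
  by apply: connU1 => //; apply/touch1P; exists x; rewrite // es.
have /negP nP : ~~ P (u |: C).
  by apply: contra uC => Pu; rewrite -(mC _ Pu) ?setU11 ?subsetUr.
have {nP} eK : u |: C = K.
  apply/eqP; apply/negPn/negP => ne; apply: nP; rewrite /P /= cuC andbT.
  by rewrite properEneq ne subUset sub1set uK sC.
exists u; split=> //; first by apply: contra uC => /(subsetP sXC).
by rewrite -eK setU1K.
Qed.

Lemma conn_connect e X x y : conn e X -> x \in X -> y \in X ->
  connect [rel u v | [&& e u v, u \in X & v \in X]] x y.
Proof.
set r := [rel u v | _] => cX xX yX.
suff /subsetP/(_ y yX) : X \subset [set z | connect r x z] by rewrite inE.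
have hX z : connect r x z -> z \in X.
  move=> /connectP[p]; elim/last_ind: p z => [z _ ->//|p t _ z].
  by rewrite last_rcons rcons_path /= => /andP[_ /and3P[_ _ tX]] ->.
apply: (conn_sub cX xX); first by rewrite inE.
move=> u v; rewrite !inE => xu vX euv; apply: (connect_trans xu).
by apply: connect1; rewrite /r /= euv vX andbT; apply: hX.
Qed.

Lemma connect_conn e X : (forall x y, x \in X -> y \in X ->
  connect [rel u v | [&& e u v, u \in X & v \in X]] x y) -> conn e X.
Proof.
move=> h; apply/connP => A sA /set0Pn[x xA] cA; apply/eqP; rewrite eqEsubset sA /=.
apply/subsetP => y yX; have /connectP[p] := h _ _ (subsetP sA _ xA) yX.
elim: p x xA => [x xA _ ->//|z p IH x xA /= /andP[/and3P[exz _ zX] pz] ly].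
exact: IH (cA _ _ xA zX exz) pz ly.
Qed.

Lemma connS e1 e2 X : subrel e1 e2 -> conn e1 X -> conn e2 X.
Proof.
move=> s /connP c; apply/connP => A sA nA cA; apply: c => // x y xA yX exy.
by apply: (cA x) => //; apply: s.
Qed.

Definition K33free e := forall a1 a2 a3 b1 b2 b3 : {set T},
  all (bag e) [:: a1; a2; a3; b1; b2; b3] ->
  pairwise (fun X Y : {set T} => [disjoint X & Y]) [:: a1; a2; a3; b1; b2; b3] ->
  allrel (touch e) [:: a1; a2; a3] [:: b1; b2; b3] -> False.

Definition K5free e := forall a1 a2 a3 a4 a5 : {set T},
  all (bag e) [:: a1; a2; a3; a4; a5] ->
  pairwise (fun X Y : {set T} => [disjoint X & Y] && touch e X Y)
    [:: a1; a2; a3; a4; a5] -> False.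

End Conn.

(** The vertex set stays [T]: [f] sends each vertex to the representative of its class, and elements
    outside the image of [f] become isolated. *)
Definition contract (T : finType) (e : rel T) (f : T -> T) : rel T :=
  [rel x y | (x != y) && [exists x', exists y', [&& f x' == x, f y' == y & e x' y']]].

Section Quo.
Variables (T : finType) (e : rel T) (f : T -> T).
Hypothesis es : symmetric e.
Hypothesis cf : forall y, conn e [set x | f x == y].

Lemma contractP x y : reflect (x != y /\ exists x' y', [/\ f x' = x, f y' = y & e x' y'])
  (contract e f x y).
Proof.
apply: (iffP andP) => -[xy]; split=> //.
  by case/existsP: b => x' /existsP[y' /and3P[/eqP ? /eqP ? ?]]; exists x', y'.
case: b => x' [y' [<- <- exy]]; apply/existsP; exists x'; apply/existsP; exists y'.
by rewrite !eqxx.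
Qed.

Lemma contract_sym : symmetric (contract e f).
Proof.
by move=> x y; apply/contractP/contractP => -[xy [x' [y' [? ? ?]]]]; split; rewrite 1?eq_sym //;
  exists y', x'; rewrite es.
Qed.

Lemma contract_irr : irreflexive (contract e f).
Proof. by move=> x; rewrite /contract /= eqxx. Qed.

Lemma contract_conn X : conn (contract e f) X -> conn e (f @^-1: X).
Proof.
move=> cX; apply/connP => A sA /set0Pn[a aA] cA; apply/eqP; rewrite eqEsubset sA /=.
have fib z : z \in A -> [set x | f x == f z] \subset A.
  move=> zA; apply: (conn_sub (cf (f z)) (x := z)) => //; first by rewrite inE.
  move=> u v uA; rewrite inE => /eqP fv euv; apply: (cA u) => //.
  by move/(subsetP sA): zA; rewrite !inE fv.
suff sX : X \subset X :&: (f @: A).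
  apply/subsetP => x; rewrite inE => /(subsetP sX); rewrite inE.
  case/andP => _ /imsetP[z zA fx]; apply: (subsetP (fib _ zA)); by rewrite inE fx.
have faX : f a \in X by move/(subsetP sA): aA; rewrite inE.
apply: (conn_sub cX faX); first by rewrite inE faX imset_f.
move=> u v; rewrite !inE => /andP[uX /imsetP[z zA ->]] vX /contractP[_ [x [y [fx fy exy]]]].
have xA : x \in A by apply: (subsetP (fib _ zA)); rewrite inE fx.
rewrite vX -fy imset_f //; apply: (cA x) => //; by rewrite inE fy.
Qed.

Lemma contract_touch X Y : touch (contract e f) X Y -> touch e (f @^-1: X) (f @^-1: Y).
Proof.
move=> /touchP[x [y [xX yY /contractP[_ [x' [y' [fx fy exy]]]]]]].
by apply/touchP; exists x', y'; rewrite !inE fx fy.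
Qed.

(** A single element outside the image of [f] is a bag with empty preimage; an edge towards [Y]
    rules this out. *)
Lemma contract_bag X Y : bag (contract e f) X -> touch (contract e f) X Y -> bag e (f @^-1: X).
Proof.
move=> /andP[_ cX] /contract_touch/touchP[x [y [xX _ _]]].
exact: (bagP xX (contract_conn cX)).
Qed.

Lemma contract_disj (X Y : {set T}) : [disjoint X & Y] -> [disjoint f @^-1: X & f @^-1: Y].
Proof. by move=> d; apply: disjP => z; rewrite !inE; apply: disjE. Qed.

Lemma contract_K33 : K33free e -> K33free (contract e f).
Proof.
move=> h a1 a2 a3 b1 b2 b3 /=.
rewrite /allrel /= !andbT.
move=> /and5P[B1 B2 B3 B4 /andP[B5 B6]].
move=> /and5P[/and5P[? ? ? ? ?] /and4P[? ? ? ?] /and3P[? ? ?] /andP[? ?] ?].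
move=> /and3P[/and3P[? ? ?] /and3P[? ? ?] /and3P[? ? ?]].
have ts X Y : touch (contract e f) X Y -> touch (contract e f) Y X.
  by rewrite (touch_sym _ _ contract_sym).
apply: (h (f @^-1: a1) (f @^-1: a2) (f @^-1: a3) (f @^-1: b1) (f @^-1: b2)
  (f @^-1: b3)); rewrite /allrel /= ?contract_disj ?contract_touch //.
rewrite (contract_bag (Y := b1) B1) // (contract_bag (Y := b1) B2) // (contract_bag (Y := b1) B3) //.
rewrite (contract_bag (Y := a1) B4) ?(contract_bag (Y := a1) B5) ?(contract_bag (Y := a1) B6) //;
  exact: ts.
Qed.

Lemma contract_K5 : K5free e -> K5free (contract e f).
Proof.
move=> h a1 a2 a3 a4 a5 /=; rewrite !andbT.
move=> /and5P[B1 B2 B3 B4 B5].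
move=> /and4P[/and4P[/andP[? ?] /andP[? ?] /andP[? ?] /andP[? ?]]
  /and3P[/andP[? ?] /andP[? ?] /andP[? ?]] /andP[/andP[? ?] /andP[? ?]] /andP[? ?]].
have ts X Y : touch (contract e f) X Y -> touch (contract e f) Y X.
  by rewrite (touch_sym _ _ contract_sym).
apply: (h (f @^-1: a1) (f @^-1: a2) (f @^-1: a3) (f @^-1: a4) (f @^-1: a5));
  rewrite /= ?contract_disj ?contract_touch //.
rewrite (contract_bag (Y := a2) B1) // (contract_bag (Y := a3) B2) // (contract_bag (Y := a4) B3) //.
rewrite (contract_bag (Y := a1) B4) ?(contract_bag (Y := a1) B5) //; exact: ts.
Qed.
End Quo.

(** * Consequences of excluding K5 and K33 minors *)

Section Link.
Variables (T : finType) (e : rel T).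
Hypotheses (es : symmetric e) (ei : irreflexive e).
Implicit Types (X W Z C D E F R : {set T}).

Definition component X C := [/\ C \subset X, bag e C &
  forall u v, u \in C -> v \in X -> e u v -> v \in C].

Lemma component_of X x : x \in X -> exists C, component X C /\ x \in C.
Proof.
move=> xX; have [C [xC sC cC clC]] := comp_ex es xX.
by exists C; split=> //; split=> //; apply: bagP xC cC.
Qed.

Lemma component_eq X C D z : component X C -> component X D -> z \in C -> z \in D -> C = D.
Proof.
move=> [sC /andP[_ cC] clC] [sD /andP[_ cD] clD] zC zD; apply/eqP; rewrite eqEsubset.
rewrite (conn_sub cC zC zD) => [|u v uD vC]; last by apply: clD; rewrite ?(subsetP sC).
rewrite (conn_sub cD zD zC) // => u v uC vD; by apply: clC; rewrite ?(subsetP sD).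
Qed.

(** The component of [s] in [s |: X] can be left only towards [z]. The vertex where this happens is
    [s] itself or lies in the wanted component. *)
Lemma component_link X s z : conn e (s |: (z |: X)) -> s != z -> s \notin X -> z \notin X ->
  e s z \/ exists C, [/\ component X C, touch e [set s] C & touch e C [set z]].
Proof.
move=> cX sz sX zX.
have sR : s \in s |: X by rewrite setU11.
have [R [[sRX bR clR] sinR]] := component_of sR.
have zR : z \notin R.
  by apply/negP => /(subsetP sRX); rewrite !inE eq_sym (negPf sz) (negPf zX).
have RsX : R \subset s |: (z |: X).
  by apply: (subset_trans sRX); apply: setUS; apply: subsetUr.
have zsX : z \in s |: (z |: X) by rewrite !inE eqxx orbT.
have [x [y [xR yX yR exy]]] := conn_cut cX RsX sinR zsX zR.
have yz : y = z.
  move: yX; rewrite !inE => /or3P[/eqP ys|/eqP//|yX]; first by rewrite ys sinR in yR.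
  by rewrite (clR x y) // ?inE ?yX ?orbT // in yR.
rewrite {y yX yR}yz in exy.
have := subsetP sRX _ xR; rewrite !inE => /orP[/eqP xs|xX]; first by left; rewrite -xs.
right; have [C [[sC bC clC] xC]] := component_of xX; exists C; split=> //; last first.
  by rewrite touch_sym //; apply/touch1P; exists x; rewrite // es.
have [_ cR] := andP bR.
have CR : C \subset R.
  have [_ cC] := andP bC; apply: (conn_sub cC xC xR) => u v uR vC; apply: clR => //.
  by rewrite inE (subsetP sC) ?orbT.
have sC' : s \notin C by apply: contra sX => /(subsetP sC).
have [a [b [aC bR' bC' eab]]] := conn_cut cR CR xC sinR sC'.
have := subsetP sRX _ bR'; rewrite !inE => /orP[/eqP bs|bX].
  by apply/touch1P; exists a; rewrite // es -bs.
by rewrite (clC _ _ aC bX eab) in bC'.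
Qed.

Hypotheses (K5 : K5free e) (K33 : K33free e).

(** Replaces the planar fact that an outer vertex without separating chords has only two outer
    neighbours. Each pair of the [s] is linked through the rest of [W]. A component touching all
    three gives [K33] together with [Z] and [v]; otherwise the three links are disjoint and, hung on
    one [s] each, give [K5] with [Z] and [v]. *)
Lemma three_common Z W v s1 s2 s3 : bag e Z -> [disjoint Z & W] -> v \in W ->
  s1 \in W -> s2 \in W -> s3 \in W -> s1 != s2 -> s1 != s3 -> s2 != s3 ->
  e v s1 -> e v s2 -> e v s3 -> touch e Z [set v] ->
  touch e Z [set s1] -> touch e Z [set s2] -> touch e Z [set s3] ->
  conn e (W :\: [set v; s1]) -> conn e (W :\: [set v; s2]) ->
  conn e (W :\: [set v; s3]) -> False.
Proof.
move=> bZ dZW vW s1W s2W s3W n12 n13 n23 ev1 ev2 ev3 tv t1 t2 t3 c1 c2 c3.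
have n21 : s2 != s1 by rewrite eq_sym.
have n31 : s3 != s1 by rewrite eq_sym.
have n32 : s3 != s2 by rewrite eq_sym.
pose X := W :\: [set v; s1; s2; s3].
have nv1 : v != s1 by apply: contraTneq ev1 => ->; rewrite ei.
have nv2 : v != s2 by apply: contraTneq ev2 => ->; rewrite ei.
have nv3 : v != s3 by apply: contraTneq ev3 => ->; rewrite ei.
have vX : v \notin X by rewrite !inE eqxx.
have X1 : s1 \notin X by rewrite !inE eqxx orbT.
have X2 : s2 \notin X by rewrite !inE eqxx orbT.
have X3 : s3 \notin X by rewrite !inE eqxx orbT.
have sXW : X \subset W by apply: subsetDl.
have zW z : z \in Z -> z \in W -> False by apply: disjE.
have zv : v \notin Z by apply/negP => /zW /(_ vW).
have z1 : s1 \notin Z by apply/negP => /zW /(_ s1W).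
have z2 : s2 \notin Z by apply/negP => /zW /(_ s2W).
have z3 : s3 \notin Z by apply/negP => /zW /(_ s3W).
have eX a b c : [set a; b; c] = [set s1; s2; s3] -> a != b -> a != c -> b != c ->
    W :\: [set v; c] = a |: (b |: X).
  move=> eabc nab nac nbc; apply/setP => x.
  have /setP/(_ x) := eabc; rewrite !inE => h.
  have aW : a \in W.
    by have /setP/(_ a) := eabc; rewrite !inE eqxx => /esym/orP[/orP[]|] /eqP->.
  have bW : b \in W.
    by have /setP/(_ b) := eabc; rewrite !inE eqxx orbT => /esym/orP[/orP[]|] /eqP->.
  have va : v != a.
    by have /setP/(_ a) := eabc; rewrite !inE eqxx => /esym/orP[/orP[]|] /eqP->.
  have vb : v != b.
    by have /setP/(_ b) := eabc; rewrite !inE eqxx orbT => /esym/orP[/orP[]|] /eqP->.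
  have [xa|xa] := eqVneq x a.
    by rewrite xa aW andbT /= negb_or nac eq_sym va.
  have [xb|xb] := eqVneq x b.
    by rewrite xb bW andbT /= negb_or nbc eq_sym vb.
  by move: h; rewrite (negPf xa) (negPf xb) /= -!orbA => <-.
have triple C : component X C -> touch e C [set s1] -> touch e C [set s2] ->
    touch e C [set s3] -> False.
  move=> [sC bC _] tC1 tC2 tC3.
  apply: (K33 (a1 := Z) (a2 := [set v]) (a3 := C) (b1 := [set s1]) (b2 := [set s2])
     (b3 := [set s3])).
  - by rewrite /= bZ bC !bag1.
  - have C0 z : z \notin X -> z \notin C by apply: contra => /(subsetP sC).
    have dZC : [disjoint Z & C].
      by apply: disjP => z zZ /(subsetP sC)/(subsetP sXW); apply: zW zZ.
    have dx (A : {set T}) x : x \notin A -> [disjoint A & [set x]].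
      by move=> h; rewrite disjoint_sym disjoints1.
    by rewrite /= dZC !dx ?C0 ?inE // ?disjoints1 ?C0 ?inE ?eqxx ?orbT //= 1?eq_sym.
  - by rewrite /allrel /= t1 t2 t3 !touch1 ev1 ev2 ev3 tC1 tC2 tC3.
(* A direct edge between [a] and [b] is recorded as the link [set0]. *)
have lk a b c : [set a; b; c] = [set s1; s2; s3] -> a != b -> a != c -> b != c ->
    conn e (W :\: [set v; c]) -> a \notin X -> b \notin X -> exists E : {set T},
      [/\ E = set0 \/ component X E /\ touch e E [set a] /\ touch e E [set b],
          conn e (a |: E) & touch e (a |: E) [set b]].
  move=> eabc nab nac nbc; rewrite (eX a b c) // => cc aX bX.
  have [eab|[C [cC tC1 tC2]]] := component_link cc nab aX bX.
    exists set0; rewrite setU0 touch1; split=> //; [by left|exact: conn1].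
  exists C; rewrite touch_sym // in tC1; split; first by right.
    by apply: connU1; rewrite // 1?touch_sym //; case: cC => _ /andP[].
  by apply: touchS tC2; rewrite ?subxx ?subsetUr.
have [E12 [h12 cE12 tE12]] := lk s1 s2 s3 erefl n12 n13 n23 c3 X1 X2.
have e231 : [set s2; s3; s1] = [set s1; s2; s3] by apply/setP=>x; rewrite !inE; case: (x == s1); case: (x == s2); case: (x == s3).
have [E23 [h23 cE23 tE23]] := lk s2 s3 s1 e231 n23 n21 n31 c1 X2 X3.
have e312 : [set s3; s1; s2] = [set s1; s2; s3] by apply/setP=>x; rewrite !inE; case: (x == s1); case: (x == s2); case: (x == s3).
have [E31 [h31 cE31 tE31]] := lk s3 s1 s2 e312 n31 n32 n12 c2 X3 X1.
have sE E a b : E = set0 \/ component X E /\ touch e E [set a] /\ touch e E [set b] ->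
    E \subset X by case=> [->|[[]]//]; rewrite sub0set.
have S12 := sE _ _ _ h12; have S23 := sE _ _ _ h23; have S31 := sE _ _ _ h31.
have dE E F a b c : E = set0 \/ component X E /\ touch e E [set a] /\ touch e E [set b] ->
   F = set0 \/ component X F /\ touch e F [set b] /\ touch e F [set c] ->
   [set a; b; c] = [set s1; s2; s3] -> [disjoint E & F].
  case=> [->|[cE [ta tb]]]; first by rewrite disjoints_subset sub0set.
  case=> [->|[cF [tb' tc]]]; first by rewrite disjoint_sym disjoints_subset sub0set.
  move=> eabc; apply: disjP => z zE zF; have EF := component_eq cE cF zE zF; subst F.
  have tt s : s \in [set s1; s2; s3] -> touch e E [set s].
    by rewrite -eabc !inE => /orP[/orP[]|] /eqP->.
  by apply: (triple E) => //; apply: tt; rewrite !inE eqxx ?orbT.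
have D1 := dE _ _ _ _ _ h12 h23 erefl.
have D2 := dE _ _ _ _ _ h23 h31 e231.
have D3 := dE _ _ _ _ _ h31 h12 e312.
have dd (E F : {set T}) a b : a != b -> E \subset X -> F \subset X -> [disjoint E & F] ->
    a \notin X -> b \notin X -> [disjoint a |: E & b |: F].
  move=> nab sEX sFX d aX bX; apply: disjP => z; rewrite !inE.
  move=> /orP[/eqP->|zE] /orP[/eqP h|zF].
  - by rewrite h eqxx in nab.
  - by rewrite (subsetP sFX) in aX.
  - by rewrite -h (subsetP sEX) in bX.
  - exact: disjE d zE zF.
have dZ (E : {set T}) a : a \notin Z -> E \subset X -> [disjoint Z & a |: E].
  move=> aZ sEX; apply: disjP => z zZ; rewrite !inE => /orP[/eqP za|zE].
    by rewrite -za zZ in aZ.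
  by apply: (zW z) => //; apply: (subsetP sXW); apply: (subsetP sEX).
have dv (E : {set T}) a : v != a -> E \subset X -> [disjoint [set v] & a |: E].
  move=> va sEX; rewrite disjoints1 !inE negb_or va /=.
  by apply: contra vX => /(subsetP sEX).
have tS (A E : {set T}) a : touch e A [set a] -> touch e A (a |: E).
  by apply: touchS; rewrite ?subxx ?sub1set ?setU11.
have bU (E : {set T}) a : conn e (a |: E) -> bag e (a |: E).
  by move=> h; apply: (bagP (x := a)) => //; rewrite setU11.
apply: (K5 (a1 := Z) (a2 := [set v]) (a3 := s1 |: E12) (a4 := s2 |: E23)
  (a5 := s3 |: E31)).
  by rewrite /= bZ bag1 !bU.
rewrite /= tv !dZ // !dv // !dd //= ?(disjoint_sym E12 E31) //.
rewrite disjoint_sym disjoints1 zv /=.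
rewrite !(tS Z) // !(tS [set v]) ?touch1 //.
rewrite (tS (s1 |: E12) _ s2) // (tS (s2 |: E23)) // !andbT /=.
by rewrite touch_sym // (tS (s3 |: E31)).
Qed.

Definition nbr (x : T) X := [set y in X | e x y].

(* A separation of order at most two along a clique, chosen with a smallest side. *)
Lemma apex_K4 w o (H : {set T}) x0 : w \notin H -> (forall x, x \in H -> e w x) ->
  (forall x, x \in H -> x != o -> 2 < #|nbr x H|) -> x0 \in H -> x0 != o -> False.
Proof.
move=> wH wu deg x0H x0o.
(* [A] is the side and [P] the clique to which it is attached. The vertex [o], the only one allowed
   a small degree, never lies in [A]. *)
suff main n : forall A P : {set T}, #|A| <= n -> A != set0 -> A \subset H -> o \notin A ->
    P \subset H -> [disjoint A & P] ->
    (forall p q, p \in P -> q \in P -> p != q -> e p q) ->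
    (forall x y, x \in A -> y \in H -> e x y -> y \in A :|: P) -> False.
  apply: (main #|H :\ o| (H :\ o) (H :&: [set o])) => //.
  - by apply/set0Pn; exists x0; rewrite !inE x0o.
  - exact: subsetDl.
  - by rewrite !inE eqxx.
  - exact: subsetIl.
  - by apply: disjP => z; rewrite !inE => /andP[/negPf ->]; rewrite andbF.
  - by move=> p q; rewrite !inE => /andP[_ /eqP->] /andP[_ /eqP->]; rewrite eqxx.
  - by move=> x y xH yH exy; rewrite !inE yH; case: eqP.
elim: n => [|n IH] A P.
  by rewrite leqn0 cards_eq0 => /eqP-> /eqP.
move=> sz /set0Pn[y yA] sAH oA sPH dAP clP clA.
have yH := subsetP sAH _ yA.
have yo : y != o by apply: contraNneq oA => <-.
have /card_gt2P[s1 [s2 [s3 [[s1n s2n s3n] [n12 n23 n31]]]]] := deg _ yH yo.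
pose W := A :|: P.
have sWH : W \subset H by rewrite subUset sAH.
have inW s : s \in nbr y H -> s \in W /\ e y s.
  by rewrite inE => /andP[sH eys]; split=> //; apply: (clA y).
have yW : y \in W by rewrite inE yA.
(* If [y] and [s] separated [W], one part would avoid [P], because [P] is a clique; attached at the
   edge between [y] and [s] it would be a smaller side. *)
have step s : s \in nbr y H -> conn e (W :\: [set y; s]).
  move=> /inW[sW eys]; apply/negPn/negP => /disconn[A1 [sA1 nA1 [y1 y1W y1A] clA1]].
  have fin (A' : {set T}) : A' \subset W :\: [set y; s] -> A' != set0 -> [disjoint A' & P] ->
     (forall u v, u \in A' -> v \in W :\: [set y; s] -> e u v -> v \in A') -> False.
    move=> sA' nA' dA' clA'.
    have sA'A : A' \subset A :\ y.
      apply/subsetP => z zA'; have := subsetP sA' _ zA'; rewrite !inE negb_or.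
      case/andP => /andP[-> _] /orP[//|zP]; by case: (disjE dA' zA' zP).
    apply: (IH A' [set y; s]) => //.
    - rewrite -ltnS; apply: leq_trans sz; rewrite (cardsD1 y A) yA.
      exact: subset_leq_card.
    - exact: subset_trans sA'A (subset_trans (subsetDl _ _) sAH).
    - by apply: contra oA => /(subsetP sA'A); rewrite inE => /andP[].
    - by apply/subsetP => z; rewrite !inE => /orP[] /eqP-> //; apply: (subsetP sWH).
    - by apply: disjP => z /(subsetP sA'); rewrite inE => /andP[/negP].
    - move=> p q; rewrite !inE => /orP[] /eqP-> /orP[] /eqP->; rewrite ?eqxx //.
      by rewrite es.
    - move=> u v uA' vH euv; rewrite inE orbC; apply/orP.
      have [|vn] := boolP (v \in [set y; s]); [by left|right].
      apply: (clA' u) => //; rewrite inE vn; apply: (clA u) => //.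
      by have := subsetP sA'A _ uA'; rewrite inE => /andP[].
  have [d|] := boolP [disjoint A1 & P]; first exact: fin clA1.
  rewrite -setI_eq0 => /set0Pn[q]; rewrite inE => /andP[qA1 qP].
  apply: (fin ((W :\: [set y; s]) :\: A1)).
  - exact: subsetDl.
  - by apply/set0Pn; exists y1; rewrite inE y1A.
  - apply: disjP => z; rewrite inE => /andP[zA1 zW] zP.
    have zq : z != q by apply: contraNneq zA1 => ->.
    by move: zA1; rewrite (clA1 q) // es clP.
  - move=> u v; rewrite !(in_setD _ A1) => /andP[uA1 uW] vW euv; rewrite vW andbT.
    by apply: contra uA1 => vA1; apply: (clA1 v) => //; rewrite es.
have [s1W e1] := inW _ s1n; have [s2W e2] := inW _ s2n; have [s3W e3] := inW _ s3n.
have wx z : z \in W -> touch e [set w] [set z].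
  by move=> /(subsetP sWH) zH; rewrite touch1 wu.
apply: (three_common (Z := [set w]) (W := W) (v := y) (s1 := s1) (s2 := s2) (s3 := s3));
  rewrite ?bag1 ?wx ?step //.
- by rewrite disjoints1; apply: contra wH => /(subsetP sWH).
- by rewrite eq_sym.
Qed.
End Link.

Lemma conn0 (T : finType) (e : rel T) : conn e set0.
Proof. by apply/connP => A; rewrite subset0 => ->. Qed.

(** [O] is contracted to a vertex [o], which [apex_K4] excuses from the degree condition; so [O]
    counts once in each degree. *)
Lemma apex_K4_bag (T : finType) (e : rel T) (w x0 : T) (D O : {set T}) :
  symmetric e -> irreflexive e -> K5free e -> K33free e -> [disjoint D & O] ->
  w \notin D -> w \notin O -> conn e O -> touch e [set w] O ->
  (forall x, x \in D -> e w x) ->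
  (forall x, x \in D -> 2 < #|nbr e x D| + touch e [set x] O) -> x0 \in D -> False.
Proof.
move=> es ei K5 K33 dDO wD wO cO /touch1P[o oO ewo] wu deg x0D.
pose f z := if z \in O then o else z.
have cf y : conn e [set x | f x == y].
  have [yO|yO] := boolP (y \in O).
    have [->|yo] := eqVneq y o.
      suff -> : [set x | f x == o] = O by [].
      apply/setP => x; rewrite inE /f; case: ifP => [_|xO]; first by rewrite eqxx.
      by apply/eqP => xo; rewrite xo oO in xO.
    suff -> : [set x | f x == y] = set0 by apply: conn0.
    apply/setP => x; rewrite !inE /f; case: ifP => [_|xO]; first by rewrite eq_sym (negPf yo).
    by apply/eqP => xy; rewrite xy yO in xO.
  suff -> : [set x | f x == y] = [set y] by apply: conn1.
  apply/setP => x; rewrite !inE /f; case: ifP => // xO.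
  rewrite (_ : (x == y) = false); last by apply/eqP => xy; rewrite -xy xO in yO.
  by apply/eqP => oy; rewrite -oy oO in yO.
have fD x : x \in D -> f x = x.
  by move=> xD; rewrite /f; case: ifP => // /(disjE dDO xD).
have fO x : x \in O -> f x = o by rewrite /f => ->.
have oD : o \notin D by apply/negP => h; apply: disjE dDO h oO.
have fw : f w = w by rewrite /f (negPf wO).
have x0o : x0 != o by apply: contraNneq oD => <-.
apply: (@apex_K4 _ (contract e f) (contract_sym f es) (@contract_irr _ _ _) (contract_K5 es cf K5)
  (contract_K33 es cf K33) w o (o |: D) x0) => //.
- by rewrite !inE negb_or wD andbT; apply: contraNneq wO => ->.
- move=> x; rewrite !inE => /orP[/eqP->|xD]; apply/contractP; split.
  + by apply: contraNneq wO => ->.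
  + by exists w, o; rewrite fw fO.
  + by apply: contraNneq wD => ->.
  + by exists w, x; rewrite fw fD // wu.
- move=> x; rewrite !inE => /orP[/eqP->|xD xo]; first by rewrite eqxx.
  apply: leq_trans (deg _ xD) _.
  have sN : nbr e x D \subset nbr (contract e f) x (o |: D) :\ o.
    apply/subsetP => y; rewrite !inE => /andP[yD exy].
    rewrite yD orbT /=; apply/andP; split; first by apply: contraNneq oD => <-.
    apply/contractP; split; last by exists x, y; rewrite !fD.
    by apply: contraTneq exy => ->; rewrite ei.
  rewrite (cardsD1 o (nbr (contract e f) x (o |: D))) addnC leq_add ?subset_leq_card //.
  case: touch1P => //= -[y yO exy]; rewrite !inE eqxx lt0b /=.
  by apply/contractP; split=> //; exists x, y; rewrite fD // fO.
- by rewrite !inE x0D orbT.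
Qed.

(** * Thomassen's induction around a connected bag *)

Lemma card_setD1_ge (C : finType) (A : {set C}) c n : n < #|A| -> n <= #|A :\ c|.
Proof. by rewrite (cardsD1 c A); case: (c \in A) => //=; rewrite add0n => /ltnW. Qed.

Lemma card_setD_ge (C : finType) (A B : {set C}) n m :
  n + m <= #|A| -> #|B| <= m -> n <= #|A :\: B|.
Proof.
move=> nm Bm; rewrite cardsD leq_subRL; last by apply: subset_leq_card; apply: subsetIl.
apply: leq_trans nm; rewrite addnC leq_add2l; apply: leq_trans Bm.
by apply: subset_leq_card; apply: subsetIr.
Qed.

Lemma conn_attach (T : finType) (e : rel T) (Z P : {set T}) : symmetric e ->
  bag e Z -> (forall p, p \in P -> touch e Z [set p]) -> bag e (P :|: Z).
Proof.
move=> es /andP[/set0Pn[z zZ] cZ] tP; apply: (bagP (x := z)); first by rewrite inE zZ orbT.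
apply/connP => A sA /set0Pn[a aA] cA.
have sZ : Z \subset A.
  have [b bA bZ] : exists2 b, b \in A & b \in Z.
    have := subsetP sA _ aA; rewrite inE => /orP[aP|]; last by exists a.
    have /touchP[b [a' [bZ]]] := tP _ aP; rewrite inE => /eqP-> eba; exists b => //.
    by apply: (cA a); rewrite // 1?es // inE bZ orbT.
  by apply: (conn_sub cZ bZ bA) => u v uA vZ; apply: cA => //; rewrite inE vZ orbT.
apply/eqP; rewrite eqEsubset sA subUset sZ andbT /=; apply/subsetP => p pP.
have /touchP[b [p' [bZ]]] := tP _ pP; rewrite inE => /eqP-> ebp.
by apply: (cA b); rewrite ?(subsetP sZ) // inE pP.
Qed.

Section Thomassen.
Variables (T C : finType) (e : rel T) (c0 : C).
Hypotheses (es : symmetric e) (ei : irreflexive e).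
Hypotheses (K5 : K5free e) (K33 : K33free e).

Definition lcol (W : {set T}) (L : T -> {set C}) (phi : T -> C) :=
  (forall v, v \in W -> phi v \in L v) /\
  (forall u v, u \in W -> v \in W -> e u v -> phi u != phi v).

(* Thomassen's induction, with the outer face replaced by a connected bag Z
   whose neighbours play the role of the outer vertices; P is precoloured. *)
Lemma thomassen_bag n (Z W P : {set T}) (L : T -> {set C}) :
  #|W| * 3 + (2 - #|P|) < n -> bag e Z -> [disjoint Z & W] -> P \subset W ->
  #|P| <= 2 -> (forall p, p \in P -> touch e Z [set p]) ->
  (forall p q, p \in P -> q \in P -> p != q -> e p q /\ [disjoint L p & L q]) ->
  (forall p, p \in P -> 0 < #|L p|) ->
  (forall v, v \in W -> v \notin P -> touch e Z [set v] -> 2 < #|L v|) ->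
  (forall v, v \in W -> ~~ touch e Z [set v] -> 4 < #|L v|) ->
  exists phi, lcol W L phi.
Proof.
(* The measure also drops when one more vertex is precoloured. The factor three makes the loss of
   vertices of [W] outweigh a return to an empty [P]. *)
elim: n Z W P L => // n IH Z W P L.
rewrite ltnS => sz bZ dZW sPW P2 tP clP L1 L3 L5.
have [W0|nW] := boolP (W == set0).
  by exists (fun=> c0); split=> u; rewrite (eqP W0) inE.
have Lne v : v \in W -> 0 < #|L v|.
  move=> vW; have [vP|vP] := boolP (v \in P); first exact: L1.
  have [tv|tv] := boolP (touch e Z [set v]); first by have := L3 v vW vP tv; case: #|L v|.
  by have := L5 v vW tv; case: #|L v|.
pose cp v := odflt c0 [pick c in L v].
have cpL v : v \in W -> cp v \in L v.
  move=> vW; rewrite /cp; case: pickP => //= h.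
  by have := Lne v vW; rewrite (eq_card0 h).
have [P0|nP] := boolP (P == set0).
  have [/existsP[p /andP[pW tp]]|/existsPn noext] := boolP
    [exists p, (p \in W) && touch e Z [set p]].
    pose L' v := if v == p then [set cp p] else L v.
    have [||||||||phi [lphi cphi]] := IH Z W [set p] L' _ bZ dZW.
    - apply: leq_trans sz; rewrite (eqP P0) cards0 cards1.
      by rewrite ltn_add2l.
    - by rewrite sub1set.
    - by rewrite cards1.
    - by move=> q /set1P->.
    - by move=> a b /set1P-> /set1P->; rewrite eqxx.
    - by move=> q /set1P->; rewrite /L' eqxx cards1.
    - move=> v vW; rewrite inE /L' => /negPf-> tv; apply: L3 => //.
      by rewrite (eqP P0) inE.
    - move=> v vW tv; rewrite /L'; case: eqP => [vp|_]; last exact: L5.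
      by rewrite vp tp in tv.
    exists phi; split=> // v vW; have := lphi v vW; rewrite /L'.
    by case: eqP => // -> /set1P->; apply: cpL.
  (* [Z] has no neighbour in [W], so a freshly coloured vertex [p] can replace it; the neighbours of
     [p] keep four of their five colours. *)
  have [p pW] := set0Pn _ nW.
  pose L' v := if e p v then L v :\ cp p else L v.
  have L5' v : v \in W -> 4 < #|L v|.
    by move=> vW; apply: L5 => //; have := noext v; rewrite vW.
  have [||||||||||phi [lphi cphi]] := IH [set p] (W :\ p) set0 L'.
  - by rewrite cards0 subn0; move: sz; rewrite (cardsD1 p W) pW /=; lia.
  - exact: bag1.
  - by rewrite disjoints1 !inE eqxx.
  - exact: sub0set.
  - by rewrite cards0.
  - by move=> q; rewrite inE.
  - by move=> a b; rewrite inE.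
  - by move=> q; rewrite inE.
  - move=> v; rewrite !inE => /andP[_ vW] _; rewrite touch1 /L' => ->.
    by apply: card_setD1_ge; apply: ltnW; apply: L5'.
  - by move=> v; rewrite !inE touch1 /L' => /andP[_ vW] /negPf->; apply: L5'.
  exists (fun v => if v == p then cp p else phi v).
  have hv v : v \in W -> v != p -> v \in W :\ p by rewrite !inE => -> ->.
  have sub v : L' v \subset L v by rewrite /L'; case: ifP => // _; apply: subsetDl.
  have np v : v \in W -> v != p -> e p v -> phi v != cp p.
    move=> vW vp epv; have := lphi v (hv _ vW vp); rewrite /L' epv !inE.
    by case/andP.
  split=> [v vW|u v uW vW euv].
    case: eqP => [->|/eqP vp]; [exact: cpL | exact/(subsetP (sub v))/lphi/hv].
  have [up|up] := eqVneq u p; have [vp|vp] := eqVneq v p.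
  - by rewrite up vp ei in euv.
  - by rewrite eq_sym np // -up.
  - by rewrite np // es -vp.
  - by apply: cphi => //; apply: hv.
have [x xP] := set0Pn _ nP.
have xW := subsetP sPW _ xP.
(* No further outer vertex is adjacent to P: absorb P into Z. *)
have [/existsP[v /andP[/and3P[vW vP tv] /existsP[p /andP[pP epv]]]]|noadj] := boolP
  [exists v, [&& v \in W, v \notin P & touch e Z [set v]] &&
             [exists p, (p \in P) && e p v]]; last first.
  have noadj' v p : v \in W -> v \notin P -> touch e Z [set v] -> p \in P -> e p v = false.
    move=> vW vP tv pP; apply/negP => epv; move/existsPn: noadj => /(_ v).
    by rewrite vW vP tv /= => /existsPn/(_ p); rewrite pP epv.
  pose F v := [set cp p | p in P & e p v].
  pose L' v := L v :\: F v.
  have Fle v : #|F v| <= 2.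
    apply: leq_trans (leq_imset_card _ _) _; apply: leq_trans P2.
    by apply: subset_leq_card; apply/subsetP => q; rewrite inE => /andP[].
  have F0 v : (forall p, p \in P -> e p v = false) -> L' v = L v.
    move=> h; rewrite /L' (_ : F v = set0) ?setD0 //.
    apply/setP => c; rewrite inE; apply/imsetP => -[p]; rewrite inE => /andP[pP].
    by rewrite h.
  have [||||||||||phi [lphi cphi]] := IH (P :|: Z) (W :\: P) set0 L'.
  - rewrite cards0 subn0; move: sz; rewrite -(cardsID P W) (setIidPr sPW).
    by have : 0 < #|P| by [rewrite card_gt0]; lia.
  - exact: conn_attach.
  - apply: disjP => z; rewrite !inE => /orP[->//|zZ] /andP[_ zW].
    exact: disjE dZW zZ zW.
  - exact: sub0set.
  - by rewrite cards0.
  - by move=> q; rewrite inE.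
  - by move=> a b; rewrite inE.
  - by move=> q; rewrite inE.
  - move=> v; rewrite !inE => /andP[vP vW] _ tv.
    have [tz|tz] := boolP (touch e Z [set v]).
      by rewrite F0 => [|p pP]; [apply: L3|apply: noadj'].
    by apply: (card_setD_ge (m := 2)) (Fle v); apply: L5.
  - move=> v; rewrite !inE => /andP[vP vW] tv; rewrite F0.
      by apply: L5 => //; apply: contra tv; apply: touchS; rewrite ?subsetUr.
    move=> p pP; apply/negP => epv; move/negP: tv; apply.
    by apply/touchP; exists p, v; rewrite !inE pP eqxx.
  exists (fun v => if v \in P then cp v else phi v); split=> [v vW|u v uW vW euv].
    case: ifP => vP; first exact: cpL.
    by have := lphi v; rewrite inE vP vW => /(_ isT); rewrite inE => /andP[].
  have np p q : p \in P -> q \in W -> q \notin P -> e p q -> phi q != cp p.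
    move=> pP qW qP epq; have := lphi q; rewrite inE qP qW => /(_ isT); rewrite inE => /andP[h _].
    by apply: contraNneq h => ->; apply: imset_f; rewrite inE pP.
  case: ifP => uP; case: ifP => vP.
  - have uv : u != v by apply: contraTneq euv => ->; rewrite ei.
    have [_ d] := clP _ _ uP vP uv; apply/negP => /eqP h.
    by apply: (disjE d) (cpL u uW) _; rewrite h; apply: cpL.
  - by rewrite eq_sym np // vP.
  - by rewrite np ?uP // es.
  - by apply: cphi; rewrite // inE ?uP ?vP.
(* Only one precoloured vertex: precolour v as well. *)
have [P1|P12] := eqVneq #|P| 1.
  have [p' eP] := cards1P (introT eqP P1).
  have pp' : p' = p by move: pP; rewrite eP inE => /eqP.
  rewrite {p'}pp' in eP.
  have [c cLv] : exists c, c \in L v :\ cp p.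
    apply/set0Pn; rewrite -card_gt0; apply: card_setD1_ge.
    by apply: ltnW; apply: L3.
  pose L' u := if u == p then [set cp p] else if u == v then [set c] else L u.
  have vp : v != p by apply: contraNneq vP => ->.
  have pW := subsetP sPW _ pP.
  have [||||||||phi [lphi cphi]] := IH Z W [set p; v] L' _ bZ dZW.
  - by apply: leq_trans sz; rewrite P1 cards2 eq_sym vp ltn_add2l.
  - by rewrite subUset !sub1set pW.
  - by rewrite cards2; case: (_ != _).
  - by move=> q /set2P[] -> //; apply: tP.
  - have cc : cp p != c by move: cLv; rewrite !inE eq_sym => /andP[].
    move=> a b /set2P[] -> /set2P[] ->; rewrite ?eqxx // /L' ?eqxx ?(negPf vp) ?eqxx.
      by rewrite epv disjoints1 inE cc.
    by rewrite es epv disjoints1 inE eq_sym cc.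
  - by move=> q /set2P[] ->; rewrite /L' ?eqxx ?(negPf vp) ?eqxx ?cards1.
  - move=> u uW; rewrite !inE negb_or => /andP[up uv] tu; rewrite /L' (negPf up) (negPf uv).
    by apply: L3; rewrite // eP inE.
  - move=> u uW tu; rewrite /L'.
    case: eqP => [up|_]; first by rewrite up tP in tu.
    case: eqP => [uv|_]; first by rewrite uv tv in tu.
    exact: L5.
  exists phi; split=> // u uW; have := lphi u uW; rewrite /L'.
  case: eqP => [-> /set1P->|_]; first exact: cpL.
  by case: eqP => [-> /set1P->|//]; move: cLv; rewrite !inE => /andP[].
have {P12}P2' : #|P| = 2.
  apply/eqP; rewrite eqn_leq P2 ltn_neqAle eq_sym P12 card_gt0 //.
rewrite P2' subnn addn0 in sz.
pose ext u := (u \in W) && touch e Z [set u].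
(* A separating edge between outer vertices: its ends take their colours from the side containing
   [P] and become the precoloured pair of the other side. *)
have [/existsP[s /existsP[q /and4P[sx qx esq ndis]]]|nosplit] := boolP
  [exists s, exists q, [&& ext s, ext q, e s q & ~~ conn e (W :\: [set s; q])]].
  have [/andP[sW ts] /andP[qW tq]] := (sx, qx).
  have [A [sA nA dA [y1 y1W y1A] clA]] : exists A : {set T},
     [/\ A \subset W :\: [set s; q], A != set0, [disjoint A & P],
      exists2 y, y \in W :\: [set s; q] & y \notin A &
      forall x y, x \in A -> y \in W :\: [set s; q] -> e x y -> y \in A].
    have [A1 [sA1 nA1 [y1 y1W y1A] clA1]] := disconn ndis.
    have [d|] := boolP [disjoint A1 & P].
      by exists A1; split=> //; exists y1.
    rewrite -setI_eq0 => /set0Pn[r]; rewrite inE => /andP[rA1 rP].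
    exists ((W :\: [set s; q]) :\: A1); split.
    - exact: subsetDl.
    - by apply/set0Pn; exists y1; rewrite inE y1A.
    - apply: disjP => z; rewrite inE => /andP[zA1 zW] zP.
      have zr : r != z by apply: contraNneq zA1 => <-.
      by have [erz _] := clP _ _ rP zP zr; rewrite (clA1 r) in zA1.
    - by exists r; rewrite ?(subsetP sA1) // inE rA1.
    - move=> u w; rewrite !(in_setD _ A1) => /andP[uA1 uW] wW euw; rewrite wW andbT.
      by apply: contra uA1 => wA1; apply: (clA1 w) => //; rewrite es.
  have AW : A \subset W by apply: subset_trans sA (subsetDl _ _).
  have sqA r : r \in [set s; q] -> r \notin A.
    by move=> h; apply/negP => /(subsetP sA); rewrite inE h.
  have [a aA] := set0Pn _ nA.
  have [|||||||||phi1 [lphi1 cphi1]] := IH Z (W :\: A) P L _ bZ.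
  - rewrite P2' subnn addn0; apply: leq_trans sz; rewrite ltn_mul2r /=.
    apply: proper_card; apply/properP; split; first exact: subsetDl.
    by exists a; rewrite ?(subsetP AW) // inE aA.
  - by apply: disjP => z zZ; rewrite inE => /andP[_]; apply: disjE zZ.
  - apply/subsetP => z zP; rewrite inE (subsetP sPW) // andbT.
    by apply/negP => zA; apply: disjE dA zA zP.
  - by rewrite P2'.
  - exact: tP.
  - exact: clP.
  - exact: L1.
  - by move=> u; rewrite inE => /andP[_]; apply: L3.
  - by move=> u; rewrite inE => /andP[_]; apply: L5.
  pose L2 u := if u \in [set s; q] then [set phi1 u] else L u.
  have sWA : s \in W :\: A by rewrite inE sW sqA // !inE eqxx.
  have qWA : q \in W :\: A by rewrite inE qW sqA // !inE eqxx orbT.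
  have nsq : s != q by apply: contraTneq esq => ->; rewrite ei.
  have [|||||||||phi2 [lphi2 cphi2]] := IH Z (A :|: [set s; q]) [set s; q] L2 _ bZ.
  - rewrite cards2 nsq subnn addn0; apply: leq_trans sz; rewrite ltn_mul2r /=.
    apply: proper_card; apply/properP; split.
      by rewrite subUset AW subUset !sub1set sW.
    move: y1W; rewrite inE => /andP[y1sq y1W]; exists y1 => //.
    by rewrite inE (negPf y1A).
  - apply: disjP => z zZ zA; apply: (disjE dZW zZ).
    move: zA; rewrite inE => /orP[/(subsetP AW)//|]; by rewrite !inE => /orP[] /eqP->.
  - exact: subsetUr.
  - by rewrite cards2; case: (_ != _).
  - by move=> r /set2P[] ->.
  - have d : phi1 s != phi1 q by apply: cphi1.
    by move=> r t /set2P[] -> /set2P[] ->; rewrite ?eqxx // => _; split;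
      rewrite // 1?es // /L2 !inE !eqxx ?orbT disjoints1 inE // eq_sym.
  - by move=> r rsq; rewrite /L2 rsq cards1.
  - move=> u; rewrite inE /L2 => /orP[uA|->//] usq tu; rewrite (negPf usq).
    apply: L3; rewrite ?(subsetP AW) //; apply/negP; exact: disjE dA uA.
  - move=> u; rewrite inE /L2 => uA tu.
    case: ifP uA => [/set2P[]h|usq]; [by rewrite h ts in tu|by rewrite h tq in tu|].
    by rewrite orbF => uA; apply: L5 => //; apply: (subsetP AW).
  exists (fun u => if u \in A then phi2 u else phi1 u).
  have eqsq r : r \in [set s; q] -> phi2 r = phi1 r.
    move=> rsq; have := lphi2 r; rewrite inE rsq orbT => /(_ isT).
    by rewrite /L2 rsq => /set1P.
  have cross u w : u \in A -> w \in W -> w \notin A -> e u w -> phi2 u != phi1 w.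
    move=> uA wW wA euw; have [wsq|wsq] := boolP (w \in [set s; q]); last first.
      by rewrite (clA u) // inE wsq in wA.
    by rewrite -eqsq //; apply: cphi2; rewrite // inE ?uA ?wsq ?orbT.
  split=> [u uW|u w uW wW euw].
    case: ifP => uA; last by apply: lphi1; rewrite inE uA.
    have := lphi2 u; rewrite inE uA => /(_ isT); rewrite /L2; case: ifP => //.
    by move=> usq; have := sqA _ usq; rewrite uA.
  case: ifP => uA; case: ifP => wA.
  - by apply: cphi2; rewrite // inE ?uA ?wA.
  - by apply: cross => //; rewrite wA.
  - by rewrite eq_sym; apply: cross; rewrite ?uA // es.
  - by apply: cphi1; rewrite // inE ?uA ?wA.
(* No splitting edge: v has at most two outer neighbours and keeps two colours in reserve. *)
have cj r t : ext r -> ext t -> e r t -> conn e (W :\: [set r; t]).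
  move=> xr xt ert; apply/negPn/negP => nc; move/existsPn: nosplit => /(_ r)/existsPn/(_ t).
  by rewrite xr xt ert nc.
have pW := subsetP sPW _ pP.
have vp : v != p by apply: contraNneq vP => ->.
have evp : e v p by rewrite es.
have xv : ext v by rewrite /ext vW.
have xp : ext p by rewrite /ext pW tP.
have [c1 [c2 [c1L c2L c12]]] : exists c1 c2, [/\ c1 \in L v :\ cp p, c2 \in L v :\ cp p & c1 != c2].
  have /card_gt1P[c1 [c2 [? ? ?]]] : 1 < #|L v :\ cp p|.
    by apply: card_setD1_ge; apply: L3.
  by exists c1, c2.
(* The reserved colours are taken only from inner neighbours of [v]. These become outer vertices,
   for which five minus two colours suffice. *)
pose L' u := if u == p then [set cp p] else
  if e v u && ~~ touch e Z [set u] then L u :\: [set c1; c2] else L u.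
have L'sub u : u \in W -> L' u \subset L u.
  rewrite /L' => uW; case: eqP => [->|_]; first by rewrite sub1set cpL.
  by case: ifP => // _; apply: subsetDl.
have vZ : v \notin Z by apply/negP => vZ; apply: disjE dZW vZ vW.
have [||||||||||phi [lphi cphi]] := IH (v |: Z) (W :\ v) P L'.
- by rewrite P2' subnn addn0; move: sz; rewrite (cardsD1 v W) vW /=; clear; lia.
- apply: conn_attach => // r /set1P->; exact: tv.
- apply: disjP => z; rewrite !inE => /orP[->//|zZ] /andP[_ zW]; exact: disjE dZW zZ zW.
- apply/subsetP => r rP; rewrite !inE (subsetP sPW) // andbT.
  by apply: contraNneq vP => <-.
- by rewrite P2'.
- by move=> r rP; apply: touchS (tP _ rP); rewrite ?subsetUr.
- move=> a b aP bP ab; have [eab d] := clP _ _ aP bP ab; split=> //.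
  apply: (disjointWl (L'sub _ _)); rewrite ?(subsetP sPW) //.
  by apply: (disjointWr (L'sub _ _)); rewrite ?(subsetP sPW).
- move=> r rP; rewrite /L'; case: eqP => _; first by rewrite cards1.
  by rewrite tP // andbF; apply: L1.
- move=> u; rewrite !inE /L' => /andP[uv uW] uP tu.
  case: eqP => [up|_]; first by rewrite up pP in uP.
  have [tz|tz] := boolP (touch e Z [set u]); first by rewrite andbF; apply: L3.
  rewrite (_ : e v u).
    by apply: (@card_setD_ge _ _ _ 3 2); rewrite ?cards2 ?c12 //; apply: L5.
  move: tu => /touchP[a [b []]]; rewrite !inE => /orP[/eqP->|aZ] /eqP-> // eau.
  by case/negP: tz; apply/touchP; exists a, u; rewrite inE.
- move=> u; rewrite !inE => /andP[uv uW] tu.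
  have tz : ~~ touch e Z [set u] by apply: contra tu; apply: touchS; rewrite ?subsetUr.
  have evu : e v u = false.
    by apply/negP => evu; case/negP: tu; apply/touchP; exists v, u; rewrite !inE !eqxx.
  rewrite /L' evu /=; case: eqP => [up|_]; first by rewrite up tP in tz.
  exact: L5.
have phip : phi p = cp p.
  have := lphi p; rewrite !inE pW eq_sym vp => /(_ isT).
  by rewrite /L' eqxx => /set1P.
have Wv u : u \in W -> u != v -> u \in W :\ v by rewrite !inE => -> ->.
(* The colour of [p] differs from [c1] and [c2]. Two further outer neighbours [u] and [w] of [v]
   contradict [three_common], so at most one of the reserved colours is taken. *)
have outer u w : ext u -> ext w -> e v u -> e v w -> phi u = c1 -> phi w = c2 -> False.
  move=> /andP[uW tu] /andP[wW tw] evu evw h1 h2.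
  have up : u != p.
    by apply/eqP => up; move: c1L; rewrite -h1 up phip !inE eqxx.
  have wp : w != p.
    by apply/eqP => wp; move: c2L; rewrite -h2 wp phip !inE eqxx.
  have uw : u != w by apply/eqP => uw; rewrite -h1 -h2 uw eqxx in c12.
  apply: (three_common es ei K5 K33 (Z := Z) (W := W) (v := v) (s1 := u) (s2 := w) (s3 := p));
    by rewrite ?cj ?(tP _ pP) ?tu ?tw ?tv // /ext ?uW ?wW ?tu ?tw //.
have [c [cLv cok]] : exists c, c \in L v /\ forall u, u \in W -> e v u -> phi u != c.
  have out u k : u \in W -> e v u -> k \in [set c1; c2] -> ~~ ext u -> phi u != k.
    rewrite /ext => uW evu kc; rewrite uW /= => ntz.
    have uv : u != v by apply: contraTneq evu => ->; rewrite ei.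
    have := lphi u (Wv _ uW uv); rewrite /L' evu ntz /=; case: eqP => [up|_].
      by rewrite up tP in ntz.
    by rewrite inE => /andP[h _]; apply: contraNneq h => ->.
  have [/existsP[u1 /and4P[uW xu evu /eqP pu]]|h1] := boolP
    [exists u, [&& u \in W, ext u, e v u & phi u == c1]].
    exists c2; split=> //; first by move: c2L; rewrite !inE => /andP[].
    move=> w wW evw; have [xw|xw] := boolP (ext w); last first.
      by apply: out => //; rewrite !inE eqxx orbT.
    by apply/eqP => pw; apply: (outer u1 w).
  exists c1; split=> //; first by move: c1L; rewrite !inE => /andP[].
  move=> w wW evw; have [xw|xw] := boolP (ext w); last first.
    by apply: out => //; rewrite !inE eqxx.
  by apply/eqP => pw; move/existsPn: h1 => /(_ w); rewrite wW xw evw pw eqxx.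
exists (fun u => if u == v then c else phi u); split=> [u uW|u w uW wW euw].
  case: eqP => [->//|/eqP uv]; apply: (subsetP (L'sub _ uW)); exact/lphi/Wv.
have [uv|uv] := eqVneq u v; have [wv|wv] := eqVneq w v.
- by rewrite uv wv ei in euw.
- by rewrite eq_sym cok // -uv.
- by rewrite cok // es -wv.
- by apply: cphi => //; apply: Wv.
Qed.
End Thomassen.

(** * Sparse bipartite graphs and orientations *)

Ltac clia := repeat match goal with |- context [card ?A] => move: (card A) => ? end; lia.

Section Bip.
Variable T : finType.
Implicit Types (e : rel T) (V A S : {set T}).

(** Ordered pairs: with [e] symmetric every edge counts twice, and the numerical bounds below are
    doubled accordingly. *)
Definition edges e V := [set p : T * T | [&& p.1 \in V, p.2 \in V & e p.1 p.2]].

Lemma edgesS e V A : A \subset V -> edges e A \subset edges e V.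
Proof.
move=> sA; apply/subsetP => p; rewrite !inE => /and3P[? ? ->].
by rewrite !(subsetP sA).
Qed.

Lemma edges_del e V v : symmetric e ->
  #|edges e V| <= #|edges e (V :\ v)| + 2 * #|nbr e v V|.
Proof.
move=> es; pose l := [set (v, y) | y in nbr e v V].
pose r := [set (y, v) | y in nbr e v V].
have : edges e V \subset edges e (V :\ v) :|: (l :|: r).
  apply/subsetP => -[x y]; rewrite !inE /= => /and3P[xV yV exy]; rewrite xV yV exy.
  have [xv|_] := eqVneq x v; rewrite /=.
    rewrite {x xV}xv in exy *.
    by rewrite (_ : (v, y) \in l) //; apply/imset_f; rewrite inE yV.
  have [yv|_] := eqVneq y v; rewrite //=.
  rewrite {y yV}yv in exy *.
  by rewrite (_ : (x, v) \in r) ?orbT //; apply/imset_f; rewrite inE xV es.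
move=> /subset_leq_card h; apply: (leq_trans h).
apply: (leq_trans (leq_card_setU _ _)); rewrite leq_add2l.
apply: (leq_trans (leq_card_setU _ _)); rewrite mul2n -addnn.
by apply: leq_add; apply: leq_imset_card.
Qed.
Lemma edges_degree e V k : (forall v, v \in V -> k <= #|nbr e v V|) ->
  k * #|V| <= #|edges e V|.
Proof.
move=> h; rewrite -[#|edges e V|]sum1_card.
rewrite (partition_big fst (mem V)) => [|p]; last by rewrite inE => /andP[].
rewrite mulnC -sum_nat_const; apply: leq_sum => v vV; apply: (leq_trans (h v vV)).
rewrite sum1_card -(card_imset _ (f := pair v)); last by move=> a b [].
apply: subset_leq_card; apply/subsetP => _ /imsetP[y yn ->].
move: yn; rewrite inE => /andP[yV evy].
by rewrite unfold_in /= inE /= vV yV evy eqxx.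
Qed.

Lemma K33freeS e1 e2 : subrel e1 e2 -> K33free e2 -> K33free e1.
Proof.
move=> s h a1 a2 a3 b1 b2 b3 B D R; apply: (h a1 a2 a3 b1 b2 b3) => //.
  apply/allP => X /(allP B) /andP[nX cX]; rewrite /bag nX; exact: connS cX.
apply/allrelP => X Y hX hY; move/allrelP: R => /(_ X Y hX hY) /touchP[x [y [xX yY exy]]].
by apply/touchP; exists x, y; split=> //; apply: s.
Qed.

Lemma edges_sep e V S A : A \subset V :\: S -> S \subset V ->
  (forall x y, x \in A -> y \in (V :\: S) :\: A -> e x y = false /\ e y x = false) ->
  #|edges e V| + #|edges e S| <=
  #|edges e (A :|: S)| + #|edges e (((V :\: S) :\: A) :|: S)|.
Proof.
move=> sA sS sep; rewrite -[X in _ <= X]cardsUI leq_add //; apply: subset_leq_card; last first.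
  by rewrite subsetI !edgesS ?subsetUr.
apply/subsetP => -[x y]; rewrite !inE /= => /and3P[xV yV exy]; rewrite xV yV exy !andbT.
have [xS|xS] := boolP (x \in S); have [yS|yS] := boolP (y \in S); rewrite ?orbT //=.
- by rewrite orbF; case: (y \in A).
- by rewrite orbF; case: (x \in A).
rewrite !orbF; have [xA|xA] := boolP (x \in A); have [yA|yA] := boolP (y \in A) => //=.
  have [] := sep x y xA; rewrite ?exy // !inE yA yS yV //.
have [] := sep y x yA; rewrite ?exy // !inE xA xS xV //.
Qed.

Definition bipartite_by e (s : T -> bool) := forall u v, e u v -> s u != s v.

(** The planar bound, twice the vertices minus four, without Euler's formula. A counterexample
    minimal in vertices and then in edges has minimum degree three, and it exceeds the bound by only
    one edge, whence a vertex of degree exactly three. *)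
Lemma bip_bound n : forall m e s V, #|V| <= n -> #|edges e V| <= m -> symmetric e ->
  K33free e -> bipartite_by e s -> 2 < #|V| -> #|edges e V| + 8 <= 4 * #|V|.
Proof.
elim: n => [|n IHn]; first by move=> m e s V; rewrite leqn0 => /eqP->.
elim=> [|m IHm] e s V sV sE es K33 bp V2.
  by move: sE; rewrite leqn0 => /eqP->; lia.
rewrite leqNgt; apply/negP => big.
have eirr x : e x x = false by apply/negP => /bp; rewrite eqxx.
(* Deleting one edge in both directions removes at most two pairs, and the remaining graph obeys the
   bound. *)
have up : #|edges e V| <= 4 * #|V| - 6.
  have [[x y]] : exists p, p \in edges e V.
    by apply/set0Pn; rewrite -card_gt0; move: big V2; clear; clia.
  rewrite inE /= => /and3P[xV yV exy].
  pose e' := [rel u v | e u v && ~~ (((u == x) && (v == y)) || ((u == y) && (v == x)))].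
  have se : subrel e' e by move=> u v /andP[].
  have sub : edges e V \subset (x, y) |: ((y, x) |: edges e' V).
    apply/subsetP => -[u v]; rewrite !inE /= !xpair_eqE => /and3P[-> -> ->] /=.
    by rewrite negb_or; do 2!case: (_ && _).
  have c1 : #|edges e V| <= #|edges e' V| + 2.
    apply: (leq_trans (subset_leq_card sub)); rewrite !cardsU1.
    by case: (_ \notin _); case: (_ \notin _); clear; clia.
  have c2 : #|edges e' V| < #|edges e V|.
    apply: proper_card; apply/properP; split.
      by apply/subsetP => p; rewrite !inE => /and3P[-> -> /se ->].
    by exists (x, y); rewrite !inE /= ?xV ?yV ?exy // !eqxx.
  have es' : symmetric e'.
    by move=> u v; rewrite /= es orbC; congr (_ && ~~ (_ || _)); rewrite andbC.
  have le' : #|edges e' V| <= m by rewrite -ltnS; apply: leq_trans c2 sE.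
  have := IHm e' s V sV le' es' (K33freeS se K33) (fun u v h => bp u v (se u v h)) V2.
  by move: c1 V2; clear; clia.
have [V3|V3] := eqVneq #|V| 3.
  have /card_gt2P[a [b [c [[aV bV cV] [ab bc ca]]]]] := V2.
  have eV : V = [set a; b; c].
    apply/eqP; rewrite eq_sym eqEcard !subUset !sub1set aV bV cV V3 /=.
    by rewrite setUC cardsU1 cards2 !inE negb_or ca eq_sym bc ab.
  have tri x y z : V = [set x; y; z] -> s x = s y -> False.
    move=> exyz sxy.
    have : edges e V \subset [set (x, z); (z, x); (y, z); (z, y)].
      apply/subsetP => -[u v]; rewrite exyz !inE /= => /and3P[hu hv /bp].
      move: hu hv; rewrite !xpair_eqE -!orbA.
      by move=> /or3P[] /eqP-> /or3P[] /eqP->; rewrite ?sxy ?eqxx ?orbT.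
    move=> /subset_leq_card; rewrite -!setUA !cardsU1 cards1.
    move: big; rewrite V3; do 3!case: (_ \notin _); clear; clia.
  have [sab|sab] := eqVneq (s a) (s b); first exact: (tri a b c).
  have [sac|sac] := eqVneq (s a) (s c).
    by apply: (tri a c b) => //; rewrite eV; apply/setP => z; rewrite !inE orbAC.
  apply: (tri b c a); last by case: (s a) (s b) (s c) sab sac => [] [] [].
  by rewrite eV; apply/setP => z; rewrite !inE -orbA orbC.
have {V3}V4 : 3 < #|V| by move: V2 V3; clear; clia.
have deg3 v : v \in V -> 3 <= #|nbr e v V|.
  move=> vV; have := edges_del V v es.
  have cV : #|V| = #|V :\ v|.+1 by rewrite (cardsD1 v V) vV.
  have sV' : #|V :\ v| <= n by move: sV; rewrite cV; clear; clia.
  have V2' : 2 < #|V :\ v| by move: V4; rewrite cV; clear; clia.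
  have := IHn #|edges e (V :\ v)| e s (V :\ v) sV' (leqnn _) es K33 bp V2'.
  by move: big V4; rewrite cV; clear; clia.
have [v vV dv] : exists2 v, v \in V & #|nbr e v V| = 3.
  have [/exists_inP[v vV lv]|/exists_inPn nv] := boolP [exists v in V, #|nbr e v V| <= 3].
    by exists v => //; have := deg3 v vV; move: lv; clear; clia.
  have : 4 * #|V| <= #|edges e V|.
    by apply: edges_degree => v /nv; rewrite -ltnNge.
  by move: up V4; clear; clia.
have /card_gt2P[u1 [u2 [u3 [[n1 n2 n3] [u12 u23 u31]]]]] : 2 < #|nbr e v V| by rewrite dv.
have [u1V u2V u3V] : [/\ u1 \in V, u2 \in V & u3 \in V].
  by move: n1 n2 n3; rewrite !inE => /andP[-> _] /andP[-> _] /andP[-> _].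
have [e1 e2 e3] : [/\ e v u1, e v u2 & e v u3].
  by move: n1 n2 n3; rewrite !inE => /andP[_ ->] /andP[_ ->] /andP[_ ->].
have b3 (x y z : bool) : x != y -> x != z -> y = z by case: x; case: y; case: z.
have s12 : s u1 = s u2 by apply: b3 (bp _ _ e1) (bp _ _ e2).
have s13 : s u1 = s u3 by apply: b3 (bp _ _ e1) (bp _ _ e3).
have u1v : u1 != v by apply: contraTneq e1 => ->; rewrite eirr.
have u2v : u2 != v by apply: contraTneq e2 => ->; rewrite eirr.
have u3v : u3 != v by apply: contraTneq e3 => ->; rewrite eirr.
pose Com := [set y in V :\ v | e u1 y && e u2 y].
pose V1 := V :\ v :\ u2.
have cV1 : #|V| = #|V1|.+2.
  by rewrite (cardsD1 v V) vV (cardsD1 u2 (V :\ v)) !inE u2v u2V.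
have V1gt : 2 < #|V1|.
  have sub : u1 |: (nbr e u1 V :\ v) \subset V1.
    rewrite subUset sub1set !inE u12 u1v u1V /=; apply/subsetP => y; rewrite !inE.
    move=> /andP[yv /andP[yV /bp ey]]; rewrite yv yV !andbT.
    by apply: contraNneq ey => ->; rewrite s12.
  apply: leq_trans (subset_leq_card sub); rewrite cardsU1 !inE eirr !andbF /=.
  have := deg3 _ u1V; rewrite (cardsD1 v (nbr e u1 V)) inE vV es e1 /=.
  by clear; clia.
(* Contract u1, v, u2 to one vertex: by induction u1 and u2 have two more common neighbours p, q.
   The 4-cycles u1 v u2 p and u1 v u2 q do not separate, which yields a K33 minor. *)
have com2 : 1 < #|Com|.
  pose f x := if (x == v) || (x == u2) then u1 else x.
  have ff y : y != u1 -> conn e [set x | f x == y].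
    move=> yu; have [/orP yy|/norP[yv yu2]] := boolP ((y == v) || (y == u2)).
      suff -> : [set x | f x == y] = set0 by apply: conn0.
      apply/setP => x; rewrite in_set0 in_set /f.
      case: ifP => [_|/negbT/norP[xv xu]]; first by rewrite eq_sym (negPf yu).
      by apply/eqP => xy; case: yy => /eqP yy; rewrite xy yy eqxx in xv xu.
    suff -> : [set x | f x == y] = [set y] by apply: conn1.
    apply/setP => x; rewrite in_set1 in_set /f; case: ifP => // xx.
    rewrite [u1 == y]eq_sym (negPf yu); apply/esym/eqP => xy.
    by move: xx; rewrite xy (negPf yv) (negPf yu2).
  have cf y : conn e [set x | f x == y].
    have [->|] := eqVneq y u1; last exact: ff.
    suff -> : [set x | f x == u1] = u1 |: (v |: [set u2]).
      apply: connU1 => //; last by apply/touch1P; exists v; rewrite ?inE ?eqxx // es.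
      apply: connU1 => //; first exact: conn1.
      by rewrite touch1.
    apply/setP => x; rewrite !inE /f; case: ifP => _; rewrite ?eqxx ?orbT ?orbF //.
  have fs x : x != v -> s (f x) = s x.
    by rewrite /f => /negPf->; case: eqP => //= ->.
  (* Moving [v] to the side of [u1] spoils the bipartition only at edges that come from [v]. These
     are dropped; they are accounted for among the three edges at [v]. *)
  pose e' := [rel x y | contract e f x y && (s x != s y)].
  have se' : subrel e' (contract e f) by move=> x y /andP[].
  have es' : symmetric e'.
    by move=> x y; rewrite /e' [LHS]/= [RHS]/= (contract_sym f es) (eq_sym (s x)).
  have K33' : K33free e' by apply: K33freeS se' (contract_K33 es cf K33).
  have bp' : bipartite_by e' s by move=> x y /andP[].
  have sV1 : #|V1| <= n by move: sV; rewrite cV1; clear; clia.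
  have bd := IHn _ e' s V1 sV1 (leqnn _) es' K33' bp' V1gt.
  pose lft := [set (u2, y) | y in Com]; pose rgt := [set (y, u2) | y in Com].
  (* Only the edges from [u2] to the common neighbours coincide with others after the contraction;
     without them the contraction is injective on edges. *)
  pose rest := (edges e (V :\ v) :\: lft) :\: rgt.
  have fe a b : a != v -> b != v -> f a = f b ->
      [\/ a = b, a = u1 /\ b = u2 | a = u2 /\ b = u1].
    rewrite /f => /negPf-> /negPf-> /=; do 2!case: eqP => [->|_]; move=> h.
    - exact: Or31.
    - exact: Or33.
    - exact: Or32.
    - exact: Or31.
  have inj : {in rest &, injective (fun p : T * T => (f p.1, f p.2))}.
    have aux a b : (a, b) \in rest -> [/\ a != v, b != v, e a b & b \in V] /\ a \in V /\
        ~ (a = u2 /\ e u1 b) /\ ~ (b = u2 /\ e u1 a).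
      rewrite in_setD in_setD [_ \in edges _ _]inE /= !in_setD1.
      move=> /and3P[nr nl /and3P[/andP[av aV] /andP[bv bV] eab]].
      do !split=> //; [case=> h1 h2; move/negP: nl|case=> h1 h2; move/negP: nr]; apply.
        by rewrite h1; apply: imset_f; rewrite !inE bv bV h2 -h1.
      by rewrite h1; apply: imset_f; rewrite !inE av aV h2 -h1 es.
    move=> [a b] [a' b'] /aux[[av bv eab bV] [aV [n1' n2']]].
    move=> /aux[[av' bv' eab' bV'] [aV' [n1'' n2'']]] /= [fa fb].
    case: (fe _ _ av av' fa) => [aa|[aa aa']|[aa aa']];
      case: (fe _ _ bv bv' fb) => [bb|[bb bb']|[bb bb']].
    - by rewrite aa bb.
    - by case: n2''; rewrite -aa -bb es.
    - by case: n2'; rewrite aa -bb' es.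
    - by case: n1''; rewrite -bb -aa.
    - by move/bp: eab; rewrite aa bb eqxx.
    - by move/bp: eab; rewrite aa bb s12 eqxx.
    - by case: n1'; rewrite bb -aa'.
    - by move/bp: eab; rewrite aa bb s12 eqxx.
    - by move/bp: eab; rewrite aa bb eqxx.
  have img : [set (f p.1, f p.2) | p in rest] \subset edges e' V1.
    apply/subsetP => _ /imsetP[[a b] + ->] /=.
    rewrite in_setD in_setD [_ \in edges _ _]inE /= !in_setD1.
    move=> /and3P[_ _ /and3P[/andP[av aV] /andP[bv bV] eab]].
    have fV1 x : x != v -> x \in V -> f x \in V1.
      move=> xv xV; rewrite /f (negPf xv) /=; case: eqP => [_|/eqP xu]; rewrite !inE.
        by rewrite u12 u1v.
      by rewrite xu xv.
    have sab := bp _ _ eab.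
    rewrite [_ \in _]inE /= !fV1 //= !fs // sab andbT; apply/contractP; split.
      by apply: contraNneq sab => fab; rewrite -(fs a) // fab fs.
    by exists a, b.
  have := edges_del V v es; rewrite dv.
  have : #|edges e (V :\ v)| <= #|rest| + (#|Com| + #|Com|).
    have : edges e (V :\ v) \subset rest :|: (lft :|: rgt).
      by apply/subsetP => z zE; rewrite 2!in_setU !in_setD zE; case: (_ \in lft); case: (_ \in rgt).
    move=> /subset_leq_card h; apply: (leq_trans h).
    apply: (leq_trans (leq_card_setU _ _)); rewrite leq_add2l.
    by apply: (leq_trans (leq_card_setU _ _)); apply: leq_add; apply: leq_imset_card.
  have : #|rest| <= #|edges e' V1|.
    by rewrite -(card_in_imset inj); apply: subset_leq_card.
  by move: bd big; rewrite cV1; clear; clia.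
have /card_gt1P[p [q [pC qC pq]]] := com2.
have [[pV pv ep1 ep2] [qV qv eq1 eq2]] :
    [/\ p \in V, p != v, e u1 p & e u2 p] /\ [/\ q \in V, q != v, e u1 q & e u2 q].
  by move: pC qC; rewrite !inE => /andP[/andP[-> ->] /andP[-> ->]]
    /andP[/andP[-> ->] /andP[-> ->]].
(* If the 4-cycle separated [V], each part with the cycle would obey the bound. The cycle
   contributes at least eight ordered pairs to both parts, and subtracting them once yields the
   bound for [V]. *)
have sep m' : m' \in V -> m' != v -> e u1 m' -> e u2 m' ->
    conn e (V :\: [set u1; u2; v; m']).
  move=> mV mv em1 em2; apply/negPn/negP.
  set S := [set u1; u2; v; m'].
  move=> /disconn[A [sA nA [y1 y1W y1A] clA]].
  have m1 : m' != u1 by apply: contraTneq em1 => ->; rewrite eirr.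
  have m2 : m' != u2 by apply: contraTneq em2 => ->; rewrite eirr.
  have cS : #|S| = 4.
    rewrite /S setUC cardsU1 !inE !negb_or m1 m2 mv.
    by rewrite setUC cardsU1 !inE !negb_or eq_sym u1v eq_sym u2v cards2 u12.
  have sS : S \subset V by rewrite !subUset !sub1set u1V u2V vV mV.
  have ES : 8 <= #|edges e S|.
    have := @edges_degree e S 2; rewrite cS; apply=> z.
    have two z' a b : a \in S -> b \in S -> a != b -> e z' a -> e z' b -> 2 <= #|nbr e z' S|.
      by move=> aS bS ab ea eb; apply/card_gt1P; exists a, b; rewrite !inE ea eb !andbT;
        move: aS bS; rewrite !inE.
    have [h1 h2 h3 h4] : [/\ u1 \in S, u2 \in S, v \in S & m' \in S].
      by rewrite !inE !eqxx ?orbT.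
    rewrite !inE -!orbA => /or4P[] /eqP->.
    - by apply: (two u1 v m'); [exact: h3|exact: h4|by rewrite eq_sym|by rewrite es|].
    - by apply: (two u2 v m'); [exact: h3|exact: h4|by rewrite eq_sym|by rewrite es|].
    - by apply: (two v u1 u2); [exact: h1|exact: h2|..].
    - by apply: (two m' u1 u2); [exact: h1|exact: h2|by []|rewrite es|rewrite es].
  have sAV : A \subset V by apply: subset_trans sA (subsetDl _ _).
  have cV : #|V :\: S| + 4 = #|V| by rewrite -cS -[in RHS](cardsID S V) (setIidPr sS) addnC.
  have cA : #|V :\: S| = #|A| + #|(V :\: S) :\: A|.
    by rewrite -(cardsID A (V :\: S)) (setIidPr sA).
  have cU (D : {set T}) : D \subset V :\: S -> #|D :|: S| = #|D| + 4.
    move=> sD; rewrite cardsU cS (_ : D :&: S = set0) ?cards0 ?subn0 //.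
    apply/setP => z; rewrite in_set0 in_setI; apply/andP => -[/(subsetP sD)].
    by rewrite in_setD => /andP[/negP].
  have A0 : 0 < #|A| by rewrite card_gt0.
  have B0 : 0 < #|(V :\: S) :\: A| by apply/card_gt0P; exists y1; rewrite in_setD y1A.
  have bnd (D : {set T}) : D \subset V :\: S -> #|D| + 4 < #|V| ->
      #|edges e (D :|: S)| + 8 <= 4 * (#|D| + 4).
    move=> sD lD; rewrite -cU //; apply: (IHn _ e s _ _ (leqnn _)) => //.
      by rewrite cU //; move: lD sV; clear; clia.
    by rewrite cU //; clear; clia.
  have := @edges_sep e V S A sA sS.
  have -> : (forall x y, x \in A -> y \in (V :\: S) :\: A -> e x y = false /\ e y x = false) <-> True.
    split=> // _ x y xA; rewrite in_setD => /andP[yA yV]; rewrite (es y x).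
    have exy : e x y = false by apply/negP => exy; rewrite (clA x y xA yV exy) in yA.
    by rewrite exy.
  have := bnd A sA; have := bnd _ (subsetDl (V :\: S) A).
  move: A0 B0 big cV cA ES; set B := _ :\: A; clear.
  move=> A0 B0 big cV cA ES hB hA /(_ I).
  have {}hB := hB ltac:(lia); have {}hA := hA ltac:(lia).
  lia.
have b3' x : e u1 x -> x != u3.
  by move=> /bp; rewrite s13; apply: contraNneq => ->.
pose X := V :\: [set u1; u2; v; p; q].
have u3X : u3 \in X.
  by rewrite !inE !negb_or u31 (eq_sym u3 u2) u23 u3v ![u3 == _]eq_sym !b3'.
have [E1 [u3E sE1 cE clE]] := comp_ex es u3X.
have nE z : z \in [set u1; u2; v; p; q] -> z \notin E1.
  by move=> zS; apply/negP => /(subsetP sE1); rewrite in_setD zS.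
have tE a b : conn e (V :\: [set u1; u2; v; a]) -> [set u1; u2; v; a; b] = [set u1; u2; v; p; q] ->
    b \in V :\: [set u1; u2; v; a] -> touch e E1 [set b].
  move=> cab eab bV.
  have sEE' : E1 \subset V :\: [set u1; u2; v; a].
    apply: subset_trans sE1 _; rewrite /X -eab; apply: setDS; exact: subsetUl.
  have bE : b \notin E1 by apply: nE; rewrite -eab in_setU set11 orbT.
  have [x [y [xE yV yE exy]]] := conn_cut cab sEE' u3E bV bE.
  rewrite (_ : b = y); first by apply/touchP; exists x, y; rewrite set11.
  apply/eqP; rewrite eq_sym; apply: contraNT yE => yb; apply: (clE x y) => //.
  have -> : X = (V :\: [set u1; u2; v; a]) :\ b.
    by rewrite /X -eab -setDDl.
  by rewrite in_setD1 yb.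
have [pu1 pu2] : p != u1 /\ p != u2.
  by split; [apply: contraTneq ep1|apply: contraTneq ep2] => ->; rewrite eirr.
have [qu1 qu2] : q != u1 /\ q != u2.
  by split; [apply: contraTneq eq1|apply: contraTneq eq2] => ->; rewrite eirr.
have tp : touch e E1 [set p].
  apply: (tE q p); [exact: sep|by rewrite setUAC|].
  by rewrite in_setD pV andbT !inE !negb_or pu1 pu2 pv.
have tq : touch e E1 [set q].
  apply: (tE p q); [exact: sep|by []|].
  by rewrite in_setD qV andbT !inE !negb_or qu1 qu2 qv eq_sym.
have tv : touch e E1 [set v].
  by apply/touchP; exists u3, v; rewrite u3E set11 es.
apply: (K33 [set u1] [set u2] E1 [set v] [set p] [set q]).
- by rewrite /= !bag1 (bagP u3E cE).
- have dE z : z \in [set u1; u2; v; p; q] -> [disjoint [set z] & E1] && [disjoint E1 & [set z]].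
    by move=> /nE zE; rewrite disjoint_sym andbb disjoint_sym disjoints1.
  have dE' z : z \in [set u1; u2; v; p; q] -> [disjoint [set z] & E1] by move=> /dE/andP[].
  have dE2 z : z \in [set u1; u2; v; p; q] -> [disjoint E1 & [set z]] by move=> /dE/andP[].
  have d1 (a b : T) : a != b -> [disjoint [set a] & [set b]] by rewrite disjoints1 in_set1.
  rewrite /= !dE' ?dE2 ?d1 // 1?eq_sym // !inE ?eqxx ?orbT //.
- by rewrite /allrel /= !touch1 tp tq tv !(es u1 v) !(es u2 v) e1 e2 ep1 ep2 eq1 eq2.
Qed.
End Bip.

(** * Orientations with prescribed capacities *)

Section Orient.
Variables (T E : finType) (p q : E -> T) (cap : T -> nat).

Definition load (o : E -> T) x := #|[set a | o a == x]|.
Definition orients (o : {ffun E -> T}) := [forall a, (o a == p a) || (o a == q a)].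
Definition overflow (o : {ffun E -> T}) := \sum_x (load o x - cap x).

Definition redirectable (o : {ffun E -> T}) x y :=
  [exists a, (o a == x) && ((p a == x) && (q a == y) || (p a == y) && (q a == x))].

Definition redirect (o : {ffun E -> T}) a y : {ffun E -> T} :=
  [ffun b => if b == a then y else o b].

Lemma load_redirect (o : {ffun E -> T}) a x y : o a = x -> x != y ->
  [/\ load o x = (load (redirect o a y) x).+1,
      load (redirect o a y) y = (load o y).+1 &
      forall z, z != x -> z != y -> load (redirect o a y) z = load o z].
Proof.
move=> oa xy; split.
- rewrite /load (cardsD1 a [set b | o b == x]) inE oa eqxx; congr _.+1; apply: eq_card => b.
  by rewrite !inE ffunE; case: (b == a); rewrite //= eq_sym (negPf xy).
- rewrite /load (cardsD1 a [set b | redirect o a y b == y]) inE ffunE !eqxx.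
  congr _.+1; apply: eq_card => b; rewrite !inE ffunE; case: (b =P a) => [->|//].
  by rewrite oa (negPf xy).
- move=> z zx zy; apply: eq_card => b; rewrite !inE ffunE; case: (b =P a) => [->|//].
  by rewrite oa eq_sym (negPf zy) eq_sym (negPf zx).
Qed.

Lemma orients_redirect o a x y : orients o -> o a = x ->
  (p a == x) && (q a == y) || (p a == y) && (q a == x) -> orients (redirect o a y).
Proof.
move=> /forallP oo oa h; apply/forallP => b; rewrite ffunE; case: (b =P a) => [->|_]; last exact: oo.
by case/orP: h => /andP[/eqP-> /eqP->]; rewrite eqxx ?orbT.
Qed.

Lemma redirect_path (o : {ffun E -> T}) a y z x s : o a = z -> last x s = z -> uniq (x :: s) ->
  path (redirectable o) x s -> path (redirectable (redirect o a y)) x s.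
Proof.
move=> oa; elim: s x => //= w s IH x lz /andP[xs us] /andP[/existsP[b hb] ps].
apply/andP; split; last exact: IH.
apply/existsP; exists b; rewrite ffunE; case: (b =P a) => // ba.
move: hb; rewrite ba oa => /andP[/eqP zx _].
by rewrite -zx -lz mem_last in xs.
Qed.

(** The last edge of the path is redirected first. Either its old owner was overloaded and the
    overflow drops, or that owner now has room and the shorter path is used. *)
Lemma augment s x y o : orients o -> path (redirectable o) x s -> last x s = y -> uniq (x :: s) ->
  cap x < load o x -> load o y < cap y ->
  exists o', orients o' /\ overflow o' < overflow o.
Proof.
elim/last_ind: s y o => [|s y' IH] y o oo; first by move=> _ <- _ /= h1 h2; lia.
rewrite rcons_path last_rcons => /andP[ps /existsP[a /andP[/eqP oa h]]] <- {y} us ox oy.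
set z := last x s in oa h.
have zy : z != y'.
  move: us; rewrite -rcons_cons rcons_uniq => /andP[h' _]; apply: contraNneq h' => <-.
  exact: mem_last.
have [lz ly lo] := load_redirect oa zy.
have oo' := orients_redirect oo oa h.
set o' := redirect o a y' in lz ly lo oo'.
have ov : overflow o' <= overflow o /\ (cap z < load o z -> overflow o' < overflow o).
  have ex (r : {ffun E -> T}) : overflow r = load r z - cap z + (load r y' - cap y' +
      \sum_(i | (i != z) && (i != y')) (load r i - cap i)).
    by rewrite /overflow (bigD1 z) //= (bigD1 y') 1?eq_sym.
  rewrite !ex (eq_bigr (fun i => load o i - cap i)) => [|i /andP[iz iy]]; last by rewrite lo.
  rewrite lz ly; move: oy; set S := bigop _ _ _.
  by move: S (load o y') (load o' z) (cap y') (cap z); clear; clia.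
have [h1|h1] := ltnP (cap z) (load o z).
  by exists o'; split=> //; case: ov => _; apply.
have us' : uniq (x :: s) by move: us; rewrite -rcons_cons rcons_uniq => /andP[].
have xz : x != z by apply: contraTneq ox => ->; rewrite -leqNgt.
have xy : x != y' by move: us; rewrite /= mem_rcons inE negb_or => /andP[/andP[]].
have [||o1 [oo1 l1]] := IH z o' oo' (redirect_path y' oa erefl us' ps) erefl us'.
- by rewrite lo.
- by move: h1; rewrite lz.
by exists o1; split=> //; case: ov => ov1 _; apply: leq_trans l1 ov1.
Qed.

(** Hakimi's theorem. When the overflow is minimal, the vertices reachable from an overloaded one
    are all full and own only edges among themselves, so they span too many edges. *)
Lemma orientation : (forall X : {set T},
    #|[set a | (p a \in X) && (q a \in X)]| <= \sum_(x in X) cap x) ->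
  exists o : {ffun E -> T}, orients o /\ forall x, load o x <= cap x.
Proof.
move=> orientation_condition.
pose o0 : {ffun E -> T} := [ffun a => p a].
have oo0 : orients o0 by apply/forallP => a; rewrite ffunE eqxx.
case: (arg_minnP overflow oo0) => o oo omin.
exists o; split=> // x; rewrite leqNgt; apply/negP => ox.
pose R := [set y | connect (redirectable o) x y].
have xR : x \in R by rewrite inE.
have [/existsP[y /andP[yR oy]]|full] := boolP [exists y, (y \in R) && (load o y < cap y)].
  move: yR; rewrite inE => /connectP[s0 ps0 ly0].
  case/shortenP: ps0 ly0 => s ps us _ ly.
  have [o' [oo' lt]] := augment oo ps (esym ly) us ox oy.
  by have := omin o' oo'; rewrite leqNgt lt.
have full' y : y \in R -> cap y <= load o y.
  by move=> yR; rewrite leqNgt; apply/negP => h; move/existsPn: full => /(_ y); rewrite yR h.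
have Rcl a : o a \in R -> (p a \in R) && (q a \in R).
  move=> oR; have /orP[/eqP ea|/eqP ea] := forallP oo a.
    rewrite -ea oR /=; move: oR; rewrite !inE => h; apply: connect_trans h (connect1 _).
    by apply/existsP; exists a; rewrite ea !eqxx.
  rewrite -ea oR andbT; move: oR; rewrite !inE => h; apply: connect_trans h (connect1 _).
  by apply/existsP; exists a; rewrite ea !eqxx orbT.
have : \sum_(y in R) load o y <= #|[set a | (p a \in R) && (q a \in R)]|.
  apply: (@leq_trans #|[set a | o a \in R]|); last first.
    by apply: subset_leq_card; apply/subsetP => a; rewrite !inE; move=> h; have := Rcl a;
      rewrite !inE; apply.
  rewrite -[X in _ <= X]sum1_card (partition_big o (mem R)) => [|a]; last by rewrite inE.
  apply: leq_sum => y yR; rewrite /load -sum1_card; apply: eq_leq; apply: eq_bigl => a.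
  rewrite [LHS]inE (in_set (fun b => o b \in R)).
  by case: eqP => [->|]; rewrite ?andbF // andbT yR.
have : \sum_(y in R) cap y < \sum_(y in R) load o y.
  rewrite (bigD1 x) //= [X in _ < X](bigD1 x) //= -addSn leq_add //.
  by apply: leq_sum => y /andP[yR _]; apply: full'.
by have := orientation_condition R; lia.
Qed.
End Orient.

(** * Bad list assignments of connected graphs *)

Section Lists.
Variables (T C : finType) (e : rel T).
Hypotheses (es : symmetric e) (ei : irreflexive e).
Implicit Types (K N W U : {set T}) (La : T -> {set C}).

Definition colourable K La := [exists phi : {ffun T -> C},
  [forall v in K, phi v \in La v] &&
  [forall u in K, forall v in K, e u v ==> (phi u != phi v)]].

Lemma colourableP K La : reflect (exists phi, lcol e K La phi) (colourable K La).
Proof.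
apply: (iffP existsP) => [[phi /andP[/forall_inP h1 /forall_inP h2]]|[phi [h1 h2]]].
  exists phi; split=> // u v uK vK; exact/implyP/(forall_inP (h2 u uK)).
exists (finfun phi); apply/andP; split; apply/forall_inP => u uK.
  by rewrite ffunE h1.
by apply/forall_inP => v vK; apply/implyP; rewrite !ffunE; apply: h2.
Qed.

Lemma colourable_sub K La La' : (forall z, z \in K -> La z \subset La' z) ->
  colourable K La -> colourable K La'.
Proof.
move=> s /colourableP[phi [h1 h2]]; apply/colourableP; exists phi; split=> // v vK.
by apply: (subsetP (s v vK)); apply: h1.
Qed.

Definition del La u (c : C) z := if e u z then La z :\ c else La z.

Lemma colourable_del K La u c : u \in K -> c \in La u -> colourable (K :\ u) (del La u c) ->
  colourable K La.
Proof.
move=> uK cu /colourableP[phi [h1 h2]]; apply/colourableP.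
exists (fun z => if z == u then c else phi z).
have hv z : z \in K -> z != u -> phi z \in La z /\ (e u z -> phi z != c).
  move=> zK zu; have := h1 z; rewrite /del !inE zu zK => /(_ isT).
  by case: ifP => // _; rewrite !inE => /andP[].
split=> [z zK|y z yK zK eyz].
  by case: (z =P u) => [->//|/eqP zu]; have [] := hv z zK zu.
case: (y =P u) => [yu|/eqP yu]; case: (z =P u) => [zu|/eqP zu].
- by move: eyz; rewrite yu zu ei.
- by rewrite eq_sym; have [_] := hv z zK zu; apply; rewrite -yu.
- by have [_] := hv y yK yu; apply; rewrite es -zu.
- by apply: h2; rewrite // !inE ?yu ?zu.
Qed.

Lemma nbr_del K u z : u \in K -> #|nbr e z K| = e u z + #|nbr e z (K :\ u)|.
Proof.
move=> uK; rewrite (cardsD1 u) !inE uK es /=; congr (_ + _).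
by apply: eq_card => x; rewrite !inE andbA.
Qed.

Lemma card_del K La u c z : u \in K -> #|nbr e z K| <= #|La z| ->
  #|nbr e z (K :\ u)| <= #|del La u c z|.
Proof.
move=> uK; rewrite (nbr_del z uK) /del; case: ifP => //= _; exact: card_setD1_ge.
Qed.

Lemma nbr_gt0 K z : conn e K -> z \in K -> 1 < #|K| -> 0 < #|nbr e z K|.
Proof.
move=> cK zK K1; have /card_gt1P[a [b [aK bK ab]]] := K1.
have [y yK yz] : exists2 y, y \in K & y \notin [set z].
  by have [az|] := eqVneq a z; [exists b|exists a]; rewrite ?inE // -az eq_sym.
have sz : [set z] \subset K by rewrite sub1set.
have [x [y' [/set1P-> y'K _ exy]]] := conn_cut cK sz (set11 z) yK yz.
by apply/card_gt0P; exists y'; rewrite inE y'K.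
Qed.

Lemma noncut_ex K x : conn e K -> x \in K -> 1 < #|K| ->
  exists u, [/\ u \in K, u != x & conn e (K :\ u)].
Proof.
move=> cK xK K1; have [|||u [uK ux cu]] := @conn_noncut _ e K [set x] es cK (conn1 e x).
- by rewrite sub1set.
- by rewrite -card_gt0 cards1.
- by apply: contraTneq K1 => <-; rewrite cards1.
by exists u; split=> //; move: ux; rewrite inE.
Qed.

(** Colour greedily towards [x], always at a vertex that does not cut the rest: it has an uncoloured
    neighbour, hence a free colour, and [x] comes last with one to spare. *)
Lemma colourable_slack K La x : conn e K -> (forall z, z \in K -> #|nbr e z K| <= #|La z|) ->
  x \in K -> #|nbr e x K| < #|La x| -> colourable K La.
Proof.
have [n] := ubnP #|K|; elim: n => // n IH in K La * => sK cK hL xK hx.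
have [K1|] := ltnP 1 #|K|; last first.
  rewrite leq_eqVlt ltnS leqn0 cards_eq0 => /orP[/cards1P[x' eK]|/eqP K0]; last by rewrite K0 inE in xK.
  have [c cx] : exists c, c \in La x by apply/set0Pn; rewrite -card_gt0; apply: leq_ltn_trans hx.
  move: xK; rewrite eK => /set1P xx; subst x'.
  apply/colourableP; exists (fun=> c); split=> [z /set1P->//|u v /set1P-> /set1P->].
  by rewrite ei.
have [u [uK ux cu]] := noncut_ex cK xK K1.
have [c cu'] : exists c, c \in La u.
  apply/set0Pn; rewrite -card_gt0; apply: leq_trans (hL u uK); exact: nbr_gt0.
apply: (colourable_del uK cu'); apply: IH => //.
- by move: sK; rewrite (cardsD1 u K) uK; lia.
- by move=> z; rewrite inE => /andP[_ zK]; apply: card_del => //; apply: hL.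
- by rewrite !inE eq_sym ux.
- move: hx; rewrite (nbr_del x uK) /del; case: ifP => //= _; exact: card_setD1_ge.
Qed.

Definition bad K La := [/\ conn e K, forall z, z \in K -> #|nbr e z K| <= #|La z| &
  ~~ colourable K La].

Lemma bad_tight K La z : bad K La -> z \in K -> #|La z| = #|nbr e z K|.
Proof.
move=> [cK hL nc] zK; apply/eqP; rewrite eqn_leq hL // andbT leqNgt.
by apply: contra nc; apply: colourable_slack.
Qed.

Lemma bad_del K La u c : bad K La -> u \in K -> conn e (K :\ u) -> c \in La u ->
  bad (K :\ u) (del La u c).
Proof.
move=> [cK hL nc] uK cu cL; split=> //.
  by move=> z; rewrite inE => /andP[_ zK]; apply: card_del => //; apply: hL.
by apply: contra nc; apply: colourable_del.
Qed.

(** A colour of [y] missing at [x] would, when given to [y], cost [x] nothing and leave slack at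
    [x]. *)
Lemma bad_sub K La x y : bad K La -> y \in K -> conn e (K :\ y) -> x \in K -> e x y ->
  La y \subset La x.
Proof.
move=> bK yK cy xK exy; apply/subsetP => c cLy; apply: contraTT (cLy) => cx.
have b' := bad_del bK yK cy cLy.
have xy : x != y by apply: contraTneq exy => ->; rewrite ei.
have xK' : x \in K :\ y by rewrite !inE xy.
have := bad_tight b' xK'; have := bad_tight bK xK.
rewrite (nbr_del x yK) /del es exy /= (cardsD1 c (La x)) (negPf cx) /=.
by move: #|_ :\ _| => k; lia.
Qed.

Lemma bad_twin K La x y : bad K La -> y \in K -> conn e (K :\ y) -> x \in K ->
  conn e (K :\ x) -> e x y -> La x = La y.
Proof.
move=> bK yK cy xK cx exy; apply/eqP; rewrite eqEsubset.
by rewrite (bad_sub bK yK cy xK exy) (bad_sub bK xK cx yK) // es.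
Qed.

(** Peel off a vertex [v] that does not cut [K]. If the colour occurs at [v], use it there in both
    assignments, otherwise use any colour of [v]; the agreement survives. If [v] has the colour and
    is adjacent to [x], then [x] has it in both by [bad_sub]. *)
Lemma bad_det K La1 La2 p1 p2 x : bad K La1 -> bad K La2 -> x \in K ->
  (forall z, z \in K -> z != x -> (p1 \in La1 z) = (p2 \in La2 z)) ->
  (p1 \in La1 x) = (p2 \in La2 x).
Proof.
have [n] := ubnP #|K|; elim: n => // n IH in K La1 La2 * => sK b1 b2 xK ag.
have cK : conn e K by case: b1.
have [K1|] := ltnP 1 #|K|; last first.
  move=> K1; have d0 : #|nbr e x K| = 0.
    apply/eqP; rewrite cards_eq0; apply/eqP/setP => y; rewrite !inE; apply/andP => -[yK exy].
    have : #|[set x; y]| <= #|K| by apply: subset_leq_card; rewrite subUset !sub1set xK.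
    have xy : x != y by apply: contraTneq exy => ->; rewrite ei.
    by rewrite cards2 xy; lia.
  have h La : bad K La -> La x = set0.
    by move=> b; apply/eqP; rewrite -cards_eq0 (bad_tight b xK) d0.
  by rewrite (h _ b1) (h _ b2) !inE.
have [v [vK vx cv]] := noncut_ex cK xK K1.
have xv : x \in K :\ v by rewrite !inE eq_sym vx.
have step c1 c2 : c1 \in La1 v -> c2 \in La2 v ->
    (forall z, z \in K -> z != v -> (z == x = false \/ ~~ e v z) ->
       (p1 \in del La1 v c1 z) = (p2 \in del La2 v c2 z) \/ z = x) ->
    (p1 \in del La1 v c1 x) = (p2 \in del La2 v c2 x).
  move=> h1 h2 h; apply: (IH (K :\ v)) => //.
  - by move: sK; rewrite (cardsD1 v K) vK; lia.
  - exact: bad_del.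
  - exact: bad_del.
  - move=> z; rewrite inE => /andP[]; rewrite inE => zv zK zx.
    have [//|zx'] := h z zK zv (or_introl (negPf zx)).
    by rewrite zx' eqxx in zx.
have [p1v|p1v] := boolP (p1 \in La1 v).
  have p2v : p2 \in La2 v by rewrite -ag.
  have [evx|evx] := boolP (e v x).
    have exv : e x v by rewrite es.
    by rewrite (subsetP (bad_sub b1 vK cv xK exv) _ p1v) (subsetP (bad_sub b2 vK cv xK exv) _ p2v).
  have := step p1 p2 p1v p2v; rewrite /del (negPf evx); apply => z zK zv _.
  have [->|zx] := eqVneq z x; [by right|left].
  by case: ifP => _; rewrite ?in_setD1 ?eqxx ?ag.
have p2v : p2 \notin La2 v by rewrite -ag.
have ne La : bad K La -> exists c, c \in La v.
  by move=> b; apply/set0Pn; rewrite -card_gt0 (bad_tight b vK) nbr_gt0.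
have [[c1 h1] [c2 h2]] := (ne _ b1, ne _ b2).
have n1 : (p1 == c1) = false by apply: contraNF p1v => /eqP->.
have n2 : (p2 == c2) = false by apply: contraNF p2v => /eqP->.
have dl La p c z : (p == c) = false -> (p \in del La v c z) = (p \in La z).
  by rewrite /del => h; case: ifP => _; rewrite ?in_setD1 ?h.
have := step c1 c2 h1 h2; rewrite !dl //; apply => z zK zv _; rewrite !dl //.
by have [->|zx] := eqVneq z x; [right|left; apply: ag].
Qed.

Definition resid N La (phi : T -> C) z := La z :\: phi @: nbr e z N.

(* W contains the neighbours of K from which the colours F can be withheld; the
   other neighbours of K are only known to differ in colour from the hub h. *)
Definition safe K La N W := exists (F : {set C}) h, [/\ #|F| <= 3, h \in N & forall phi : T -> C,
  (forall v, v \in W -> phi v \notin F) ->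
  (forall v, v \in N -> v != h -> phi v != phi h) -> colourable K (resid N La phi)].

Lemma card_resid N La phi z n : n + #|nbr e z N| <= #|La z| -> n <= #|resid N La phi z|.
Proof. by move=> h; apply: card_setD_ge h _; apply: leq_imset_card. Qed.

(** * Configurations that make a component safe *)

Section Gadgets.
Variables (K N W : {set T}) (La : T -> {set C}).
Hypotheses (cK : conn e K) (WN : W \subset N).
Hypothesis hL : forall z, z \in K -> #|nbr e z K| + #|nbr e z N| <= #|La z|.

Lemma resid_badE phi : ~~ colourable K (resid N La phi) -> bad K (resid N La phi).
Proof. by move=> nc; split=> // z zK; apply: card_resid; apply: hL. Qed.

(** A bad residue leaves no inequality strict: a repeated colour among the neighbours in [N], or one
    outside the list of [z], would leave [z] a colour too many. *)
Lemma resid_tight phi z : bad K (resid N La phi) -> z \in K ->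
  [/\ #|La z| = #|nbr e z K| + #|nbr e z N|, {in nbr e z N &, injective phi} &
      forall v, v \in N -> e z v -> phi v \in La z].
Proof.
move=> b zK; have t := bad_tight b zK; have l := hL zK.
have le := leq_imset_card phi (nbr e z N).
have le2 : #|La z :&: phi @: nbr e z N| <= #|phi @: nbr e z N|.
  by apply: subset_leq_card; apply: subsetIr.
have eL := cardsID (phi @: nbr e z N) (La z).
rewrite -/(resid N La phi z) t in eL.
split; first by lia.
  by apply/imset_injP; apply/eqP; lia.
have sI : phi @: nbr e z N \subset La z.
  apply/setIidPr/eqP; rewrite eqEcard subsetIr /=; lia.
by move=> v vN ev; apply: (subsetP sI); apply: imset_f; rewrite inE vN.
Qed.

(** The colour of [h] occurs once on [N], so it is removed only from the lists of neighbours of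
    [h]. *)
Lemma resid_hub phi z h c : (forall v, v \in N -> v != h -> phi v != phi h) ->
  ~~ e z h -> c = phi h -> (c \in resid N La phi z) = (c \in La z).
Proof.
move=> hub ezh ->; rewrite inE; case: imsetP => //= -[v].
rewrite inE => /andP[vN ezv] hv; have vh : v != h by apply: contraNneq ezh => <-.
by have := hub v vN vh; rewrite hv eqxx.
Qed.

Lemma subset3 (A : {set C}) : exists2 F : {set C}, F \subset A & #|F| = minn 3 #|A|.
Proof.
have [le|lt] := leqP #|A| 3; first by exists A.
have /card_geqP[s [us ss sA]] : 3 <= #|A| by apply: ltnW.
exists [set x in s]; last by rewrite cardsE (card_uniqP us) ss.
by apply/subsetP => x; rewrite inE => /sA.
Qed.

Lemma nbrUW z : #|nbr e z N| = #|nbr e z W| + #|nbr e z (N :\: W)|.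
Proof.
rewrite -(cardsID W); congr (_ + _); apply: eq_card => x; rewrite !inE.
  by case xW: (x \in W); rewrite ?andbF //= (subsetP WN) ?andbT.
by rewrite andbA.
Qed.

(** Only neighbours in [N :\: W] can take a colour of [F] from [z], and what is left of [F] exceeds
    the degree of [z] in [K]. The neighbour [w] ensures this even when [z] has fewer than three
    colours. *)
Lemma safe_low_degree z w : z \in K -> w \in W -> e z w ->
  #|nbr e z K| + #|nbr e z (N :\: W)| <= 2 -> safe K La N W.
Proof.
move=> zK wW ezw h2.
have [F sF eF] := subset3 (La z).
have Wz : 0 < #|nbr e z W| by apply/card_gt0P; exists w; rewrite inE wW.
have lF : #|nbr e z K| + #|nbr e z (N :\: W)| < #|F|.
  by have := hL zK; rewrite nbrUW eF; lia.
exists F, w; split; [by rewrite eF geq_minl|exact: (subsetP WN)|].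
move=> phi avoid _.
apply: (colourable_slack (x := z)) => // [y yK|].
  by apply: card_resid; apply: hL.
have : F :\: phi @: nbr e z (N :\: W) \subset resid N La phi z.
  apply/subsetP => c; rewrite !inE => /andP[nc cF]; rewrite (subsetP sF) // andbT.
  apply: contra nc => /imsetP[v]; rewrite inE => /andP[vN ezv] cv.
  apply/imsetP; exists v => //; rewrite !inE vN ezv !andbT.
  by apply/negP => vW; move: cF; rewrite cv (negPf (avoid v vW)).
move=> /subset_leq_card; apply: leq_trans.
by apply: (card_setD_ge (m := #|nbr e z (N :\: W)|)); rewrite ?leq_imset_card // addSn.
Qed.
Lemma resid_mem phi z v : v \in N -> e z v -> phi v \notin resid N La phi z.
Proof. by move=> vN ezv; rewrite inE negb_and negbK imset_f // inE vN. Qed.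

Lemma avoid_U (F : {set C}) phi x : (forall v, v \in W -> phi v \notin F) ->
  F \subset phi @: nbr e x N -> #|F| <= #|N :\: W|.
Proof.
move=> avoid sF; have : F \subset phi @: (N :\: W).
  apply/subsetP => c cF; have /imsetP[v] := subsetP sF _ cF.
  rewrite inE => /andP[vN _] cv; rewrite cv; apply: imset_f; rewrite inE vN andbT.
  by apply/negP => vW; move: cF; rewrite cv (negPf (avoid v vW)).
by move/subset_leq_card/leq_trans; apply; apply: leq_imset_card.
Qed.

(** In a bad case [x] and [y] have the same residual list. This puts the colour of [w] into
    [La x :\: La y] and every colour of that difference onto a neighbour of [x]. Either [F] is the
    whole difference, which [w] avoids, or its three colours need three vertices in [N :\: W]. *)
Lemma safe_twin x y w : x \in K -> y \in K -> conn e (K :\ x) -> conn e (K :\ y) ->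
  e x y -> w \in W -> e x w -> ~~ e y w -> #|N :\: W| <= 2 -> safe K La N W.
Proof.
move=> xK yK cx cy exy wW exw eyw U2.
have wN := subsetP WN _ wW.
have [F sF eF] := subset3 (La x :\: La y).
exists F, w; split=> //; first by rewrite eF geq_minl.
move=> phi avoid hub; apply: contraT => /resid_badE b.
have tw := bad_twin b yK cy xK cx exy.
have [_ _ hx] := resid_tight b xK.
have wA : phi w \in La x :\: La y.
  rewrite inE hx // andbT -(resid_hub hub eyw (erefl _)) -tw.
  exact: resid_mem.
have [le|lt] := leqP #|La x :\: La y| 3.
  have FA : F = La x :\: La y by apply/eqP; rewrite eqEcard sF eF leq_min le leqnn.
  by have := avoid w wW; rewrite FA wA.
have : #|F| <= #|N :\: W|.
  apply: (@avoid_U F phi x) => //; apply/subsetP => c /(subsetP sF).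
  rewrite inE => /andP[cy' cx']; apply: contraR cy' => cI.
  have : c \in resid N La phi x by rewrite inE cI.
  by rewrite tw inE => /andP[].
by rewrite eF (minn_idPl (ltnW lt)) => /leq_trans/(_ U2).
Qed.

Lemma safe_single x w : w \in W -> nbr e w K = [set x] -> #|N :\: W| <= 2 -> safe K La N W.
Proof.
move=> wW nw U2.
have wN := subsetP WN _ wW.
have [xK exw] : x \in K /\ e x w.
  by have := set11 x; rewrite -nw inE es => /andP[].
have ezw z : z \in K -> z != x -> ~~ e z w.
  move=> zK zx; apply: contra zx => ezw; have : z \in nbr e w K by rewrite inE zK es.
  by rewrite nw inE.
pose hubb (phi : {ffun T -> C}) := [forall v in N, (v != w) ==> (phi v != phi w)].
pose X := [set c | [exists phi : {ffun T -> C}, [&& hubb phi, phi w == c &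
  ~~ colourable K (resid N La phi)]]].
have [F sF eF] := subset3 X.
exists F, w; split=> //; first by rewrite eF geq_minl.
move=> phi avoid hub; apply: contraT => nc.
have b := resid_badE nc.
have [le|lt] := leqP #|X| 3.
  have FA : F = X by apply/eqP; rewrite eqEcard sF eF leq_min le leqnn.
  have /negP[] := avoid w wW; rewrite FA inE.
  have rE z : resid N La (finfun phi) z = resid N La phi z.
    rewrite /resid; congr (_ :\: _); apply: eq_imset => v; exact: ffunE.
  apply/existsP; exists (finfun phi); rewrite ffunE eqxx /=; apply/andP; split.
    by apply/forall_inP => v vN; apply/implyP; rewrite !ffunE; apply: hub.
  by apply: contra nc; apply: colourable_sub => z _; rewrite rE.
have [p pF pU] : exists2 p, p \in F & p \notin phi @: N.
  have : ~~ (F \subset phi @: N).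
    apply/negP => sFN; have : F \subset phi @: (N :\: W).
      apply/subsetP => c cF; have /imsetP[v vN cv] := subsetP sFN _ cF.
      rewrite cv; apply: imset_f; rewrite inE vN andbT.
      by apply/negP => vW; move: cF; rewrite cv (negPf (avoid v vW)).
    by move/subset_leq_card; rewrite eF (minn_idPl (ltnW lt)) => /leq_trans/(_ (leq_imset_card _ _))/leq_trans/(_ U2).
  by case/subsetPn => p pF pU; exists p.
have := subsetP sF _ pF; rewrite inE => /existsP[psi /and3P[/forall_inP hubp /eqP pw ncp]].
have bp := resid_badE ncp.
have hub' v : v \in N -> v != w -> psi v != psi w by move=> vN; apply/implyP/hubp.
have pE z : (p \in resid N La phi z) = (p \in La z).
  rewrite inE; case: imsetP => //= -[v]; rewrite inE => /andP[vN _] pv.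
  by case/negP: pU; rewrite pv imset_f.
have : (p \in resid N La phi x) = (p \in resid N La psi x).
  by apply: (bad_det b bp xK) => z zK zx; rewrite pE (resid_hub hub' (ezw z zK zx) (esym pw)).
have [_ _ hx] := resid_tight bp xK.
by rewrite pE -pw hx // (negPf (resid_mem _ wN exw)).
Qed.

(** Here the vertex with a private colour is an exempted neighbour [a] of [x]. In a bad case the
    colour of [w] lies in both lists, while no exempted neighbour of [x] has a colour in [La y].
    Hence the two lists share at most three colours, and these are withheld from [w]. *)
Lemma safe_pair x y w : x \in K -> y \in K -> conn e (K :\ x) -> conn e (K :\ y) ->
  e x y -> nbr e x W = [set w] -> nbr e y W = [set w] -> nbr e x (N :\: W) != set0 ->
  [disjoint nbr e x (N :\: W) & nbr e y (N :\: W)] -> #|N :\: W| <= 2 ->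
  #|nbr e x K| <= 2 -> safe K La N W.
Proof.
move=> xK yK cx cy exy nx ny /set0Pn[a aU] dU U2 d2.
have [wW exw] : w \in W /\ e x w by have := set11 w; rewrite -nx inE => /andP[].
have eyw : e y w by have := set11 w; rewrite -ny inE => /andP[].
have wN := subsetP WN _ wW.
have [aN exa] : a \in N /\ e x a by move: aU; rewrite !inE => /andP[/andP[_ ->] ->].
have neU v : v \in N :\: W -> e x v -> ~~ e y v.
  by move=> vU exv; apply/negP => eyv; apply: (disjE dU (z := v)); rewrite inE vU.
exists (if #|La x :&: La y| <= 3 then La x :&: La y else set0), a; split=> //.
  by case: ifP; rewrite ?cards0.
move=> phi avoid hub; apply: contraT => /resid_badE b.
have tw := bad_twin b yK cy xK cx exy.
have [tx injx hx] := resid_tight b xK; have [_ _ hy] := resid_tight b yK.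
have wI : phi w \in La x :&: La y by rewrite inE hx ?hy.
have := avoid w wW; case: ifP => [_|/negbT]; first by rewrite wI.
rewrite -ltnNge => lt _.
have nU v : v \in nbr e x (N :\: W) -> phi v \notin La y.
  rewrite inE => /andP[vU exv]; have eyv := neU v vU exv.
  have vN : v \in N by move: vU; rewrite inE => /andP[].
  have vW : v \notin W by move: vU; rewrite inE => /andP[].
  apply/negP => vL; have : phi v \notin resid N La phi y by rewrite -tw; apply: resid_mem.
  rewrite inE vL andbT negbK => /imsetP[u]; rewrite inE => /andP[uN eyu] vu.
  have uv : u != v by apply: contraTneq eyu => ->.
  have [uW|uW] := boolP (u \in W).
    have uw : u = w by apply/set1P; rewrite -ny inE uW.
    have : v = u by apply: injx; rewrite ?inE ?vN ?uN // uw.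
    by move/eqP; rewrite eq_sym (negPf uv).
  have uU : u \in N :\: W by rewrite inE uW.
  have ua : u != a by apply: contraTneq eyu => ->; apply: neU; move: aU; rewrite !inE => /andP[].
  have va : v != a.
    by apply: contraNneq (hub u uN ua) => <-; rewrite vu.
  (* A colour shared by [u] and [v] makes both different from [a], which gives three exempted
     vertices, one too many. *)
  have : [set a; v; u] \subset N :\: W.
    by rewrite !subUset !sub1set uU vU !andbT; move: aU; rewrite inE => /andP[].
  move=> /subset_leq_card; rewrite setUC cardsU1 cards2 !inE negb_or ua uv eq_sym va.
  by move: U2; set k := #|_ :\: _|; clear; lia.
have sub : La x :&: La y \subset La x :\: phi @: nbr e x (N :\: W).
  apply/subsetP => c; rewrite inE => /andP[cx' cy']; rewrite inE cx' andbT.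
  by apply/imsetP => -[v vU cv]; move: cy'; rewrite cv (negPf (nU v vU)).
have sI : phi @: nbr e x (N :\: W) \subset La x.
  by apply/subsetP => c /imsetP[v]; rewrite !inE => /andP[/andP[_ vN] exv] ->; apply: hx.
have cI : #|phi @: nbr e x (N :\: W)| = #|nbr e x (N :\: W)|.
  apply: card_in_imset => u v; rewrite !inE => /andP[/andP[_ uN] eu] /andP[/andP[_ vN] ev].
  by apply: injx; rewrite inE ?uN ?vN.
have := subset_leq_card sub; rewrite cardsD (setIidPr sI) cI tx nbrUW nx cards1.
by move: lt d2; clear; lia.
Qed.
End Gadgets.
End Lists.

(** * Withholding three colours from the neighbours of a component *)

Section EndPiece.
Variables (T : finType) (e : rel T).
Hypotheses (es : symmetric e) (ei : irreflexive e).
Implicit Types (K D E R X S : {set T}).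

Lemma conn_drop R E r : conn e R -> r \in R -> r \notin E ->
  (forall u v, u \in E -> v \in R -> v \notin E -> e u v -> v = r) -> conn e (R :\: E).
Proof.
move=> cR rR rE att; apply/connP => A sA nA cA; have [a aA] := set0Pn _ nA.
have sAR : A \subset R by apply: subset_trans sA (subsetDl _ _).
have [rA|rA] := boolP (r \in A); last first.
  suff eA : A = R by rewrite eA rR in rA.
  apply: (conn_closed cR sAR aA) => x y xA yR exy; apply: (cA x) => //.
  rewrite inE yR andbT; apply/negP => yE.
  have := subsetP sA _ xA; rewrite inE => /andP[xE xR].
  by move: rA; rewrite -(att y x) // ?xA // es.
have sub : R \subset A :|: E.
  apply: (conn_sub cR rR); first by rewrite inE rA.
  move=> x y; rewrite !inE => /orP[xA|xE] yR exy.
    by have [|yE] := boolP (y \in E); rewrite ?orbT // orbF; apply: (cA x); rewrite // inE yE.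
  have [|yE] := boolP (y \in E); rewrite ?orbT // orbF.
  by rewrite (att x y).
apply/eqP; rewrite eqEsubset sA; apply/subsetP => x; rewrite inE => /andP[xE xR].
by have := subsetP sub _ xR; rewrite inE (negPf xE) orbF.
Qed.

Definition piece K r D := r \in K /\ component e (K :\ r) D.

Lemma piece_sub K r D : piece K r D -> [/\ D \subset K, r \notin D, bag e D &
  forall u v, u \in D -> v \in K -> v \notin D -> e u v -> v = r].
Proof.
move=> [rK [sD bD clD]]; split=> //.
- exact: subset_trans sD (subsetDl _ _).
- by apply/negP => /(subsetP sD); rewrite !inE eqxx.
move=> u v uD vK vD euv; apply/eqP; apply: contraNT vD => vr.
by apply: (clD u) => //; rewrite !inE vr.
Qed.

Lemma piece_root K r D : conn e K -> piece K r D -> exists2 d, d \in D & e d r.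
Proof.
move=> cK p; have [sD rD bD att] := piece_sub p; have [rK _] := p.
have [/set0Pn[x xD] _] := andP bD.
have [d [y [dD yK yD edy]]] := conn_cut cK sD xD rK rD.
by exists d => //; rewrite -(att d y).
Qed.

Lemma piece_rest K r D : conn e K -> piece K r D -> conn e (K :\: D).
Proof.
by move=> cK p; have [sD rD bD att] := piece_sub p; apply: (conn_drop cK (r := r)) => //; case: p.
Qed.

(** A cut vertex of [K] inside [D] has a piece on the side away from [r], properly inside [D]. The
    result is a leaf block without its cut vertex; there [bad_twin] applies to every edge. *)
Lemma end_piece K r D : conn e K -> ~~ conn e (K :\ r) -> piece K r D ->
  exists r' D', [/\ D' \subset D, piece K r' D', ~~ conn e (K :\ r') &
    forall z, z \in D' -> conn e (K :\ z)].
Proof.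
move=> cK; have [n] := ubnP #|D|; elim: n => // n IH in r D * => sD ncr p.
have [/exists_inP[z zD ncz]|/exists_inPn h] := boolP [exists z in D, ~~ conn e (K :\ z)]; last first.
  by exists r, D; split=> // z /h; rewrite negbK.
have [sDK rD bD att] := piece_sub p; have [rK _] := p.
have zK := subsetP sDK _ zD.
have rz : r != z by apply: contraNneq rD => ->.
have rKz : r \in K :\ z by rewrite !inE rz.
have [M [cM rM]] := component_of es rKz; have [sM /andP[_ cnM] clM] := cM.
have [y yK yM] : exists2 y, y \in K :\ z & y \notin M.
  have : ~~ (K :\ z \subset M).
    apply: contra ncz => sKM; suff <- : M = K :\ z by [].
    by apply/eqP; rewrite eqEsubset sM.
  by case/subsetPn => y; exists y.
have [M' [cM' yM']] := component_of es yK.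
have RM : K :\: D \subset M.
  apply: (conn_sub (piece_rest cK p) (x := r)); rewrite ?inE ?rD //.
  move=> u v uM; rewrite inE => /andP[vD vK] euv; apply: (clM u) => //.
  by rewrite !inE vK andbT; apply: contraNneq vD => ->.
have sM'D : M' \subset D :\ z.
  apply/subsetP => u uM'; have [sM' _ _] := cM'.
  have := subsetP sM' _ uM'; rewrite !inE => /andP[-> uK] /=.
  apply: contraT => uD; have uM : u \in M by apply: (subsetP RM); rewrite inE uD.
  by rewrite (component_eq cM cM' uM uM') yM' in yM.
have [|||r' [D' [s1 p1 nc1 h1]]] := IH z M'.
- apply: leq_ltn_trans (subset_leq_card sM'D) _; move: sD; rewrite (cardsD1 z D) zD.
  by rewrite add1n ltnS.
- exact: ncz.
- by split.
exists r', D'; split=> //; apply: subset_trans s1 _; apply: subset_trans sM'D _; exact: subsetDl.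
Qed.

Lemma two_pieces K r : conn e K -> r \in K -> ~~ conn e (K :\ r) -> exists D1 D2,
  [/\ piece K r D1, piece K r D2 & [disjoint D1 & D2]].
Proof.
move=> cK rK ncr; have [A [sA nA [y yK yA] clA]] := disconn ncr.
have [x xA] := set0Pn _ nA; have xK := subsetP sA _ xA.
have [D1 [c1 xD1]] := component_of es xK; have [D2 [c2 yD2]] := component_of es yK.
exists D1, D2; split=> //; apply: disjP => z z1 z2.
have e12 := component_eq c1 c2 z1 z2; move/negP: yA; apply.
have [sD1 /andP[_ cD1] _] := c1.
have : D1 \subset A.
  by apply: (conn_sub cD1 xD1 xA) => u v uA vD; apply: clA => //; apply: (subsetP sD1).
by move/subsetP; apply; rewrite e12.
Qed.
End EndPiece.

(** * Components whose removal with any one neighbouring hub keeps the graph connected *)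

Section Regular.
Variables (T C : finType) (e : rel T).
Hypotheses (es : symmetric e) (ei : irreflexive e).
Hypotheses (K5 : K5free e) (K33 : K33free e).
Variables (K N W : {set T}) (La : T -> {set C}) (y0 : T).
Hypothesis H3 : forall S : {set T}, #|S| <= 2 -> conn e (~: S).
Hypothesis HN : forall v, (v \in N) = (v \notin K) && touch e [set v] K.
Hypotheses (y0K : y0 \notin K) (y0N : y0 \notin N).
Hypothesis HK : forall t, t \in N -> conn e (~: (t |: K)).
Hypotheses (cK : conn e K) (K0 : K != set0) (WN : W \subset N) (U2 : #|N :\: W| <= 2).
Hypothesis hL : forall z, z \in K -> #|nbr e z K| + #|nbr e z N| <= #|La z|.

Lemma escape (X S : {set T}) x0 y : #|S| <= 2 -> x0 \in X -> [disjoint X & S] ->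
  y \notin X -> y \notin S -> exists u v, [/\ u \in X, v \notin X, v \notin S & e u v].
Proof.
move=> S2 xX dXS yX yS.
have sX : X \subset ~: S by rewrite -disjoints_subset.
have yS' : y \in ~: S by rewrite inE.
have [u [v [uX]]] := conn_cut (H3 S2) sX xX yS' yX.
by rewrite inE => vS vX euv; exists u, v; split.
Qed.

Lemma N_notK v : v \in N -> v \notin K.
Proof. by rewrite HN => /andP[]. Qed.

Lemma NI v z : v \notin K -> z \in K -> e z v -> v \in N.
Proof. by move=> vK zK ezv; rewrite HN vK; apply/touch1P; exists z; rewrite // es. Qed.

Lemma N_touch v : v \in N -> exists2 z, z \in K & e z v.
Proof. by rewrite HN => /andP[_ /touch1P[z zK]]; exists z; rewrite // es. Qed.

Lemma N_gt2 : 2 < #|N|.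
Proof.
rewrite ltnNge; apply/negP => N2; have [k kK] := set0Pn _ K0.
have dKN : [disjoint K & N] by apply: disjP => z zK /N_notK/negP.
have [u [v [uK vK vN euv]]] := escape N2 kK dKN y0K y0N.
by rewrite (NI vK uK euv) in vN.
Qed.

Lemma W_ex : exists w, w \in W.
Proof.
apply/set0Pn; rewrite -card_gt0; have := N_gt2; rewrite -(cardsID W N) (setIidPr WN).
by case: #|W| => //; rewrite add0n ltnNge U2.
Qed.

(** Supplies the third branch set for [N_all_K33]. [Q] contains [y0], and with fewer than three
    contacts in [N] it would be separated from [K] by two vertices. *)
Lemma far_comp : exists Q (n1 n2 n3 : T), [/\ bag e Q, [disjoint Q & K :|: N],
  [/\ n1 \in N, n2 \in N & n3 \in N], [/\ n1 != n2, n2 != n3 & n3 != n1] &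
  [/\ touch e Q [set n1], touch e Q [set n2] & touch e Q [set n3]]].
Proof.
have y0X : y0 \in ~: (K :|: N) by rewrite !inE negb_or y0K.
have [Q [[sQ bQ clQ] yQ]] := component_of es y0X.
have dQ : [disjoint Q & K :|: N] by rewrite disjoints_subset.
pose M := [set n in N | touch e Q [set n]].
have /card_gt2P[n1 [n2 [n3 [[m1 m2 m3] d]]]] : 2 < #|M|.
  rewrite ltnNge; apply/negP => M2; have [k kK] := set0Pn _ K0.
  have dQM : [disjoint Q & M].
    by apply: disjP => z zQ; rewrite inE => /andP[zN _]; apply: (disjE dQ zQ); rewrite inE zN orbT.
  have kQ : k \notin Q by apply/negP => kQ; apply: (disjE dQ kQ); rewrite inE kK.
  have kM : k \notin M by rewrite inE negb_and; apply/orP; left; apply/negP => /N_notK; rewrite kK.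
  have [u [v [uQ vQ vM euv]]] := escape M2 yQ dQM kQ kM.
  have uKN : u \notin K :|: N by apply/negP; apply: disjE dQ uQ.
  have vN : v \notin N.
    apply: contra vM => vN; rewrite inE vN; apply/touchP; exists u, v; by rewrite set11.
  have [vK|vK] := boolP (v \in K).
    by move: uKN; rewrite !inE negb_or => /andP[uK]; rewrite (NI uK vK) // es.
  by rewrite (clQ u) // !inE negb_or vK in vQ.
move: m1 m2 m3; rewrite !inE => /andP[? ?] /andP[? ?] /andP[? ?].
by exists Q, n1, n2, n3; split.
Qed.

(** By [HK] neither [v] nor [w] separates together with [K], so a component beyond both must be
    attached to each of them. *)
Lemma comp_touch v w Q : v != w -> v \in N -> w \in N ->
  component e (~: (K :|: [set v; w])) Q -> touch e Q [set v] /\ touch e Q [set w].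
Proof.
have main v' w' Q' : v' != w' -> v' \in N -> w' \in N ->
    component e (~: (K :|: [set v'; w'])) Q' -> touch e Q' [set w'].
  move=> vw vN wN [sQ /andP[/set0Pn[q qQ] cQ] clQ].
  have sQ' : Q' \subset ~: (v' |: K).
    apply: subset_trans sQ _; rewrite setCS; apply/subsetP => z; rewrite !inE.
    by case/orP => ->; rewrite ?orbT.
  have wV : w' \in ~: (v' |: K) by rewrite !inE negb_or eq_sym vw N_notK.
  have wQ : w' \notin Q' by apply/negP => /(subsetP sQ); rewrite !inE eqxx !orbT.
  have [x [y [xQ yV yQ exy]]] := conn_cut (HK vN) sQ' qQ wV wQ.
  apply/touchP; exists x, y; split=> //; rewrite inE; apply: contraNT yQ => yw.
  apply: (clQ x) => //; move: yV; rewrite !inE !negb_or => /andP[-> ->]; by rewrite yw.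
move=> vw vN wN cQ; split; last exact: main cQ.
by apply: (main w v) => //; [rewrite eq_sym|rewrite [[set w; v]]setUC].
Qed.

Lemma w_out w : w \in N -> exists2 y, y \notin K & (y != w) && e w y.
Proof.
move=> wN; have [t tN tw] : exists2 t, t \in N & t != w.
  have /card_gt1P[a [b [aN bN ab]]] : 1 < #|N| by apply: ltnW N_gt2.
  by have [aw|] := eqVneq a w; [exists b; rewrite // -aw eq_sym|exists a].
have wV : [set w] \subset ~: (t |: K).
  by rewrite sub1set !inE negb_or eq_sym tw N_notK.
have yV : y0 \in ~: (t |: K).
  by rewrite !inE negb_or y0K andbT; apply: contraNneq y0N => ->.
have yw : y0 \notin [set w] by rewrite inE; apply: contraNneq y0N => ->.
have [x [y [/set1P-> yV' yw' ewy]]] := conn_cut (HK tN) wV (set11 w) yV yw.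
exists y; first by move: yV'; rewrite !inE negb_or => /andP[].
by rewrite ewy andbT; move: yw'; rewrite inE.
Qed.

Lemma disjoint_1_1 (a b : T) : a != b -> [disjoint [set a] & [set b]].
Proof. by rewrite disjoints1 inE. Qed.
Lemma disjoint_1_l (a : T) (X : {set T}) : a \notin X -> [disjoint [set a] & X].
Proof. by rewrite disjoints1. Qed.
Lemma disjoint_1_r (a : T) (X : {set T}) : a \notin X -> [disjoint X & [set a]].
Proof. by rewrite disjoint_sym disjoints1. Qed.

Hypothesis nsafe : ~ safe e K La N W.

Lemma high_degree z w : z \in K -> w \in W -> e z w ->
  2 < #|nbr e z K| + #|nbr e z (N :\: W)|.
Proof.
move=> zK wW ezw; rewrite ltnNge; apply/negP => h; apply: nsafe.
exact: (safe_low_degree es ei cK WN hL zK wW).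
Qed.

(** Otherwise some edge of [D] joins a neighbour of [w] to a vertex not adjacent to [w], and
    [safe_twin] applies to it. *)
Lemma universal D w : conn e D -> D \subset K -> (forall z, z \in D -> conn e (K :\ z)) ->
  w \in W -> touch e [set w] D -> forall z, z \in D -> e z w.
Proof.
move=> cD sD nc wW /touch1P[x xD ewx] z zD; apply: contraT => ezw.
have sA : nbr e w D \subset D by apply/subsetP => y; rewrite inE => /andP[].
have xA : x \in nbr e w D by rewrite inE xD.
have zA : z \notin nbr e w D by rewrite inE zD es.
have [u [v [uA vD vA euv]]] := conn_cut cD sA xA zD zA.
move: uA vA; rewrite !inE vD /= => /andP[uD ewu] ewv; exfalso; apply: nsafe.
by apply: (safe_twin es ei cK WN hL (subsetP sD _ uD) (subsetP sD _ vD) (nc _ uD) (nc _ vD) euv wW);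
  rewrite 1?es.
Qed.

Lemma nbrU_touch z : 0 < #|nbr e z (N :\: W)| ->
  exists u, [/\ u \in N, u \notin W & e z u].
Proof. by move/card_gt0P => [u]; rewrite !inE => /andP[/andP[? ?] ?]; exists u. Qed.

Lemma N_all_K33 (D1 D2 : {set T}) : bag e D1 -> bag e D2 -> [disjoint D1 & D2] ->
  D1 \subset K -> D2 \subset K ->
  (forall n, n \in N -> touch e D1 [set n] /\ touch e D2 [set n]) -> False.
Proof.
move=> b1 b2 d12 s1 s2 h.
have [Q [n1 [n2 [n3 [bQ dQ [m1 m2 m3] [n12 n23 n31] [t1 t2 t3]]]]]] := far_comp.
have nQ n : n \in N -> n \notin Q.
  by move=> nN; apply/negP => /(disjE dQ); apply; rewrite inE nN orbT.
have nD (D : {set T}) n : D \subset K -> n \in N -> n \notin D.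
  by move=> sD /N_notK; apply: contra; apply: (subsetP sD).
have dD (D : {set T}) : D \subset K -> [disjoint D & Q].
  by move=> sD; apply: disjP => z /(subsetP sD) zK /(disjE dQ); apply; rewrite inE zK.
apply: (K33 (a1 := D1) (a2 := D2) (a3 := Q) (b1 := [set n1]) (b2 := [set n2]) (b3 := [set n3])).
- by rewrite /= b1 b2 bQ !bag1.
- have n13 : n1 != n3 by rewrite eq_sym.
  by rewrite /= d12 !dD // !disjoint_1_1 // !(disjoint_1_r (nQ _ _)) // !disjoint_1_r ?nD.
- by rewrite /allrel /= t1 t2 t3; have [-> ->] := h _ m1; have [-> ->] := h _ m2; have [-> ->] := h _ m3.
Qed.

(** Each vertex of [W] is adjacent to all of [K]. With [w] as apex and the graph outside [w |: K] as
    one more vertex, [apex_K4_bag] applies unless some vertex has too few contacts; then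
    [high_degree] forces [K] to be an edge whose ends both see all of [N]. *)
Lemma regular_nocut : (forall z, z \in K -> conn e (K :\ z)) -> False.
Proof.
move=> nc; have [w wW] := W_ex; have wN := subsetP WN _ wW.
have all_w v z : v \in W -> z \in K -> e z v.
  move=> vW; apply: (universal cK (subxx _) nc vW).
  by apply/touch1P; have [z' z'K ez'] := N_touch (subsetP WN _ vW); exists z'; rewrite // es.
have [y yK /andP[yw ewy]] := w_out wN.
have [x0 x0K] := set0Pn _ K0.
pose O := ~: (w |: K).
have yO : y \in O by rewrite !inE negb_or yw.
have dK : [disjoint K & O] by apply: disjP => z zK; rewrite !inE zK orbT.
have [/forall_inP hd|] := boolP [forall x in K, 2 < #|nbr e x K| + touch e [set x] O].
  apply: (apex_K4_bag (w := w) es ei K5 K33 dK _ _ (HK wN) _ _ hd x0K); rewrite ?N_notK //.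
  - by rewrite !inE eqxx.
  - by apply/touch1P; exists y.
  - by move=> x xK; rewrite es all_w.
rewrite negb_forall => /existsP[x]; rewrite negb_imply -leqNgt => /andP[xK dx].
have gx := high_degree xK wW (all_w w x wW xK).
have Ux : 0 < #|nbr e x (N :\: W)| by move: gx dx; case: (touch _ _ _); clear; clia.
have tx : touch e [set x] O.
  have [u [uN uW exu]] := nbrU_touch Ux; apply/touch1P; exists u => //.
  by rewrite !inE negb_or N_notK // andbT; apply: contraNneq uW => ->.
have d1x : #|nbr e x K| <= 1 by move: dx; rewrite tx; clear; clia.
have leU z : #|nbr e z (N :\: W)| <= #|N :\: W|.
  by apply: subset_leq_card; apply/subsetP => v; rewrite inE => /andP[].
have Uall z : 1 < #|nbr e z (N :\: W)| -> forall u, u \in N -> u \notin W -> e z u.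
  move=> gz u uN uW; have sub : nbr e z (N :\: W) \subset N :\: W.
    by apply/subsetP => v; rewrite inE => /andP[].
  have /eqP eU : nbr e z (N :\: W) == N :\: W by rewrite eqEcard sub (leq_trans U2).
  have : u \in N :\: W by rewrite inE uW.
  by rewrite -eU inE => /andP[].
have Ux2 : 1 < #|nbr e x (N :\: W)| by move: gx d1x; clear; clia.
have K1 : 1 < #|K|.
  rewrite ltnNge; apply/negP => K1; have := gx; have := leU x.
  suff -> : nbr e x K = set0 by rewrite cards0 add0n => h1 /leq_trans/(_ h1)/leq_trans/(_ U2).
  apply/setP => z; rewrite !inE; apply/andP => -[zK exz].
  have xz : x != z by apply: contraTneq exz => ->; rewrite ei.
  have : #|[set x; z]| <= #|K| by apply: subset_leq_card; rewrite subUset !sub1set xK.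
  by rewrite cards2 xz => /leq_trans/(_ K1).
have /card_gt0P[y' ] := nbr_gt0 cK xK K1; rewrite inE => /andP[y'K exy].
have y'x : y' != x by apply: contraTneq exy => ->; rewrite ei.
have nx : nbr e x K = [set y'].
  apply/eqP; rewrite eq_sym eqEcard cards1 d1x andbT sub1set inE y'K //.
(* an end vertex of K is attached at a cut vertex, unless K is an edge *)
have eK : K = [set x; y'].
  have := nc y' y'K => cy.
  have sx : [set x] \subset K :\ y' by rewrite sub1set !inE eq_sym y'x.
  have -> : K = y' |: (K :\ y') by rewrite setD1K.
  rewrite setUC; congr (_ :|: _); apply/esym.
  apply: (conn_closed cy sx (set11 x)) => u v /set1P-> ; rewrite !inE => /andP[vy vK] exv.
  have : v \in nbr e x K by rewrite inE vK.
  by rewrite nx inE (negPf vy).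
have gy := high_degree y'K wW (all_w w y' wW y'K).
have d1y : #|nbr e y' K| <= 1.
  apply: (@leq_trans #|[set x]|); last by rewrite cards1.
  apply: subset_leq_card; apply/subsetP => z; rewrite eK !inE => /andP[/orP[//|/eqP->]].
  by rewrite ei.
have Uy2 : 1 < #|nbr e y' (N :\: W)| by move: gy d1y; clear; clia.
apply: (@N_all_K33 [set x] [set y']); rewrite ?bag1 ?sub1set ?disjoint_1_1 // 1?eq_sym //.
move=> n nN; rewrite !touch1; have [nW|nW] := boolP (n \in W); first by rewrite !all_w.
by rewrite (Uall x) ?(Uall y').
Qed.
Lemma piece_deg r D z : piece e K r D -> z \in D -> #|nbr e z K| = #|nbr e z D| + e z r.
Proof.
move=> p zD; have [sD rD bD att] := piece_sub p; have [rK _] := p.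
rewrite (cardsD1 r) !inE rK /= addnC; congr (_ + _); apply: eq_card => x; rewrite !inE.
have [->|xr] /= := eqVneq x r; first by rewrite (negPf rD).
case exz: (e z x); rewrite ?andbF ?andbT //; apply/idP/idP; last exact: (subsetP sD).
by move=> xK; apply: contraNT xr => xD; rewrite (att z x).
Qed.

Lemma rest_escape r D w : w \notin K -> piece e K r D -> ~~ conn e (K :\ r) ->
  exists u v, [/\ u \in K :\: D, u != r, v \notin K, v != w & e u v].
Proof.
move=> wK p ncr; have [sD rD /andP[/set0Pn[d dD] cD] att] := piece_sub p; have [rK [sD' _ _]] := p.
have [x xX] : exists x, x \in (K :\: D) :\ r.
  have : ~~ (K :\ r \subset D).
    by apply: contra ncr => s; suff <- : D = K :\ r by []; apply/eqP; rewrite eqEsubset sD'.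
  by case/subsetPn => x; rewrite !inE => /andP[xr xK] xD; exists x; rewrite !inE xr xK xD.
have dX : [disjoint (K :\: D) :\ r & [set r; w]].
  apply: disjP => z; rewrite !inE => /and3P[/negPf-> _ zK] /= /eqP zw.
  by rewrite -zw zK in wK.
have S2 : #|[set r; w]| <= 2 by rewrite cards2; case: (_ != _).
have dX1 : d \notin (K :\: D) :\ r by rewrite !inE dD andbF.
have dX2 : d \notin [set r; w].
  by rewrite !inE negb_or; apply/andP; split; [apply: contraNneq rD|apply: contraNneq wK] => <-;
    rewrite ?(subsetP sD).
have [u [v [uX vX vS euv]]] := escape S2 xX dX dX1 dX2.
move: vS; rewrite !inE negb_or => /andP[vr vw].
exists u, v; move: uX; rewrite inE => /andP[]; rewrite in_set1 => ur uKD; split=> //.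
apply/negP => vK; move: vX; rewrite !inE vr vK andbT negbK => vD.
move: uKD; rewrite inE => /andP[uD uK]; move/eqP: ur; apply; apply: (att v) => //.
by rewrite es.
Qed.
Section Piece.
Variables (r : T) (D : {set T}).
Hypotheses (p : piece e K r D) (ncr : ~~ conn e (K :\ r)).
Hypothesis nc : forall z, z \in D -> conn e (K :\ z).

(** Against [apex_K4_bag] only a vertex [x] adjacent to [r] with a single neighbour [y] in [D] can
    remain. Unless [safe_pair] applies to [x] and [y], a hub [v] other than [w] sees both [x] and
    the rest of [D]. This completes a [K5] if [w] touches [R], and a [K33] otherwise. *)
Lemma W_piece_small w : w \in W -> touch e [set w] D -> 1 < #|D| -> False.
Proof.
move=> wW twD D1; have [sD rD bD att] := piece_sub p; have [rK _] := p.
have wN := subsetP WN _ wW; have wK := N_notK wN.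
have [_ cD] := andP bD.
have uni v : v \in W -> touch e [set v] D -> forall z, z \in D -> e z v.
  by move=> vW tv; apply: universal.
have uw := uni w wW twD.
pose R := K :\: D; pose Y := ~: (w |: K).
have rR : r \in R by rewrite !inE rD.
have cR : conn e R := piece_rest es cK p.
have cY : conn e Y := HK wN.
have [u1 [v1 [u1R _ v1K v1w uv1]]] := rest_escape wK p ncr.
have v1Y : v1 \in Y by rewrite !inE negb_or v1w.
have tRY : touch e R Y by apply/touchP; exists u1, v1.
have [yw ywK /andP[yww ewy]] := w_out wN.
have ywY : yw \in Y by rewrite !inE negb_or yww.
have YK z : z \in Y -> z \in K -> False by rewrite !inE negb_or => /andP[_ /negP].
have wD : w \notin D by apply: contra wK; apply: (subsetP sD).
have wR : w \notin R by rewrite inE negb_and wK orbT.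
have wY : w \notin Y by rewrite !inE eqxx.
have dDR : [disjoint D & R] by apply: disjP => z zD; rewrite inE zD.
have dDY : [disjoint D & Y] by apply: disjP => z /(subsetP sD) zK /YK.
have dRY : [disjoint R & Y] by apply: disjP => z; rewrite inE => /andP[_ zK] /YK.
pose O := R :|: Y.
have cO : conn e O by apply: connU.
have [x0 x0D] : exists x, x \in D by apply/card_gt0P; apply: ltnW.
have [/forall_inP hd|] := boolP [forall x in D, 2 < #|nbr e x D| + touch e [set x] O].
  apply: (apex_K4_bag (w := w) es ei K5 K33 _ wD _ cO _ _ hd x0D).
  - by apply: disjP => z zD; rewrite inE => /orP[]; [apply: disjE dDR zD|apply: disjE dDY zD].
  - by rewrite inE negb_or wR.
  - by apply/touch1P; exists yw; rewrite // inE ywY orbT.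
  - by move=> x /uw; rewrite es.
rewrite negb_forall => /existsP[x]; rewrite negb_imply -leqNgt => /andP[xD dx].
have xK := subsetP sD _ xD.
have gx := high_degree xK wW (uw x xD); rewrite (piece_deg p xD) in gx.
have tr : e x r -> touch e [set x] O.
  by move=> exr; apply/touch1P; exists r; rewrite // inE rR.
have tU : 0 < #|nbr e x (N :\: W)| -> touch e [set x] O.
  move=> /nbrU_touch[u [uN uW exu]]; apply/touch1P; exists u; rewrite // inE; apply/orP; right.
  by rewrite !inE negb_or N_notK // andbT; apply: contraNneq uW => ->.
have D0 := nbr_gt0 cD xD D1.
have d1x : #|nbr e x D| = 1.
  have [t|t] := boolP (touch e [set x] O); first by move: dx D0; rewrite t; clear; clia.
  have nxr : e x r = false by apply: contraNF t.
  have nU : (0 < #|nbr e x (N :\: W)|) = false by apply: contraNF t.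
  by exfalso; move: dx gx nU; rewrite (negPf t) nxr; clear; clia.
have [y nx] := cards1P (introT eqP d1x).
have [yD exy] : y \in D /\ e x y by have := set11 y; rewrite -nx inE => /andP[].
have yx : y != x by apply: contraTneq exy => ->; rewrite ei.
have yK := subsetP sD _ yD.
have xr : x != r by apply: contraNneq rD => <-.
have exr : e x r.
  apply: contraT => exr.
  have sx : [set x] \subset K :\ y by rewrite sub1set !inE eq_sym yx.
  have rKy : r \in K :\ y by rewrite !inE rK andbT; apply: contraNneq rD => ->.
  have rx : r \notin [set x] by rewrite inE eq_sym.
  have [u [v [/set1P-> vK vx euv]]] := conn_cut (nc yD) sx (set11 x) rKy rx.
  move: vK; rewrite !inE => /andP[vy vK].
  have [vD|vD] := boolP (v \in D).
    have : v \in nbr e x D by rewrite inE vD.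
    by rewrite nx inE (negPf vy).
  by move: exr; rewrite -(att x v) ?euv.
have Ux : 0 < #|nbr e x (N :\: W)| by move: gx; rewrite d1x exr; clear; clia.
have dKx : #|nbr e x K| <= 2 by rewrite (piece_deg p xD) d1x exr.
pose X2 := D :\ x.
have yX : y \in X2 by rewrite !inE yx.
have cX2 : conn e X2.
  apply: (conn_drop es cD (r := y)); rewrite ?inE // => u v /set1P-> vD vx exv.
  by apply/set1P; rewrite -nx inE vD.
have X2D : X2 \subset D := subsetDl _ _.
have t2R : touch e X2 R.
  have sX : X2 \subset K :\ x.
    by apply/subsetP => z; rewrite !inE => /andP[-> /(subsetP sD)->].
  have rX : r \in K :\ x by rewrite !inE eq_sym xr.
  have rX2 : r \notin X2 by rewrite inE (negPf rD) andbF.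
  have [u [v [uX vK vX euv]]] := conn_cut (nc xD) sX yX rX rX2.
  apply/touchP; exists u, v; split=> //; move: vK vX; rewrite !inE => /andP[-> ->].
  by rewrite /= andbT.
have txR : touch e [set x] R by apply/touch1P; exists r.
have t1y : touch e [set x] X2 by apply/touch1P; exists y.
have tw2 : touch e X2 [set w] by apply/touchP; exists y, w; rewrite set11 uw.
have dx2 : [disjoint [set x] & X2] by rewrite disjoints1 !inE eqxx.
have dxR : [disjoint [set x] & R] by rewrite disjoints1 inE xD.
have d2R : [disjoint X2 & R] by apply: disjP => z /(subsetP X2D); apply: disjE dDR.
have [/existsP[v /and4P[vN vw exv t2v]]|none] := boolP
  [exists v, [&& v \in N, v != w, e x v & touch e X2 [set v]]]; last first.
  have only v : v \in N -> e x v -> touch e X2 [set v] -> v = w.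
    move=> vN exv tv; apply/eqP; apply: contraNT none => vw.
    by apply/existsP; exists v; rewrite vN vw exv tv.
  have WD v z : v \in W -> z \in D -> e z v -> v = w.
    move=> vW zD ezv; have u' : forall z', z' \in D -> e z' v.
      by apply: uni => //; apply/touch1P; exists z; rewrite // es.
    apply: only; rewrite ?(subsetP WN) ?u' //; apply/touchP; exists y, v.
    by rewrite set11 u'.
  have nW z : z \in D -> nbr e z W = [set w].
    move=> zD; apply/setP => v; rewrite !inE; apply/andP/eqP => [[vW]|->]; first exact: WD.
    by rewrite wW uw.
  apply: nsafe; apply: (safe_pair es ei cK WN hL (x := x) (y := y) (w := w)) => //; rewrite ?nW ?nc //.
  - by rewrite -card_gt0.
  - apply: disjP => u; rewrite !inE => /andP[/andP[uW uN] exu] /andP[_ eyu].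
    by move: uW; rewrite (only u) ?wW //; apply/touchP; exists y, u; rewrite set11.
have vK := N_notK vN.
have [twR|twR] := boolP (touch e [set w] R).
  have vY : v \in Y by rewrite !inE negb_or vw.
  apply: (K5 (a1 := [set x]) (a2 := X2) (a3 := R) (a4 := [set w]) (a5 := Y)).
    by rewrite /= !bag1 (bagP yX cX2) (bagP rR cR) (bagP v1Y cY).
  have dx' : [disjoint [set x] & Y] by rewrite disjoints1; apply/negP => /YK.
  have d2Y : [disjoint X2 & Y] by apply: disjP => z /(subsetP X2D); apply: disjE dDY.
  rewrite /= dx2 t1y dxR txR d2R t2R dx' d2Y dRY tRY tw2 touch1 uw // (touch_sym R) // twR.
  have xw : x != w by apply: contraNneq wK => <-.
  have wX2 : w \notin X2 by apply: contra wD => /(subsetP X2D).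
  rewrite (disjoint_1_1 xw) (disjoint_1_l wY) !disjoint_1_r //=.
  rewrite (_ : touch e [set x] Y) /=; last by apply/touch1P; exists v.
  rewrite (_ : touch e X2 Y) /=; last by apply: touchS t2v; rewrite ?sub1set.
  by rewrite !andbT; apply/touch1P; exists yw.
(* As [w] does not touch [R], an edge that leaves [K] from [R] and avoids [v] ends in a component
   [Q] beyond both [w] and [v]. *)
have [u2 [v2 [u2R _ v2K v2v uv2]]] := rest_escape vK p ncr.
have v2w : v2 != w.
  apply: contraNneq twR => v2w; apply/touch1P; exists u2; rewrite // es -v2w //.
have v2X : v2 \in ~: (K :|: [set w; v]) by rewrite !inE !negb_or v2K v2w.
have [Q [cQ v2Q]] := component_of es v2X.
have wv : w != v by rewrite eq_sym.
have [tQw tQv] := comp_touch wv wN vN cQ.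
have [sQ bQ clQ] := cQ.
have Qn z : z \in Q -> [/\ z \notin K, z != w & z != v].
  by move=> /(subsetP sQ); rewrite !inE !negb_or => /and3P[].
apply: (K33 (a1 := [set x]) (a2 := X2) (a3 := Q) (b1 := [set w]) (b2 := [set v]) (b3 := R)).
- by rewrite /= !bag1 bQ (bagP yX cX2) (bagP rR cR).
- have KQ z : z \in K -> z \notin Q by move=> zK; apply/negP => /Qn[]; rewrite zK.
  have d2Q : [disjoint X2 & Q].
    by apply: disjP => z /(subsetP X2D)/(subsetP sD)/KQ/negP.
  have dQR : [disjoint Q & R].
    by apply: disjP => z /Qn[zK _ _]; rewrite inE (negPf zK) andbF.
  have xw : x != w by apply: contraNneq wK => <-.
  have xv : x != v by apply: contraNneq vK => <-.
  have X2n z : z \notin K -> z \notin X2.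
    by apply: contra => /(subsetP X2D)/(subsetP sD).
  have wQ : w \notin Q by apply/negP => /Qn[]; rewrite eqxx.
  have vQ : v \notin Q by apply/negP => /Qn[_ _]; rewrite eqxx.
  have vR : v \notin R by rewrite inE negb_and vK orbT.
  by rewrite /= dx2 d2Q d2R dQR dxR !disjoint_1_1 // !disjoint_1_r ?X2n // !disjoint_1_l // KQ.
- rewrite /allrel /= tQw tQv tw2 t2v !touch1 uw // exv txR t2R /= !andbT.
  by apply/touchP; exists v2, u2; rewrite // es.
Qed.
(** Every end piece uses both exempted hubs. A vertex of [W] at [D] makes [D] a single vertex of
    degree at most one in [K], which by [high_degree] has two exempted neighbours; without such a
    vertex 3-connectivity demands two contacts, all of them exempted. *)
Lemma piece_U : (forall w, w \in W -> touch e [set w] D -> exists x, D = [set x]) /\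
  #|N :\: W| = 2 /\ forall u, u \in N :\: W -> touch e D [set u].
Proof.
have [sD rD /[dup] bD /andP[/set0Pn[d dD] cD] att] := piece_sub p; have [rK _] := p.
have sing w : w \in W -> touch e [set w] D -> exists x, D = [set x].
  move=> wW tw; apply/cards1P; rewrite eqn_leq; apply/andP; split.
    by rewrite leqNgt; apply/negP; apply: W_piece_small tw.
  by apply/card_gt0P; exists d.
split=> //.
have [/exists_inP[w wW tw]|/exists_inPn unt] := boolP [exists w in W, touch e [set w] D].
  have [x eD] := sing w wW tw.
  have xK : x \in K by apply: (subsetP sD); rewrite eD set11.
  have exw : e x w.
    by move: tw; rewrite eD touch1 es.
  have xD : x \in D by rewrite eD set11.
  have gx := high_degree xK wW exw; rewrite (piece_deg p xD) in gx.
  have d0 : #|nbr e x D| = 0.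
    apply/eqP; rewrite cards_eq0; apply/eqP/setP => z; rewrite eD !inE.
    by case: eqP => // ->; rewrite ei.
  have Ux : 1 < #|nbr e x (N :\: W)| by move: gx; rewrite d0; case: (e x r); clear; clia.
  have sU : nbr e x (N :\: W) \subset N :\: W by apply/subsetP => v; rewrite inE => /andP[].
  have eU : nbr e x (N :\: W) = N :\: W by apply/eqP; rewrite eqEcard sU (leq_trans U2).
  split; first by apply/eqP; rewrite eqn_leq U2 -eU.
  by move=> u; rewrite -eU eD touch1 inE => /andP[].
pose M := [set u in N | touch e D [set u]].
have sM : M \subset N :\: W.
  apply/subsetP => u; rewrite !inE => /andP[uN tu]; rewrite uN andbT.
  by apply/negP => /unt; rewrite touch_sym // tu.
suff M2 : 1 < #|M|.
  have eM : M = N :\: W by apply/eqP; rewrite eqEcard sM (leq_trans U2).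
  split; first by apply/eqP; rewrite eqn_leq U2 -eM.
  by move=> u; rewrite -eM inE => /andP[].
rewrite ltnNge; apply/negP => M1.
have [x [_ [xKD xr _ _ _]]] := rest_escape y0K p ncr.
move: xKD; rewrite inE => /andP[xD xK].
have S2 : #|r |: M| <= 2 by rewrite cardsU1; case: (_ \notin _); move: M1; clear; clia.
have dS : [disjoint D & r |: M].
  apply: disjP => z zD; rewrite in_setU1 => /orP[/eqP zr|]; first by rewrite -zr zD in rD.
  by rewrite inE => /andP[/N_notK]; rewrite (subsetP sD).
have xS : x \notin r |: M.
  by rewrite in_setU1 negb_or xr inE negb_and; apply/orP; left; apply/negP => /N_notK; rewrite xK.
have [u [v [uD vD]]] := escape S2 dD dS xD xS.
rewrite in_setU1 negb_or => /andP[vr vM] euv.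
have [vK|vK] := boolP (v \in K); first by move: vr; rewrite (att u v) // eqxx.
move: vM; rewrite inE (NI vK (subsetP sD _ uD) euv) /= => /negP; apply.
by apply/touchP; exists u, v; rewrite set11.
Qed.
End Piece.

(** Both exempted hubs [a] and [b] touch two disjoint end pieces. The rest of [K] would complete a
    [K33] with any component beyond [a] and [b] that touches it. Hence each hub of [W] sees only the
    end pieces, and both of them because of [safe_single], so that [N_all_K33] applies. *)
Lemma regular_absurd : False.
Proof.
have [/forall_inP|] := boolP [forall z in K, conn e (K :\ z)]; first exact: regular_nocut.
rewrite negb_forall => /existsP[r0]; rewrite negb_imply => /andP[r0K nc0].
have [D1 [D2 [p1 p2 d12]]] := two_pieces es cK r0K nc0.
have [r1 [D [sD q1 nc1 ncD]]] := end_piece es cK nc0 p1.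
have [r2 [E [sE q2 nc2 ncE]]] := end_piece es cK nc0 p2.
have dDE : [disjoint D & E].
  by apply: disjP => z /(subsetP sD) z1 /(subsetP sE); apply: disjE d12 z1.
have [singD [cU tD]] := piece_U q1 nc1 ncD; have [singE [_ tE]] := piece_U q2 nc2 ncE.
have /cards2P[a [b [ab eU]]] : #|N :\: W| == 2 by rewrite cU.
have aU : a \in N :\: W by rewrite eU !inE eqxx.
have bU : b \in N :\: W by rewrite eU !inE eqxx orbT.
have [aW aN] : a \notin W /\ a \in N by move: aU; rewrite inE => /andP[].
have [bW bN] : b \notin W /\ b \in N by move: bU; rewrite inE => /andP[].
have [sDK rD bD attD] := piece_sub q1; have [sEK rE bE attE] := piece_sub q2.
have [r1K _] := q1; have [r2K _] := q2.
have r1E : r1 \notin E by apply: contra nc1 => /ncE.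
have r2D : r2 \notin D by apply: contra nc2 => /ncD.
pose core := (K :\: D) :\: E.
have r1c : r1 \in core by rewrite !inE rD r1E.
have r2c : r2 \in core by rewrite !inE rE r2D.
have ccore : conn e core.
  apply: (conn_drop es (piece_rest es cK q1) (r := r2)) => //; first by rewrite inE r2D.
  by move=> u v uE; rewrite inE => /andP[_ vK]; apply: attE.
have tDc : touch e D core.
  by have [d dD edr] := piece_root cK q1; apply/touchP; exists d, r1.
have tEc : touch e E core.
  by have [d dE edr] := piece_root cK q2; apply/touchP; exists d, r2.
have Wpair w : w \in W -> touch e D [set w] /\ touch e E [set w].
  move=> wW; have wN := subsetP WN _ wW.
  have wX : w \in ~: (K :|: [set a; b]).
    by rewrite !inE !negb_or N_notK //=; apply/andP; split; apply: contraTneq wW => ->.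
  have [Q [cQ wQ]] := component_of es wX; have [sQ bQ clQ] := cQ.
  have [tQa tQb] := comp_touch ab aN bN cQ.
  have Qn z : z \in Q -> [/\ z \notin K, z != a & z != b].
    by move=> /(subsetP sQ); rewrite !inE !negb_or => /and3P[].
  have KQ z : z \in K -> z \notin Q by move=> zK; apply/negP => /Qn[]; rewrite zK.
  have core_free : ~~ touch e Q core.
    apply/negP => tQ.
    apply: (K33 (a1 := D) (a2 := E) (a3 := Q) (b1 := [set a]) (b2 := [set b]) (b3 := core)).
    - by rewrite /= bD bE bQ !bag1 (bagP r1c ccore).
    - have dK (X : {set T}) : X \subset K -> [disjoint X & Q].
        by move=> sX; apply: disjP => z /(subsetP sX)/KQ/negP.
      have nX (X : {set T}) z : X \subset K -> z \in N -> z \notin X.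
        by move=> sX /N_notK; apply: contra => /(subsetP sX).
      have sc : core \subset K by apply: subset_trans (subsetDl _ _) (subsetDl _ _).
      have aQ : a \notin Q by apply/negP => /Qn[]; rewrite eqxx.
      have bQ' : b \notin Q by apply/negP => /Qn[]; rewrite eqxx.
      have dDc : [disjoint D & core] by apply: disjP => z zD; rewrite !inE zD andbF.
      have dEc : [disjoint E & core] by apply: disjP => z zE; rewrite !inE zE.
      have dQc : [disjoint Q & core] by rewrite disjoint_sym dK.
      rewrite /= dDE (dK D) // (dK E) // dDc dEc dQc (disjoint_1_1 ab) !(disjoint_1_r aQ) !(disjoint_1_r bQ').
      by rewrite !disjoint_1_r ?nX // !disjoint_1_l ?nX.
    - by rewrite /allrel /= !tD // !tE // tQa tQb tQ tDc tEc.
  have TDE z : z \in K -> e z w -> (z \in D) || (z \in E).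
    move=> zK ezw; apply: contraNT core_free; rewrite negb_or => /andP[zD zE].
    by apply/touchP; exists w, z; rewrite es !inE zD zE.
  have aux (A B : {set T}) : (forall w', w' \in W -> touch e [set w'] A -> exists x, A = [set x]) ->
      (forall z, z \in K -> e z w -> (z \in A) || (z \in B)) -> A \subset K -> touch e B [set w].
    move=> sA tAB sAK; apply: contraT => tB.
    have nB z : z \in B -> e z w = false.
      by move=> zB; apply: contraNF tB => ezw; apply/touchP; exists z, w; rewrite set11.
    have [z zK ezw] := N_touch wN.
    have zA : z \in A by have := tAB z zK ezw; case: (boolP (z \in B)) => [/nB|]; rewrite ?ezw // orbF.
    have [|x eA] := sA w wW; first by apply/touch1P; exists z; rewrite // es.
    exfalso; apply: nsafe; apply: (safe_single es ei cK WN hL (x := x) wW) => //.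
    apply/setP => y; rewrite !inE es; apply/andP/eqP => [[yK eyw]|->].
      have := tAB y yK eyw; case: (boolP (y \in B)) => [/nB|_]; rewrite ?eyw // orbF eA.
      by move/set1P.
    by move: zA; rewrite eA => /set1P zx; rewrite -zx.
  split; last exact: (aux D E).
  by apply: (aux E D) => // z zK ezw; rewrite orbC TDE.
apply: (N_all_K33 bD bE dDE) => // n nN.
have [nW|nW] := boolP (n \in W); first exact: Wpair.
by rewrite tD ?tE // inE nW.
Qed.
End Regular.

(** * The distinguished component, none of whose hubs is exempted *)

Section Special.
Variables (T C : finType) (e : rel T).
Hypotheses (es : symmetric e) (ei : irreflexive e).
Hypotheses (K5 : K5free e) (K33 : K33free e).
Implicit Types (K N W : {set T}) (La : T -> {set C}).

Lemma regular_safe K N W La y0 : (forall S : {set T}, #|S| <= 2 -> conn e (~: S)) ->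
  (forall v, (v \in N) = (v \notin K) && touch e [set v] K) -> y0 \notin K -> y0 \notin N ->
  (forall t, t \in N -> conn e (~: (t |: K))) -> conn e K -> K != set0 -> W \subset N ->
  #|N :\: W| <= 2 ->
  (forall z, z \in K -> #|nbr e z K| + #|nbr e z N| <= #|La z|) -> safe e K La N W.
Proof.
move=> H3 HN y0K y0N HK cK K0 WN U2 hL; apply: boolp.contrapT => ns.
exact: (regular_absurd es ei K5 K33 H3 HN y0K y0N HK cK K0 WN U2 hL ns).
Qed.

(** Vertices of [K] without contact to [N] that do not cut [K] are coloured first. Afterwards every
    end piece sees [N], and with no exemptions [high_degree] bounds the degrees in [K] alone. A hub
    [w] adjacent to a whole end piece is the apex, and the connected set [D] serves to link [w] to
    the rest of [K]. *)
Lemma special_safe K D N La : conn e K -> conn e D -> [disjoint K & D] ->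
  (forall v, (v \in N) = (v \in D) && touch e [set v] K) -> N != set0 ->
  (forall z, z \in K -> #|nbr e z K| + #|nbr e z N| <= #|La z|) -> safe e K La N N.
Proof.
have [n] := ubnP #|K|; elim: n => // n IH in K La * => sK cK cD dKD HN nN hL.
have [v0 v0N] := set0Pn _ nN.
have NK v : v \in N -> v \notin K.
  by rewrite HN => /andP[vD _]; apply/negP => vK; apply: disjE dKD vK vD.
have [/exists_inP[u uK /andP[cu /eqP nu]]|/exists_inPn tou] := boolP
   [exists u in K, conn e (K :\ u) && (nbr e u N == set0)].
  have Nu v : v \in N -> ~~ e v u.
    move=> vN; rewrite es; apply/negP => euv; have : v \in nbr e u N by rewrite inE vN.
    by rewrite nu inE.
  have K1 : 1 < #|K|.
    move: (v0N); rewrite HN => /andP[_ /touch1P[z zK ez]].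
    by apply/card_gt1P; exists z, u; split=> //; apply: contraTneq ez => ->; apply: Nu.
  have [c cu'] : exists c, c \in La u.
    apply/set0Pn; rewrite -card_gt0; apply: leq_trans (hL u uK); rewrite nu cards0 addn0.
    exact: nbr_gt0.
  have [|||||F [h [F3 hN safeF]]] := IH (K :\ u) (del e La u c) _ cu cD.
  - by move: sK; rewrite (cardsD1 u K) uK.
  - by apply: disjP => z; rewrite inE => /andP[_]; apply: disjE dKD.
  - move=> v; rewrite HN; case vD: (v \in D) => //=; apply/touch1P/touch1P => -[z].
      move=> zK evz; exists z => //; rewrite !inE zK andbT; apply: contraTneq (evz) => ->.
      by apply: Nu; rewrite HN vD /=; apply/touch1P; exists z.
    by rewrite inE => /andP[_ zK]; exists z.
  - by [].
  - move=> z; rewrite inE => /andP[_ zK]; have := hL z zK.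
    rewrite (nbr_del es z uK) /del; case: ifP => [euz|_]; last first.
      by [].
    by move=> h; apply: card_setD1_ge; apply: leq_trans h; rewrite -addnA.
  exists F, h; split=> // phi avoid hub.
  have cr : c \in resid e N La phi u by rewrite inE nu imset0 inE cu'.
  apply: (colourable_del es ei uK cr); apply: colourable_sub (safeF phi avoid hub) => z _.
  rewrite /resid /del; case: ifP => // _.
  by apply/subsetP => x; rewrite !inE => /and3P[-> -> ->].
apply: boolp.contrapT => ns.
have U2 : #|N :\: N| <= 2 by rewrite setDv cards0.
have high z w : z \in K -> w \in N -> e z w -> 2 < #|nbr e z K|.
  move=> zK wN ezw; have := high_degree es ei cK (subxx N) hL ns zK wN ezw.
  suff -> : nbr e z (N :\: N) = set0 by rewrite cards0 addn0.
  by apply/setP => y; rewrite setDv !inE.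
have uni (A : {set T}) w := universal es ei cK (subxx N) U2 hL ns (D := A) (w := w).
have tou' z : z \in K -> conn e (K :\ z) -> exists2 w, w \in N & e z w.
  move=> zK cz; have := tou z zK; rewrite cz /= => /set0Pn[w]; rewrite inE => /andP[wN ezw].
  by exists w.
have [z0 z0K] : exists z, z \in K.
  by move: v0N; rewrite HN => /andP[_ /touch1P[z zK _]]; exists z.
have [/forall_inP nc|] := boolP [forall z in K, conn e (K :\ z)].
  have [w wN ezw] := tou' z0 z0K (nc z0 z0K).
  have uw z : z \in K -> e z w.
    by apply: uni => //; apply/touch1P; exists z0; rewrite // es.
  (* [w] lies outside [K], so with [o := w] no vertex of [K] is excused from the degree
     condition. *)
  apply: (apex_K4 es ei K5 K33 (w := w) (o := w) (H := K) (x0 := z0)) => //.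
  - exact: NK.
  - by move=> x xK; rewrite es uw.
  - by move=> x xK _; apply: (high x w); rewrite ?uw.
  - by apply: contraTneq z0K => ->; apply: NK.
rewrite negb_forall => /existsP[r0]; rewrite negb_imply => /andP[r0K nc0].
have [D1 [D2 [p1 p2 d12]]] := two_pieces es cK r0K nc0.
have [r1 [A [sA q1 nc1 ncA]]] := end_piece es cK nc0 p1.
have [r2 [E [sE q2 nc2 ncE]]] := end_piece es cK nc0 p2.
have dAE z : z \in A -> z \in E -> False.
  by move=> /(subsetP sA) z1 /(subsetP sE); apply: disjE d12 z1.
have [sAK rA /[dup] bA /andP[/set0Pn[a aA] cA] attA] := piece_sub q1.
have [sEK rE bE attE] := piece_sub q2; have /andP[/set0Pn[x xE] _] := bE.
have [r1K _] := q1.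
have [w wN eaw] := tou' a (subsetP sAK _ aA) (ncA a aA).
have [w' wN' exw] := tou' x (subsetP sEK _ xE) (ncE x xE).
have uw z : z \in A -> e z w.
  by apply: uni => //; apply/touch1P; exists a; rewrite // es.
pose R := K :\: A.
have cR : conn e R := piece_rest es cK q1.
have r1R : r1 \in R by rewrite inE rA.
have wA : w \notin A by apply: contra (NK _ wN); apply: (subsetP sAK).
have wR : w \notin R by rewrite inE negb_and NK ?orbT.
have fin (O : {set T}) : R \subset O -> [disjoint A & O] -> w \notin O -> conn e O ->
    touch e [set w] O -> False.
  move=> RO dAO wO cO tO.
  apply: (apex_K4_bag (w := w) es ei K5 K33 dAO wA wO cO tO _ _ aA).
    by move=> z zA; rewrite es uw.
  move=> z zA; have := high z w (subsetP sAK _ zA) wN (uw z zA).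
  rewrite (piece_deg q1 zA) => /leq_trans; apply; rewrite leq_add2l.
  case ezr: (e z r1) => //; rewrite lt0b; apply/touch1P; exists r1 => //.
  exact: (subsetP RO).
(* If [w] misses [R], the branch set is extended through [D]: [w'] touches [R], and its component of
   [D :\ w] is attached to [w]. *)
have [tR|tR] := boolP (touch e [set w] R).
  by apply: (fin R) => //; apply: disjP => z zA; rewrite inE zA.
have wD v : v \in N -> v \in D by rewrite HN => /andP[].
have xR : x \in R.
  by rewrite inE (subsetP sEK) // andbT; apply/negP => xA; apply: dAE xA xE.
have ww : w' != w by apply: contraNneq tR => <-; apply/touch1P; exists x; rewrite // es.
have wX : w' \in D :\ w by rewrite !inE ww wD.
have [Q [[sQ /andP[_ cQ] clQ] wQ]] := component_of es wX.
have QD : Q \subset D by apply: subset_trans sQ (subsetDl _ _).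
have nwQ : w \notin Q by apply/negP => /(subsetP sQ); rewrite !inE eqxx.
have tQ : touch e Q [set w].
  have [u [v [uQ vD vQ euv]]] := conn_cut cD QD wQ (wD _ wN) nwQ.
  apply/touchP; exists u, v; split=> //; rewrite inE; apply: contraNT vQ => vw.
  by apply: (clQ u) => //; rewrite !inE vw.
apply: (fin (R :|: Q)).
- exact: subsetUl.
- apply: disjP => z zA; rewrite !inE zA /= => /(subsetP QD); apply: disjE dKD _.
  exact: (subsetP sAK).
- by rewrite inE negb_or wR.
- by apply: connU => //; apply/touchP; exists x, w'.
- by rewrite touch_sym //; apply: touchS tQ; rewrite ?subsetUr.
Qed.
End Special.

(** * Colouring the hubs of one piece *)

Lemma card_bigcup_le (I C : finType) (P : pred I) (F : I -> {set C}) n :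
  (forall i, P i -> #|F i| <= n) -> #|\bigcup_(i | P i) F i| <= n * #|[set i | P i]|.
Proof.
move=> h; apply: (@leq_trans (\sum_(i | P i) #|F i|)).
  elim/big_rec2: _ => [|i A s Pi le]; first by rewrite cards0.
  by apply: leq_trans (leq_card_setU _ _) _; rewrite leq_add2l.
rewrite cardsE mulnC -sum_nat_const; exact: leq_sum.
Qed.

Section Roots.
Variables (T : finType) (e : rel T).
Hypotheses (es : symmetric e) (ei : irreflexive e).
Variable X : {set T}.

Definition inner : rel T := [rel u v | [&& e u v, u \in X & v \in X]].
(** Components are named by a canonical element. Outside [X] every vertex is its own root, so
    [croot] is at the same time a contraction map. *)
Definition croot := root inner.
Definition cclass x := [set z | croot z == x].

Lemma inner_sym : connect_sym inner.
Proof. by apply: sym_connect_sym => u v; rewrite /inner /= es [(u \in X) && _]andbC. Qed.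

Lemma crootK z : croot (croot z) = croot z.
Proof. exact/(root_root inner_sym). Qed.

Lemma croot_eq u v : e u v -> u \in X -> v \in X -> croot u = croot v.
Proof.
move=> euv uX vX; apply/eqP; rewrite (root_connect inner_sym).
by apply: connect1; rewrite /inner /= euv uX.
Qed.

Lemma croot_out z : z \notin X -> croot z = z.
Proof.
move=> zX; have /connectP[[|y p]] := connect_root inner z; first by move=> _ /esym.
by rewrite /= /inner /= (negPf zX) !andbF.
Qed.

Lemma croot_in z : z \in X -> croot z \in X.
Proof.
move=> zX; have /connectP[p] := connect_root inner z; rewrite -/(croot z).
elim/last_ind: p => [_ ->//|p y _]; rewrite rcons_path last_rcons.
by move=> /andP[_ /and3P[_ _ yX]] ->.
Qed.

Lemma croot_inE z : (croot z \in X) = (z \in X).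
Proof. by apply/idP/idP; [|exact: croot_in]; apply: contraTT => zX; rewrite croot_out. Qed.

Lemma cclass_conn x : conn e (cclass x).
Proof.
apply: connect_conn => u v; rewrite !inE => /eqP uv /eqP vv.
have : connect inner u v by rewrite -(root_connect inner_sym) -/(croot u) -/(croot v) uv vv.
move=> /connectP[p]; elim: p u uv => [u _ _ ->//|y p IH u uv /= /andP[/and3P[euy uX yX] pp] lp].
have yv : croot y = x by rewrite -(croot_eq euy).
apply: connect_trans (IH y yv pp lp); apply: connect1.
by rewrite /= euy !inE uv yv eqxx.
Qed.

Lemma cclass_component z : z \in X -> component e X (cclass (croot z)).
Proof.
move=> zX; split.
- by apply/subsetP => y; rewrite inE -(croot_inE y) => /eqP->; apply: croot_in.
- by apply: (bagP (x := z)); [rewrite inE|apply: cclass_conn].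
move=> u v; rewrite !inE => /eqP uz vX euv.
have uX : u \in X by rewrite -croot_inE uz croot_in.
by rewrite -uz (croot_eq euv uX vX).
Qed.
End Roots.

Section PieceColour.
Variables (T C : finType) (e : rel T).
Hypotheses (es : symmetric e) (ei : irreflexive e).
Hypotheses (K5 : K5free e) (K33 : K33free e).
Variables (X B1 : {set T}) (t k : T) (ct : C) (La : T -> {set C}) (N : T -> {set T}).
Notation croot := (croot e X).
Notation cclass := (cclass e X).
Hypotheses (tX : t \notin X) (tB : t \notin B1) (dBX : [disjoint B1 & X]).
Hypothesis lB : forall v, v \in B1 -> 10 < #|La v|.
Definition is_croot x := (x \in X) && (croot x == x).
Hypothesis kr : is_croot k.
Hypothesis Nsub : forall x, is_croot x -> N x \subset t |: B1.
Hypothesis Ntouch : forall x v, is_croot x -> v \in N x -> touch e [set v] (cclass x).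
Hypothesis Nk : N k \subset B1.
Hypothesis spec : safe e (cclass k) La (N k) (N k).
Hypothesis reg : forall x (W : {set T}), is_croot x -> x != k -> W \subset N x ->
  #|N x :\: W| <= 2 -> safe e (cclass x) La (N x) W.

(** The incidences of components and hubs. Oriented to the component, an incidence is an exemption;
    oriented to the hub, it is the duty to avoid the colours of that component. *)
Let E := {a : T * T | is_croot a.1 && (a.2 \in N a.1)}.
Let p (a : E) := (val a).1.
Let q (a : E) := (val a).2.
(** The hub [t] is already coloured and cannot avoid anything; the component of [k] must not exempt
    anything. *)
Let cap y := if (y == k) || (y == t) then 0 else 2.

Lemma E_inj a b : p a = p b -> q a = q b -> a = b.
Proof.
by move=> pp qq; apply/val_inj; rewrite [LHS]surjective_pairing [RHS]surjective_pairing; congr pair.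
Qed.

Lemma NX x v : is_croot x -> v \in N x -> v \notin X.
Proof.
move=> xr /(subsetP (Nsub xr)); rewrite !inE => /orP[/eqP->//|vB].
by apply/negP; apply: disjE dBX vB.
Qed.

Lemma cap_sum (Y : {set T}) : 2 * #|Y| <= \sum_(y in Y) cap y + 4.
Proof.
have : \sum_(y in Y) 2 <= \sum_(y in Y) cap y + \sum_(y in Y) (if (y == k) || (y == t) then 2 else 0).
  by rewrite -big_split; apply: leq_sum => y _; rewrite /cap; case: ifP.
rewrite sum_nat_const mulnC => /leq_trans; apply; rewrite leq_add2l.
rewrite -big_mkcondr sum_nat_const; apply: (@leq_trans (#|[set k; t]| * 2)); last first.
  by rewrite cards2; case: (_ != _).
rewrite leq_mul2r; apply/orP; right; apply: subset_leq_card; apply/subsetP => y.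
by rewrite !inE => /andP[].
Qed.

(** From three vertices on, the minus four of [bip_bound] matches the two capacities of two that are
    missing at [k] and [t]. A smaller set spans at most one incidence, which by [Nk] does not join
    [k] and [t], so one end has capacity two. *)
Lemma orientation_condition (Y : {set T}) : #|[set a : E | (p a \in Y) && (q a \in Y)]| <= \sum_(y in Y) cap y.
Proof.
set A := [set a | _].
have [Y2|Y2] := ltnP 2 #|Y|.
  pose s x := x \in X.
  pose e1 := [rel x y | contract e croot x y && (s x != s y)].
  have cf y : conn e [set x | croot x == y] by apply: cclass_conn.
  have es1 : symmetric e1.
    by move=> x y; rewrite /e1 [LHS]/= [RHS]/= (contract_sym croot es) (eq_sym (s x)).
  have K1 : K33free e1.
    by apply: K33freeS (contract_K33 es cf K33) => x y /andP[].
  have := @bip_bound _ #|Y| #|edges e1 Y| e1 s Y (leqnn _) (leqnn _) es1 K1 (fun x y h => proj2 (andP h)) Y2.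
  pose l := [set (p a, q a) | a in A]; pose r := [set (q a, p a) | a in A].
  have Pa (a : E) : is_croot (p a) /\ q a \in N (p a) by case/andP: (valP a).
  have ed a : a \in A -> e1 (p a) (q a).
    move=> aA; have [pr qN] := Pa a; have qX := NX pr qN.
    have /andP[pX /eqP rp] := pr.
    rewrite /e1 /= /s pX (negPf qX) andbT; apply/contractP; split.
      by apply: contraNneq qX => <-.
    have /touch1P[z zc eqz] := Ntouch pr qN.
    exists z, (q a); split; [by move: zc; rewrite inE => /eqP|exact: croot_out|by rewrite es].
  have dlr : [disjoint l & r].
    apply: disjP => _ /imsetP[a aA ->] /imsetP[b bA [pq _]].
    by have [/andP[pX _] _] := Pa a; have [pb qN] := Pa b; have := NX pb qN; rewrite -pq pX.
  have cl : #|l| = #|A| by apply: card_imset => a b [] ; apply: E_inj.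
  have cr : #|r| = #|A| by apply: card_imset => a b [qq pp]; apply: E_inj.
  have sub : l :|: r \subset edges e1 Y.
    rewrite subUset; apply/andP; split; apply/subsetP => _ /imsetP[a aA ->];
      have := aA; rewrite inE => /andP[pY qY]; rewrite inE [_.1]/= [_.2]/= pY qY /=.
      exact: ed.
    by have := ed a aA; rewrite -[e1 _ _](es1 (q a)).
  have := subset_leq_card sub; rewrite cardsU (disjoint_setI0 dlr) cards0 subn0 cl cr.
  have := cap_sum Y; move: #|A| #|Y| #|edges _ _| => x y z; set w := \sum_(_ in _) _.
  by move: w; clear; lia.
have [->|/set0Pn[a aA]] := eqVneq A set0; first by rewrite cards0.
have := aA; rewrite inE => /andP[pY qY].
have [pr qN] := andP (valP a); have [pX _] := andP pr.
have qX : q a \notin X := NX pr qN.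
have pq : p a != q a by apply: contraNneq qX => <-.
have eY : Y = [set p a; q a].
  by apply/eqP; rewrite eq_sym eqEcard subUset !sub1set pY qY cards2 pq.
have A1 : A \subset [set a].
  apply/subsetP => b; rewrite !inE eY => /andP[]; have [pr' qN'] := andP (valP b); have [pX' _] := andP pr'.
  have qX' : q b \notin X := NX pr' qN'.
  rewrite !inE => /orP[/eqP pp|/eqP pp]; last by rewrite -pp pX' in qX.
  move=> /orP[/eqP qq|/eqP qq]; first by rewrite qq pX in qX'.
  by apply/eqP; apply: E_inj.
apply: leq_trans (subset_leq_card A1) _; rewrite cards1 eY big_setU1 ?inE //= big_set1.
rewrite /cap; have pt : p a != t by apply: contraNneq tX => <-.
have [pk|pk] := eqVneq (p a) k; last by rewrite (negPf pt).
have qB : q a \in B1 by apply: (subsetP Nk); rewrite -pk.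
have -> : q a == k = false by apply: contraNF qX => /eqP->; by case/andP: kr.
by have -> : q a == t = false by apply: contraNF tB => /eqP<-.
Qed.
Lemma withheld : exists W : T -> {set T}, [/\ forall x, is_croot x -> W x \subset N x,
  forall x, is_croot x -> safe e (cclass x) La (N x) (W x),
  forall x, is_croot x -> t \notin W x &
  forall v, #|[set x | is_croot x && (v \in W x)]| <= 2].
Proof.
have [o [/forallP oo lo]] := orientation orientation_condition.
pose W x := [set v in N x | [exists a : E, [&& p a == x, q a == v & o a == v]]].
have WN x : W x \subset N x by apply/subsetP => v; rewrite inE => /andP[].
have capE y : load o y <= cap y := lo y.
have Uload x : is_croot x -> #|N x :\: W x| <= load o x.
  move=> xr; apply: leq_trans (leq_imset_card q [set a | o a == x]).
  apply: subset_leq_card; apply/subsetP => v; rewrite inE => /andP[vW vN].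
  have av : is_croot (x, v).1 && ((x, v).2 \in N (x, v).1) by rewrite /= xr.
  apply/imsetP; exists (Sub (x, v) av : E); last by rewrite /q SubK.
  rewrite inE; have := oo (Sub (x, v) av : E); rewrite /p /q SubK /= => /orP[//|ov].
  case/negP: vW; rewrite inE vN; apply/existsP; exists (Sub (x, v) av : E).
  by rewrite /p /q SubK /= ov !eqxx.
have Wload v : #|[set x | is_croot x && (v \in W x)]| <= load o v.
  apply: leq_trans (leq_imset_card p [set a | o a == v]).
  apply: subset_leq_card; apply/subsetP => x; rewrite !inE => /and3P[_ _ /existsP[a]].
  by case/and3P=> /eqP <- _ oa; apply: imset_f; rewrite inE.
have cap2 y : cap y <= 2 by rewrite /cap; case: ifP.
exists W; split=> //.
- move=> x xr; have [xk|xk] := eqVneq x k; last first.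
    by apply: reg => //; apply: leq_trans (Uload x xr) (leq_trans (capE x) (cap2 x)).
  suff -> : W x = N x by rewrite xk.
  apply/eqP; rewrite eqEsubset WN /= -setD_eq0 -cards_eq0 -leqn0.
  by apply: leq_trans (Uload x xr) _; apply: leq_trans (capE x) _; rewrite /cap xk eqxx.
- move=> x xr; apply/negP; rewrite inE => /andP[_ /existsP[a /and3P[_ _ oa]]].
  have : 0 < load o t by apply/card_gt0P; exists a; rewrite inE.
  by rewrite ltnNge (leq_trans (capE t)) // /cap eqxx orbT.
- by move=> v; apply: leq_trans (Wload v) (leq_trans (capE v) (cap2 v)).
Qed.

(** Once each component is contracted into its hub, that hub is adjacent to the other hubs of the
    component, so a proper colouring gives it a private colour. [Z] is the precoloured [t]; a
    neighbour of [t] also loses [ct], and four colours remain where three are required. *)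
Lemma piece_colour : exists phi : T -> C, [/\ phi t = ct, lcol e B1 La phi,
  forall v, v \in B1 -> e t v -> phi v != ct &
  forall x, is_croot x -> colourable e (cclass x) (resid e (N x) La phi)].
Proof.
have [W [WN Ws tW W2]] := withheld.
have [g gP] : exists g : T -> {set C} * T, forall x, is_croot x -> [/\ #|(g x).1| <= 3, (g x).2 \in N x &
    forall phi, (forall v, v \in W x -> phi v \notin (g x).1) ->
    (forall v, v \in N x -> v != (g x).2 -> phi v != phi (g x).2) ->
    colourable e (cclass x) (resid e (N x) La phi)].
  suff /fin_all_exists[g h] : forall x : T, exists u : {set C} * T, is_croot x -> [/\ #|u.1| <= 3, u.2 \in N x &
    forall phi, (forall v, v \in W x -> phi v \notin u.1) ->
    (forall v, v \in N x -> v != u.2 -> phi v != phi u.2) ->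
    colourable e (cclass x) (resid e (N x) La phi)] by exists g.
  move=> x; have [xr|xr] := boolP (is_croot x); last by exists (set0, x).
  by have [F [h hF]] := Ws x xr; exists (F, h).
pose f z := if z \in X then (g (croot z)).2 else z.
have rr z : z \in X -> is_croot (croot z) by move=> zX; rewrite /is_croot croot_in // (crootK es) eqxx.
have hN x : is_croot x -> (g x).2 \in N x by move=> xr; case: (gP x xr).
have fX z : f z \notin X.
  rewrite /f; case: ifP => [zX|/negbT//]; exact: NX (rr z zX) (hN _ (rr z zX)).
have fid z : z \notin X -> f z = z by rewrite /f => /negPf->.
have cf y : conn e [set x | f x == y].
  have [yX|yX] := boolP (y \in X).
    suff -> : [set x | f x == y] = set0 by apply: conn0.
    by apply/setP => x; rewrite !inE; apply: contraTF yX => /eqP <-.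
  (* The fibre of [y] consists of [y] and the components contracted into it, each of which touches
     [y]. *)
  apply/connP => A sA nA cA; have [a aA] := set0Pn _ nA.
  have inF z : z \in X -> f z = y -> exists z', [/\ z' \in cclass (croot z), e z' y &
      cclass (croot z) \subset [set x | f x == y]].
    move=> zX fz; have := Ntouch (rr z zX) (hN _ (rr z zX)).
    have -> : (g (croot z)).2 = y by rewrite -fz /f zX.
    move=> /touch1P[z' zc ey]; exists z'; split; rewrite // 1?es //.
    apply/subsetP => u; rewrite !inE => /eqP uz; have uX : u \in X by rewrite -(croot_inE e) uz croot_in.
    by rewrite /f uX uz -fz /f zX.
  have yF : y \in [set x | f x == y] by rewrite inE fid.
  have cmA z u : z \in X -> f z = y -> u \in cclass (croot z) -> u \in A -> cclass (croot z) \subset A.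
    move=> zX fz uc uA; have [z' [_ _ sub]] := inF z zX fz.
    apply: (conn_sub (cclass_conn es X (croot z)) uc uA) => v w vA wc evw.
    by apply: (cA v); rewrite // (subsetP sub).
  have yA : y \in A.
    have := subsetP sA _ aA; rewrite inE => /eqP fa.
    have [aX|aX] := boolP (a \in X); last by rewrite -fa fid.
    have [z' [zc ez _]] := inF a aX fa.
    have ac : a \in cclass (croot a) by rewrite inE.
    by apply: (cA z') => //; apply: (subsetP (cmA a a aX fa ac aA)).
  apply/eqP; rewrite eqEsubset sA; apply/subsetP => z; rewrite inE => /eqP fz.
  have [zX|zX] := boolP (z \in X); last by rewrite -(fid z zX) fz.
  have [z' [zc ez sub]] := inF z zX fz.
  have zA : z' \in A by apply: (cA y); rewrite // 1?es // (subsetP sub).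
  by apply: (subsetP (cmA z z' zX fz zc zA)); rewrite inE.
pose e2 := contract e f.
have es2 : symmetric e2 := contract_sym f es.
have K52 : K5free e2 := contract_K5 es cf K5.
have K332 : K33free e2 := contract_K33 es cf K33.
pose Fv v := \bigcup_(x | is_croot x && (v \in W x)) (g x).1.
have Fv6 v : #|Fv v| <= 6.
  apply: (@leq_trans (3 * #|[set x | is_croot x && (v \in W x)]|)).
    by apply: card_bigcup_le => x /andP[xr _]; case: (gP x xr).
  by rewrite -[6]/(3 * 2) leq_mul2l W2 orbT.
pose L2 v := La v :\: Fv v :\: (if e2 t v then [set ct] else set0).
have l5 v : v \in B1 -> 4 < #|La v :\: Fv v|.
  by move=> vB; apply: (card_setD_ge (m := 6)) (Fv6 v); apply: lB.
have [|||||||||phi [h1 h2]] := @thomassen_bag _ _ e2 ct es2 (@contract_irr _ _ _) K52 K332 _ [set t] B1 set0 L2 (leqnn _).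
- exact: bag1.
- by rewrite disjoints1.
- exact: sub0set.
- by rewrite cards0.
- by move=> z; rewrite inE.
- by move=> z z'; rewrite inE.
- by move=> z; rewrite inE.
- move=> v vB _; rewrite touch1 /L2 => ->; apply: card_setD1_ge; apply: ltnW; exact: l5.
- by move=> v vB; rewrite touch1 /L2 => /negPf->; rewrite setD0; apply: l5.
have BX v : v \in B1 -> v \notin X by move=> vB; apply/negP; apply: disjE dBX vB.
have Bt v : v \in B1 -> v != t by move=> vB; apply: contraNneq tB => <-.
pose psi v := if v == t then ct else phi v.
have psiB v : v \in B1 -> psi v = phi v by move=> /Bt/negPf vt; rewrite /psi vt.
have e2I u v : u != v -> u \notin X -> v \notin X -> e u v -> e2 u v.
  by move=> uv uX vX euv; apply/contractP; split=> //; exists u, v; rewrite !fid.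
have neq u v : e u v -> u != v by apply: contraTneq => ->; rewrite ei.
have ht v : v \in B1 -> e2 t v -> phi v != ct.
  by move=> vB ev; have := h1 v vB; rewrite /L2 ev !inE => /andP[].
have hF v : v \in B1 -> phi v \in La v :\: Fv v.
  by move=> vB; have := h1 v vB; rewrite /L2 inE => /andP[].
exists psi; split; first by rewrite /psi eqxx.
- split=> [v vB|u v uB vB euv]; first by rewrite psiB //; have := hF v vB; rewrite inE => /andP[].
  by rewrite !psiB //; apply: h2 => //; apply: e2I; rewrite ?BX ?neq.
- by move=> v vB etv; rewrite psiB // ht //; apply: e2I; rewrite  ?tX ?BX ?neq.
move=> x xr; have [_ _ hx] := gP x xr; apply: hx => [v vW|v vN vh].
  have vB : v \in B1.
    have := subsetP (Nsub xr) _ (subsetP (WN x xr) _ vW); rewrite in_setU1 => /orP[/eqP vt|//].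
    by have := tW x xr; rewrite -vt vW.
  rewrite psiB //; have := hF v vB; rewrite inE => /andP[nF _]; apply: contra nF => vF.
  by apply/bigcupP; exists x; rewrite // xr.
have e2h : e2 v (g x).2.
  apply/contractP; split=> //; have /touch1P[z zc evz] := Ntouch xr vN; exists v, z; split=> //.
    by rewrite fid // (NX xr vN).
  move: zc; rewrite inE => /eqP zx; rewrite /f -(croot_inE e) zx.
  by have /andP[-> _] := xr.
have := subsetP (Nsub xr) _ vN; have := subsetP (Nsub xr) _ (hN x xr).
move: e2h vh; rewrite !in_setU1; move: (g x).2 => h e2h vh.
move=> /orP[/eqP ht'|hB] /orP[/eqP vt|vB].
- by rewrite vt ht' eqxx in vh.
- by rewrite psiB // /psi ht' eqxx ht // es2 -ht'.
- by rewrite (psiB h) // /psi vt eqxx eq_sym ht // -vt.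
- by rewrite !psiB // h2.
Qed.
End PieceColour.

(** * The induction over separating hubs *)

Lemma min_nat (P : nat -> Prop) n : P n -> exists2 m, P m & forall k, P k -> m <= k.
Proof.
elim/ltn_ind: n => n IH Pn; apply: boolp.contrapT => h.
have [[m [mn Pm]]|no] := boolp.EM (exists m, m < n /\ P m); first by case: h; apply: (IH m).
case: h; exists n => // k Pk; rewrite leqNgt; apply/negP => kn; by case: no; exists k.
Qed.

Section Main.
Variables (T C : finType) (e : rel T) (c0 : C).
Hypotheses (es : symmetric e) (ei : irreflexive e).
Hypotheses (K5 : K5free e) (K33 : K33free e).
Hypothesis H3 : forall S : {set T}, #|S| <= 2 -> conn e (~: S).
Variables (S0 : {set T}) (La : T -> {set C}).
Hypothesis hS : forall z, z \in S0 -> #|nbr e z setT| <= #|La z|.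
Hypothesis hS10 : forall z, z \in S0 -> #|nbr e z setT| <= 10.
Hypothesis hB : forall v, v \notin S0 -> 10 < #|La v|.

Lemma five_choosable (W : {set T}) : (forall v, v \in W -> 4 < #|La v|) ->
  exists phi, lcol e W La phi.
Proof.
move=> l5; have [->|/set0Pn[p pW]] := eqVneq W set0.
  by exists (fun=> c0); split=> u; rewrite inE.
have [c cp] : exists c, c \in La p.
  by apply/set0Pn; rewrite -card_gt0; apply: leq_trans (l5 p pW).
suff cW : colourable e (W :\ p) (del e La p c).
  exact/colourableP/(colourable_del es ei pW cp cW).
apply/colourableP.
apply: (@thomassen_bag _ _ e c es ei K5 K33 _ [set p] (W :\ p) set0 _ (leqnn _)).
- exact: bag1.
- by rewrite disjoints1 !inE eqxx.
- exact: sub0set.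
- by rewrite cards0.
- by move=> z; rewrite inE.
- by move=> z z'; rewrite inE.
- by move=> z; rewrite inE.
- move=> v; rewrite inE => /andP[_ vW] _; rewrite touch1 /del => ->; apply: card_setD1_ge.
  by apply: ltnW; apply: l5.
- by move=> v; rewrite inE => /andP[_ vW]; rewrite touch1 /del => /negPf->; apply: l5.
Qed.

Lemma nbrT_split z (A : {set T}) : #|nbr e z setT| = #|nbr e z A| + #|nbr e z (~: A)|.
Proof.
rewrite -(cardsID A); congr (_ + _); apply: eq_card => x; rewrite !inE //.
exact: andbC.
Qed.

Lemma nbr_disj z (A B : {set T}) : [disjoint A & B] ->
  #|nbr e z A| + #|nbr e z B| = #|nbr e z (A :|: B)|.
Proof.
move=> d; rewrite -cardsUI (_ : nbr e z A :&: nbr e z B = set0) ?cards0 ?addn0.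
  by apply: eq_card => x; rewrite !inE -andb_orl.
apply/setP => x; rewrite !inE; apply/negP => /andP[/andP[xA _] /andP[xB _]].
exact: disjE d xA xB.
Qed.

Lemma nbr_sub z (A B : {set T}) : A \subset B -> #|nbr e z A| <= #|nbr e z B|.
Proof.
move=> s; apply: subset_leq_card; apply/subsetP => x; rewrite !inE => /andP[xA ->].
by rewrite (subsetP s).
Qed.

(** A colour of [t] missing at [x] leaves slack at [x]. If there is none, [x] has more than ten
    colours for at most ten neighbours. *)
Lemma one_big (K : {set T}) t : conn e K -> K \subset S0 -> t \notin S0 -> touch e [set t] K ->
  ~: (t |: K) = set0 -> exists phi, lcol e setT La phi.
Proof.
move=> cK KS tS /touch1P[x xK etx] emp.
have tK : t \notin K by apply: contra tS; apply: (subsetP KS).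
have eT : t |: K = setT by rewrite -[LHS]setCK emp setC0.
have dz z : z \in K -> #|nbr e z setT| = e z t + #|nbr e z K|.
  by move=> zK; rewrite -eT (nbr_del es z (setU11 t K)) setU1K // es.
have [c ct hc] : exists2 c, c \in La t & c \notin La x \/ 10 < #|La x|.
  have [sub|] := boolP (La t \subset La x).
    have /card_gt0P[c ct] : 0 < #|La t| by apply: leq_trans (hB tS).
    by exists c => //; right; apply: leq_trans (subset_leq_card sub); apply: hB.
  by case/subsetPn => c ct cx; exists c => //; left.
suff cc : colourable e K (del e La t c).
  apply/colourableP; rewrite -eT; apply: (colourable_del es ei (setU11 t K) ct).
  by rewrite setU1K.
apply: (colourable_slack es ei (x := x) cK) => // [z zK|].
  have := hS (subsetP KS _ zK); rewrite dz // /del es; case: ifP => //= _.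
  exact: card_setD1_ge.
have := hS (subsetP KS _ xK); have := hS10 (subsetP KS _ xK).
rewrite dz // es etx /del etx /= => h10 hx; case: hc => [cx|l11].
  by rewrite (setDidPl _) // disjoint_sym disjoints1.
by apply: leq_trans h10 _; apply: card_setD1_ge.
Qed.

(** No vertex cuts the graph, so in a bad assignment the lists at the ends of every edge are equal.
    One colour used at both ends of an induced path with two edges leaves slack at its middle, and
    by 3-connectivity the rest is connected. *)
Lemma all_small : S0 = setT -> (exists a b, a != b /\ ~~ e a b) -> exists phi, lcol e setT La phi.
Proof.
move=> ST [a [b [ab nab]]].
have cT : conn e setT by have := @H3 set0; rewrite cards0 setC0; apply.
have c1 z : conn e (setT :\ z) by have := @H3 [set z]; rewrite cards1 setTD; apply.
have [x [v [eax exv av xa]]] : exists x v, [/\ e a x, e x v, ~~ e a v & v != a].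
  have bA : b \notin a |: nbr e a setT by rewrite !inE negb_or eq_sym ab.
  have [x [v [xA _ vA exv]]] := conn_cut cT (subsetT _) (setU11 a (nbr e a setT)) (in_setT b) bA.
  move: xA vA; rewrite !inE negb_or => /orP[/eqP xa|eax] /andP[va eav].
    by rewrite -xa exv in eav.
  by exists x, v.
apply/colourableP; apply: contraT => nc.
have bd : bad e setT La by split=> // z _; apply: hS; rewrite ST inE.
have tw y z : e y z -> La y = La z.
  by move=> eyz; apply: (bad_twin es ei bd (in_setT z) (c1 z) (in_setT y) (c1 y) eyz).
have T1 : 1 < #|[set: T]| by apply/card_gt1P; exists a, b; rewrite !inE.
have [c ca] : exists c, c \in La a.
  apply/set0Pn; rewrite -card_gt0 (bad_tight es ei bd (in_setT a)).
  exact: nbr_gt0.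
have cv : c \in La v by rewrite -(tw _ _ exv) -(tw _ _ eax).
have vTa : v \in setT :\ a by rewrite !inE xa.
case/negP: nc; apply: (colourable_del es ei (in_setT a) ca).
have cv' : c \in del e La a c v by rewrite /del (negPf av).
apply: (colourable_del es ei vTa cv').
have xv : x != v by apply: contraTneq exv => ->; rewrite ei.
have xxa : x != a by apply: contraTneq eax => ->; rewrite ei.
have evx : e v x by rewrite es.
have exa : e x a by rewrite es.
have c2 : conn e ((setT :\ a) :\ v).
  have := @H3 [set a; v]; rewrite cards2 -setTD -setDDl; apply; by case: (_ != _).
apply: (colourable_slack es ei (x := x) c2).
- move=> z zK; apply: card_del => //; apply: card_del => //.
  by apply: hS; rewrite ST inE.
- by rewrite !inE xv xxa.
have : #|nbr e x setT| <= #|La x| by apply: hS; rewrite ST inE.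
rewrite (nbr_del es x (in_setT a)) (nbr_del es x vTa) /del evx eax (setDDl (La x)) setUid.
by apply: card_setD1_ge.
Qed.
(** [D] is one side of a separation by a component [K] and a hub [t]; it is all of the remaining
    graph when [K] and [t] do not separate. *)
Definition triple S' (K : {set T}) t (D : {set T}) :=
  [/\ component e S' K, t \notin S0, touch e [set t] K & component e (~: (t |: K)) D].

(** * Colouring a smallest side of a separation *)

Section Step.
Variables (S' B' : {set T}).
Hypotheses (sS : S' \subset S0) (dB : [disjoint B' & S0]).
Hypothesis clS : forall u v, u \in S' -> v \in S0 -> e u v -> v \in S'.
Hypothesis clB : forall u v, u \in S' -> v \notin S0 -> e u v -> v \in B'.
Variables (K D : {set T}) (t : T).
Hypothesis tr : triple S' K t D.
Hypothesis tmin : forall K1 t1 D1, triple S' K1 t1 D1 -> #|D| <= #|D1|.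

Lemma triple_facts : [/\ bag e K, bag e D, [disjoint K & D], t \notin K & t \notin D] /\
  [/\ K \subset S', K \subset S0 &
  (forall u v, u \in K -> v \in S0 -> e u v -> v \in K)] /\
  (forall u v, u \in D -> v \notin D -> e u v -> v = t \/ v \in K).
Proof.
have [[sK bK clK] tS tK [sD bD clD]] := tr.
have tnK : t \notin K by apply: contra tS => /(subsetP sK)/(subsetP sS).
split; first split=> //.
- by apply: disjP => z zK /(subsetP sD); rewrite !inE zK orbT.
- by apply/negP => /(subsetP sD); rewrite !inE eqxx.
split; first split=> //.
- exact: subset_trans sS.
- move=> u v uK vS euv; apply: (clK u v) => //; apply: (clS _ vS euv).
  exact: (subsetP sK).
move=> u v uD vD euv; have [->|vt] := eqVneq v t; first by left.
right; apply: contraT => vK; case/negP: vD; apply: (clD u v) => //.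
by rewrite !inE negb_or vt.
Qed.

(** [t] alone does not separate the graph, and [D] is joined to its outside only through [t] and
    [K]. *)
Lemma outer_meets (A : {set T}) a : A \subset ~: (t |: D) -> a \in A ->
  (forall x y, x \in A -> y \in ~: (t |: D) -> e x y -> y \in A) -> exists2 k, k \in A & k \in K.
Proof.
have [[bK bD dKD tK tD] [[sK KS clK] clD]] := triple_facts.
move=> sA aA clA; have [/exists_inP//|/exists_inPn no] := boolP [exists k in A, k \in K].
have c1 : conn e (~: [set t]) by apply: H3; rewrite cards1.
have [/set0Pn[k kK] _] := andP bK.
have sA1 : A \subset ~: [set t].
  by apply: subset_trans sA _; rewrite setCS subsetUl.
have kt : k \in ~: [set t] by rewrite !inE; apply: contraNneq tK => <-.
have kA : k \notin A by apply/negP => /no; rewrite kK.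
have [x [y [xA yt yA exy]]] := conn_cut c1 sA1 aA kt kA.
have [yD|yD] := boolP (y \in D).
  have xO := subsetP sA _ xA; move: xO; rewrite !inE negb_or => /andP[xt xD].
  have eyx : e y x by rewrite es.
  have [xt'|xK] := clD y x yD xD eyx; first by rewrite xt' eqxx in xt.
  by move: (no x xA); rewrite xK.
case/negP: yA; apply: (clA x) => //.
by move: yt; rewrite !inE negb_or yD andbT.
Qed.

Lemma outer_conn : conn e (~: (t |: D)).
Proof.
have [[bK bD dKD tK tD] [[sK KS clK] clD]] := triple_facts.
apply/connP => A sA nA cA; have [a aA] := set0Pn _ nA.
have [k kA kK] := outer_meets sA aA cA; have [_ cK] := andP bK.
have KO z : z \in K -> z \in ~: (t |: D).
  move=> zK; rewrite !inE negb_or; apply/andP; split; first by apply: contraNneq tK => <-.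
  by apply/negP; apply: disjE dKD zK.
have KA : K \subset A by apply: (conn_sub cK kK kA) => u v uA vK; apply: cA => //; apply: KO.
apply/eqP; rewrite eqEsubset sA; apply/subsetP => z zO; apply: contraT => zA.
have [|||k2 k2A k2K] := @outer_meets (~: (t |: D) :\: A) z.
- exact: subsetDl.
- by rewrite in_setD zA.
- move=> x y; rewrite !(in_setD _ A) => /andP[xA xO] yO exy; rewrite yO andbT.
  by apply: contra xA => yA; apply: (cA y); rewrite // es.
by move: k2A; rewrite in_setD (subsetP KA).
Qed.

Lemma outer_conn_t : conn e (~: D).
Proof.
have [[bK bD dKD tK tD] [[sK KS clK] clD]] := triple_facts.
have -> : ~: D = t |: ~: (t |: D).
  by apply/setP => z; rewrite !inE; case: eqP => //= ->.
apply: connU1; rewrite ?outer_conn //; have [_ _ /touch1P[k kK etk] _] := tr.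
apply/touch1P; exists k => //; rewrite !inE negb_or; apply/andP; split.
  by apply: contraNneq tK => <-.
by apply/negP; apply: disjE dKD kK.
Qed.

(* Minimality of D makes every component inside D regular. *)
Lemma inner_conn K1 t1 : component e S' K1 -> K1 \subset D -> t1 \notin S0 -> touch e [set t1] K1 ->
  conn e (~: (t1 |: K1)).
Proof.
have [[bK bD dKD tK tD] [[sK KS clK] clD]] := triple_facts.
move=> cK1 K1D t1S t1K; have [_ bK1 _] := cK1; have [/set0Pn[x1 x1K] _] := andP bK1.
have [/set0Pn[k kK] _] := andP bK.
have kD : k \notin D by apply/negP; apply: disjE dKD kK.
have t1D : t1 != t -> t1 \in D.
  move=> tt; have /touch1P[z zK etz] := t1K; apply: contraT => t1D.
  have ezt : e z t1 by rewrite es.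
  have [|tK1] := clD z t1 (subsetP K1D _ zK) t1D ezt; first by move/eqP; rewrite (negPf tt).
  by rewrite (subsetP KS) in t1S.
(* [R] is the outside of [D], without [t] when [t] itself is removed. It is connected, so a second
   component would lie inside [D] and miss [K1], against the minimality of [D]. *)
pose R := if t1 == t then ~: (t |: D) else ~: D.
have cR : conn e R by rewrite /R; case: ifP; rewrite ?outer_conn ?outer_conn_t.
have kR : k \in R.
  rewrite /R; case: ifP => _; rewrite !inE ?negb_or kD //=.
  by rewrite andbT; apply: contraNneq tK => <-.
have RX : R \subset ~: (t1 |: K1).
  rewrite /R; case: (eqVneq t1 t) => [->|tt]; rewrite setCS subUset sub1set.
    by rewrite setU11 (subset_trans K1D) ?subsetUr.
  by rewrite t1D.
have RD z : z \in ~: (t1 |: K1) -> z \notin R -> z \in D.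
  rewrite /R; case: (eqVneq t1 t) => [->|tt]; rewrite !inE ?negbK ?negb_or //.
  by case/andP => /negPf->.
apply: contraT => ncX.
have [M [cM kM]] := component_of es (subsetP RX _ kR); have [sM /andP[_ cnM] clM] := cM.
have [y yX yM] : exists2 y, y \in ~: (t1 |: K1) & y \notin M.
  have : ~~ (~: (t1 |: K1) \subset M).
    by apply: contra ncX => s; suff <- : M = ~: (t1 |: K1) by []; apply/eqP; rewrite eqEsubset sM.
  by case/subsetPn => y; exists y.
have [M' [cM' yM']] := component_of es yX; have [sM' _ _] := cM'.
have RM : R \subset M.
  by apply: (conn_sub cR kR kM) => u v uM vR; apply: clM => //; apply: (subsetP RX).
have sD : M' \subset D :\ x1.
  apply/subsetP => z zM'; have zX := subsetP sM' _ zM'; rewrite in_setD1; apply/andP; split.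
    by apply: contraTneq zX => ->; rewrite !inE x1K orbT.
  apply: RD => //; apply/negP => /(subsetP RM) zM.
  by rewrite (component_eq cM cM' zM zM') yM' in yM.
have := @tmin K1 t1 M' (And4 cK1 t1S t1K cM').
have := subset_leq_card sD; rewrite (cardsD1 x1 D) (subsetP K1D) //; clear; clia.
Qed.

Let X := (S' :&: D) :|: K.
Let B1 := B' :&: D.

(** The outside of [D] is coloured already. The hubs in [D] follow by [piece_colour], with [t]
    precoloured and [K] distinguished; the components inside [D] and [K] itself come last. *)
Lemma colour_step phi0 : lcol e ((B' :\: D) :|: (S' :\: X)) La phi0 ->
  exists phi, lcol e (B' :|: S') La phi.
Proof.
move=> [h1 h2].
have [[bK bD dKD tK tD] [[sK KS clK] clD]] := triple_facts.
have [cK tS ttK cD] := tr.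
have /andP[/set0Pn[k0 k0K] cnK] := bK.
have [/set0Pn[d0 d0D] cnD] := andP bD.
have nS v : v \in B' -> v \notin S0 by move=> vB; apply/negP; apply: disjE dB vB.
have KD z : z \in K -> z \notin D by move=> zK; apply/negP; apply: disjE dKD zK.
have tB : t \in B'.
  by have /touch1P[z zK etz] := ttK; apply: (clB (subsetP sK _ zK) tS); rewrite es.
have XS : X \subset S' by rewrite subUset subsetIl.
have KX : K \subset X := subsetUr _ _.
have Xin z : z \in X -> z \notin K -> z \in D by rewrite !inE => /orP[/andP[]|->].
have tX : t \notin X by apply: contra tS => /(subsetP XS)/(subsetP sS).
have dBX : [disjoint B1 & X].
  apply: disjP => z; rewrite inE => /andP[/nS zS _] /(subsetP XS)/(subsetP sS) zS'.
  by rewrite zS' in zS.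
have cKX : component e X K.
  by split=> // u v uK /(subsetP XS)/(subsetP sS); apply: clK.
pose k := croot e X k0.
have k0X : k0 \in X := subsetP KX _ k0K.
have eK : cclass e X k = K.
  by apply: (component_eq (cclass_component es k0X) cKX _ k0K); rewrite inE.
have rr z : z \in X -> is_croot e X (croot e X z).
  by move=> zX; rewrite /is_croot croot_in // (crootK es) eqxx.
have kr : is_croot e X k by apply: rr.
have cX x : is_croot e X x -> component e X (cclass e X x).
  by case/andP=> xX /eqP xr; have := cclass_component es xX; rewrite xr.
have Xcl u v : u \in X -> v \in S' -> e u v -> v \in X.
  move=> uX vS euv; have [uK|uK] := boolP (u \in K).
    by apply: (subsetP KX); apply: (clK u v) => //; apply: (subsetP sS).
  have [vD|vD] := boolP (v \in D); first by rewrite !inE vS vD.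
  have [vt|vK] := clD u v (Xin u uX uK) vD euv; last exact: (subsetP KX).
  by move: tS; rewrite -vt (subsetP sS).
have cS x : is_croot e X x -> component e S' (cclass e X x).
  move=> xr; have [s1 b1 cl1] := cX x xr; split=> //; first exact: subset_trans XS.
  move=> u v uc vS euv; apply: (cl1 u v) => //; apply: Xcl euv => //.
  exact: (subsetP s1).
have cmD x : is_croot e X x -> x != k -> cclass e X x \subset D.
  move=> xr xk; have [s1 b1 cl1] := cX x xr; apply/subsetP => z zx.
  apply: Xin; first exact: (subsetP s1).
  apply: contra xk => zK; have := component_eq (cX x xr) cKX zx zK; rewrite -eK => ex.
  have : x \in cclass e X x by rewrite inE; case/andP: xr.
  by rewrite ex inE; case/andP: xr => _ /eqP->.
(* For [K] only hubs in [D] are counted, so [t] is not among them. *)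
pose N x := if x == k then [set v in D | touch e [set v] K]
  else [set v | (v \notin cclass e X x) && touch e [set v] (cclass e X x)].
have NB x v : is_croot e X x -> v \in N x -> v \notin S0 /\ v \in B'.
  move=> xr; have [s1 _ cl1] := cS x xr.
  suff main : v \notin cclass e X x -> touch e [set v] (cclass e X x) -> v \notin S0 /\ v \in B'.
    rewrite /N; case: eqP => [xk|_]; rewrite inE => /andP[vD tv]; apply: main => //.
      by rewrite xk eK; apply: contraL vD; apply: KD.
    by rewrite xk eK.
  move=> vc /touch1P[z zc evz]; have ezv : e z v by rewrite es.
  have vS : v \notin S0.
    apply: contra vc => vS; apply: (cl1 z v) => //; apply: (clS (u := z)) => //.
    exact: (subsetP s1).
  by split=> //; apply: (clB (u := z)) => //; apply: (subsetP s1).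
have Nsub x : is_croot e X x -> N x \subset t |: B1.
  move=> xr; apply/subsetP => v vN; have [vS vB] := NB x v xr vN.
  rewrite in_setU1 in_setI vB /=; move: vN; rewrite /N; case: (x =P k) => [xk|/eqP xk]; rewrite inE.
    by case/andP=> ->; rewrite orbT.
  case/andP=> vc /touch1P[z zc evz]; have zD := subsetP (cmD x xr xk) _ zc.
  have [vD|vD] := boolP (v \in D); rewrite ?orbT // orbF.
  have ezv : e z v by rewrite es.
  have [->//|vK] := clD z v zD vD ezv; by rewrite (subsetP KS) in vS.
have Ntouch x v : is_croot e X x -> v \in N x -> touch e [set v] (cclass e X x).
  by move=> xr; rewrite /N; case: (x =P k) => [->|_]; rewrite inE => /andP[_]; rewrite ?eK.
have Nk : N k \subset B1.
  apply/subsetP => v vN; have [vS vB] := NB k v kr vN.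
  by move: vN; rewrite in_setI vB /N eqxx inE => /andP[].
(* The neighbours of [K] outside [D], [t] among them, are coloured; their colours are removed from
   the lists of [K] in advance. *)
pose Lb z := if z \in K then La z :\: phi0 @: nbr e z (~: D :\: K) else La z.
have LbE z : z \notin K -> Lb z = La z by rewrite /Lb => /negPf->.
have BK v : v \in B1 -> v \notin K.
  by move=> vB; apply/negP => /(subsetP KX); apply: disjE dBX vB.
have lB v : v \in B1 -> 10 < #|Lb v|.
  by move=> vB; rewrite LbE ?BK //; apply: hB; apply: nS; move: vB; rewrite inE => /andP[].
have spec : safe e (cclass e X k) Lb (N k) (N k).
  rewrite eK; apply: (special_safe (D := D) es ei K5 K33 cnK cnD dKD).
  - by move=> v; rewrite /N eqxx inE.
  - have c1 : conn e (~: [set t]) by apply: H3; rewrite cards1.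
    have sD1 : D \subset ~: [set t].
      by apply/subsetP => z zD; rewrite !inE; apply: contraNneq tD => <-.
    have kt : k0 \in ~: [set t] by rewrite !inE; apply: contraNneq tK => <-.
    have [u [v [uD vt vD euv]]] := conn_cut c1 sD1 d0D kt (KD _ k0K).
    apply/set0Pn; exists u; rewrite /N eqxx inE uD; apply/touch1P; exists v => //.
    have [vt'|//] := clD u v uD vD euv; by move: vt; rewrite vt' !inE eqxx.
  - move=> z zK; rewrite /Lb zK; apply: (card_setD_ge (m := #|nbr e z (~: D :\: K)|)).
      apply: leq_trans (hS (subsetP KS _ zK)); rewrite (nbrT_split z D) addnAC addnC leq_add //.
        by apply: nbr_sub; apply/subsetP => v; rewrite /N eqxx inE => /andP[].
      rewrite nbr_disj ?nbr_sub //; last by apply: disjP => v vK; rewrite inE vK.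
      apply/subsetP => v; rewrite !inE => /orP[/KD//|/andP[_ //]].
    exact: leq_imset_card.
have reg x (W : {set T}) : is_croot e X x -> x != k -> W \subset N x ->
    #|N x :\: W| <= 2 -> safe e (cclass e X x) Lb (N x) W.
  move=> xr xk WN U2; have [s1 /andP[n1 c1] cl1] := cS x xr.
  have xD := cmD x xr xk.
  have NE v : (v \in N x) = (v \notin cclass e X x) && touch e [set v] (cclass e X x).
    by rewrite /N (negPf xk) inE.
  apply: (regular_safe (y0 := k0) es ei K5 K33 H3 NE) => //.
  - by apply/negP => /(subsetP xD); apply/negP; apply: KD.
  - apply/negP => /(NB x k0 xr)[+ _]; by rewrite (subsetP KS).
  - move=> t1 t1N; apply: inner_conn => //; [exact: cS|by have [] := NB x t1 xr t1N|exact: Ntouch].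
  - move=> z zc; have zK : z \notin K by apply: contraL (subsetP xD _ zc); apply: KD.
    rewrite LbE // nbr_disj; first by apply: leq_trans (nbr_sub z (subsetT _)) (hS _);
      apply: (subsetP sS); apply: (subsetP s1).
    by apply: disjP => v vc; rewrite NE vc.
have [phi [pt [p1 p2] pt' px]] := @piece_colour _ _ e es ei K5 K33 X B1 t k (phi0 t) Lb N tX
  (introN idP (fun h => negP tD (subsetP (subsetIr _ _) _ h))) dBX lB kr Nsub Ntouch Nk spec reg.
have /fin_all_exists[chi hchi] : forall x : T, exists f : T -> C,
    is_croot e X x -> lcol e (cclass e X x) (resid e (N x) Lb phi) f.
  move=> x; have [xr|xr] := boolP (is_croot e X x); last by exists (fun=> c0).
  by have /colourableP[f hf] := px x xr; exists f.
pose psi z := if z \in X then chi (croot e X z) z else if z \in B1 then phi z else phi0 z.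
have zc z : z \in cclass e X (croot e X z) by rewrite inE.
pose R := (B' :\: D) :|: (S' :\: X).
have cls z : z \in B' :|: S' -> [\/ z \in X, z \notin X /\ z \in B1 | [/\ z \notin X, z \notin B1 & z \in R]].
  move=> zBS; have [zX|zX] := boolP (z \in X); first exact: Or31.
  have [zB|zB] := boolP (z \in B1); first exact: Or32.
  apply: Or33; split=> //; move: zBS zB zX; rewrite !(in_setU, in_setD, in_setI).
  by case: (z \in B'); case: (z \in S'); case: (z \in D); case: (z \in K).
have RD z : z \in R -> z \notin D.
  rewrite !(in_setU, in_setD, in_setI).
  by case: (z \in B'); case: (z \in S'); case: (z \in D); case: (z \in K).
have RK z : z \in R -> z \notin K.
  rewrite !(in_setU, in_setD, in_setI) => /orP[/andP[_ /nS zS]|/andP[]].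
    by apply: contra zS; apply: (subsetP KS).
  by rewrite negb_or => /andP[].
have Rt u v : u \in D -> v \in R -> e u v -> v = t.
  move=> uD vR euv; have [//|vK] := clD u v uD (RD v vR) euv.
  by have := RK v vR; rewrite vK.
have chiN z v : z \in X -> v \in N (croot e X z) -> e z v -> chi (croot e X z) z != phi v.
  move=> zX vN ezv; have [hc _] := hchi _ (rr z zX); have := hc z (zc z).
  by rewrite inE => /andP[h _]; apply: contraNneq h => ->; rewrite imset_f // inE vN.
have XS' z : z \in X -> z \in S' by apply: (subsetP XS).
have NI z v : z \in X -> v \notin S0 -> e z v -> v \in D \/ croot e X z != k -> v \in N (croot e X z).
  move=> zX vS ezv h; have tv : touch e [set v] (cclass e X (croot e X z)).
    by apply/touch1P; exists z; rewrite // es.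
  rewrite /N; case: (croot e X z =P k) => [ek|_]; rewrite inE.
    by case: h => [->|]; [rewrite -eK -ek|rewrite ek eqxx].
  rewrite tv andbT; apply: contra vS => vc; apply: (subsetP sS).
  have [s1 _ _] := cS _ (rr z zX); exact: (subsetP s1).
exists psi; split=> [z zBS|u v uBS vBS euv].
  rewrite /psi; case: (cls z zBS) => [zX|[zX zB]|[zX zB zR]].
  - rewrite zX; have [hc _] := hchi _ (rr z zX); have := hc z (zc z).
    by rewrite inE => /andP[_]; rewrite /Lb; case: ifP => // _; rewrite inE => /andP[].
  - by rewrite (negPf zX) zB -LbE ?BK //; apply: p1.
  - by rewrite (negPf zX) (negPf zB); apply: h1.
have A12 u' v' : u' \in X -> v' \in B1 -> e u' v' -> psi u' != psi v'.
  move=> uX vB euv'; have vX : v' \notin X by apply/negP; apply: disjE dBX vB.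
  rewrite /psi uX (negPf vX) vB; apply: chiN => //.
  by move: vB; rewrite inE => /andP[vB vD]; apply: NI => //; [exact: nS|left].
have A13 u' v' : u' \in X -> v' \notin X -> v' \notin B1 -> v' \in R -> e u' v' -> psi u' != psi v'.
  move=> uX vX vB vR euv'; rewrite /psi uX (negPf vX) (negPf vB).
  have [uK|uK] := boolP (u' \in K).
    have [hc _] := hchi _ (rr u' uX); have := hc u' (zc u').
    rewrite inE /Lb uK inE => /and3P[_ h _]; apply: contraNneq h => ->.
    by rewrite imset_f // !inE RD // RK.
  have uD := Xin u' uX uK; have vt := Rt u' v' uD vR euv'.
  rewrite vt -pt; apply: chiN => //; last by rewrite -vt.
  apply: NI => //; first by rewrite -vt.
  right; apply: contra uK => /eqP ek; by rewrite -eK -ek.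
have A23 u' v' : u' \notin X -> u' \in B1 -> v' \notin X -> v' \notin B1 -> v' \in R -> e u' v' ->
    psi u' != psi v'.
  move=> uX uB vX vB vR euv'; rewrite /psi (negPf uX) uB (negPf vX) (negPf vB).
  have uD : u' \in D by move: uB; rewrite inE => /andP[].
  have vt := Rt u' v' uD vR euv'; rewrite vt; apply: pt' => //; by rewrite -vt es.
have evu : e v u by rewrite es.
case: (cls u uBS) => [uX|[uX uB]|[uX uB uR]]; case: (cls v vBS) => [vX|[vX vB]|[vX vB vR]].
- rewrite /psi uX vX (croot_eq es euv uX vX); have [_ hc] := hchi _ (rr v vX); apply: hc => //.
  by rewrite inE (croot_eq es euv uX vX).
- exact: A12.
- exact: A13.
- by rewrite eq_sym; apply: A12.
- by rewrite /psi (negPf uX) (negPf vX) uB vB; apply: p2.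
- exact: A23.
- by rewrite eq_sym; apply: A13.
- by rewrite eq_sym; apply: A23.
- by rewrite /psi (negPf uX) (negPf vX) (negPf uB) (negPf vB); apply: h2.
Qed.
End Step.

(** Induction on the number of small vertices: since [K] is left to the inner side, the outside of a
    smallest [D] has fewer of them. The hub [b0] ensures that every component has a hub next to
    it. *)
Lemma colour_hubs b0 (S' B' : {set T}) : b0 \notin S0 -> S' \subset S0 -> [disjoint B' & S0] ->
  (forall u v, u \in S' -> v \in S0 -> e u v -> v \in S') ->
  (forall u v, u \in S' -> v \notin S0 -> e u v -> v \in B') ->
  exists phi, lcol e (B' :|: S') La phi.
Proof.
move=> b0S; have [n] := ubnP #|S'|; elim: n => // n IH in S' B' *.
move=> sz sS dB clS clB.
have [->|/set0Pn[z zS]] := eqVneq S' set0.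
  rewrite setU0; apply: five_choosable => v vB; apply: (@leq_trans 11) => //.
  by apply: hB; apply/negP; apply: disjE dB vB.
have [K [cK zK]] := component_of es zS; have [sK bK clK] := cK; have [_ cnK] := andP bK.
have KS := subset_trans sK sS.
have [t tS ttK] : exists2 t, t \notin S0 & touch e [set t] K.
  have cT : conn e setT by have := @H3 set0; rewrite cards0 setC0; apply.
  have bK0 : b0 \notin K by apply: contra b0S; apply: (subsetP KS).
  have [u [v [uK _ vK euv]]] := conn_cut cT (subsetT _) zK (in_setT b0) bK0.
  exists v; last by apply/touch1P; exists u; rewrite // es.
  apply: contra vK => vS; apply: (clK u) => //; apply: (clS u) => //; exact: (subsetP sK).
have [emp|/set0Pn[y yO]] := eqVneq (~: (t |: K)) set0.
  have [phi [h1 h2]] := one_big cnK KS tS ttK emp.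
  by exists phi; split=> [v _|u v _ _]; [apply: h1|apply: h2]; rewrite in_setT.
have [D0 [cD0 _]] := component_of es yO.
have [m [K1 [t1 [D [tr cD]]]] mmin] := @min_nat (fun m => exists K t D, triple S' K t D /\ #|D| = m)
  #|D0| (ex_intro _ K (ex_intro _ t (ex_intro _ D0 (conj (And4 cK tS ttK cD0) erefl)))).
have tmin K2 t2 D2 : triple S' K2 t2 D2 -> #|D| <= #|D2|.
  by move=> h; rewrite cD; apply: mmin; exists K2, t2, D2.
have [[bK1 bD dKD tK tD] [[sK1 KS1 clK1] clD]] := triple_facts sS clS tr.
have tS1 : t1 \notin S0 by case: tr.
set X := (S' :&: D) :|: K1.
have [|||||phi0 h0] := IH (S' :\: X) (B' :\: D).
- rewrite -ltnS; apply: leq_trans sz; rewrite ltnS; apply: proper_card; apply/properP; split.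
    exact: subsetDl.
  have [/set0Pn[k kK] _] := andP bK1; exists k; first exact: (subsetP sK1).
  by rewrite inE negb_and negbK inE kK orbT.
- exact: subset_trans (subsetDl _ _) sS.
- by apply: disjP => v; rewrite inE => /andP[_]; apply: disjE dB.
- move=> u v; rewrite !(in_setD _ X) => /andP[uX uS] vS euv; rewrite (clS u v) // andbT.
  have evu : e v u by rewrite es.
  apply: contra uX; rewrite !in_setU !in_setI uS /= => /orP[/andP[_ vD]|vK].
    have [//|uD] := boolP (u \in D).
    have [ut|->] := clD v u vD uD evu; last by rewrite orbT.
    by move: tS1; rewrite -ut (subsetP sS).
  by rewrite (clK1 v u vK (subsetP sS _ uS) evu) orbT.
- move=> u v; rewrite inE => /andP[uX uS] vS euv; rewrite inE (clB u v) // andbT.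
  have evu : e v u by rewrite es.
  apply: contra uX => vD; rewrite !inE uS /=.
  have [//|uD] := boolP (u \in D).
  have [ut|->] := clD v u vD uD evu; last by rewrite orbT.
  by move: tS1; rewrite -ut (subsetP sS).
exact: (colour_step sS dB clS clB tr tmin h0).
Qed.

Lemma colour_graph : (exists a b, a != b /\ ~~ e a b) -> exists phi, lcol e setT La phi.
Proof.
move=> nc; have [ST|] := boolP (setT \subset S0).
  by apply: all_small nc; apply/eqP; rewrite eqEsubset subsetT.
case/subsetPn => b0 _ b0S.
rewrite -(setUCr S0) setUC; apply: (colour_hubs b0S) => //.
- by apply: disjP => z; rewrite inE => /negP.
- by move=> u v _ vS _; rewrite inE.
Qed.
End Main.

From mathcomp Require Import all_order all_algebra lra.
From Stdlib Require Import Btauto.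
Import Order.TTheory GRing.Theory Num.Theory.
Local Open Scope ring_scope.

(** * Crossing parity of chains *)

Section Parity.
Variables (R : realFieldType) (d : R).
Implicit Types (u v w a b c p q : R * R) (s t : seq (R * R)).

(** An open half-plane together with one of its boundary rays, so that of two opposite nonzero
    vectors exactly one belongs to it. *)
Definition upper u := (0 < u.2) || ((u.2 == 0) && (0 < u.1)).
(* For short steps away from the origin: the step from u to v crosses the positive first axis. *)
Definition cross u v := (upper u (+) upper v) && (0 < u.1).
Definition near2 r u v := (`|u.1 - v.1| <= r) && (`|u.2 - v.2| <= r).
Definition far u := (2 * d < `|u.1|) || (2 * d < `|u.2|).

Lemma upperN u : u != 0 -> upper (- u) = ~~ upper u.
Proof.
case: u => x y; rewrite -[0]/(0, 0) xpair_eqE /upper /= => h.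
rewrite oppr_gt0 oppr_eq0 oppr_gt0; case: (ltgtP y 0) h => //= _.
by rewrite andbT; case: (ltgtP x 0).
Qed.

Lemma upper_far u v : near2 (2 * d) u v -> far u -> upper u != upper v -> 2 * d < `|u.1|.
Proof.
move=> /andP[_ h2] /orP[//|h3]; move: h2 h3; rewrite /upper.
case: (ltgtP u.2 0) => hu; case: (ltgtP v.2 0) => hv //=; rewrite ?eqxx //.
- rewrite (ltr0_norm hu) ltr0_norm => [|]; lra.
- rewrite (ltr0_norm hu) ltr0_norm => [|]; lra.
- rewrite (gtr0_norm hu) gtr0_norm => [|]; lra.
- rewrite (gtr0_norm hu) gtr0_norm => [|]; lra.
- rewrite hu normr0 => h h'; have := normr_ge0 (0 - v.2); lra.
- rewrite hu normr0 => h h'; have := normr_ge0 (0 - v.2); lra.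
- rewrite hu normr0 => h h'; have := normr_ge0 (0 - v.2); lra.
Qed.

Lemma pos_near u w : 2 * d < `|u.1| -> near2 (2 * d) u w -> (0 < u.1) = (0 < w.1).
Proof.
move=> h /andP[]; rewrite ler_norml => /andP[h1 h2] _.
by case: (ltgtP u.1 0) h => hu; rewrite ?(ltr0_norm hu) ?(gtr0_norm hu) ?hu ?normr0 => h;
  symmetry; apply/idP; lra.
Qed.
(** The four points are too close together to surround the origin. If the first axis is crossed
    between any two of them, all first coordinates have the same sign, so the parity depends on the
    end points only. *)
Lemma cross_quad u1 u2 u3 u4 (S := [:: u1; u2; u3; u4]) :
  {in S &, forall x y, near2 (2 * d) x y} -> {in S, forall x, far x} ->
  cross u1 u2 (+) cross u2 u3 = cross u1 u4 (+) cross u4 u3.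
Proof.
move=> N F.
have key x y : x \in S -> y \in S -> upper x != upper y -> forall z, z \in S -> (0 < z.1) = (0 < u1.1).
  move=> xS yS hxy z zS; have fx := upper_far (N x y xS yS) (F x xS) hxy.
  rewrite -(pos_near fx (N x z xS zS)) -(pos_near fx (N x u1 xS _)) //.
  by rewrite inE eqxx.
have [m1 m2 m3 m4] : [/\ u1 \in S, u2 \in S, u3 \in S & u4 \in S].
  by rewrite !inE !eqxx ?orbT.
have fin : (forall z, z \in S -> (0 < z.1) = (0 < u1.1)) ->
    cross u1 u2 (+) cross u2 u3 = cross u1 u4 (+) cross u4 u3.
  move=> h; rewrite /cross (h u2) // (h u4) //.
  by case: (upper u1); case: (upper u2); case: (upper u3); case: (upper u4); case: (0 < u1.1).
have [e12|n12] := eqVneq (upper u1) (upper u2); last exact: fin (key _ _ m1 m2 n12).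
have [e13|n13] := eqVneq (upper u1) (upper u3); last exact: fin (key _ _ m1 m3 n13).
have [e14|n14] := eqVneq (upper u1) (upper u4); last exact: fin (key _ _ m1 m4 n14).
by rewrite /cross -e12 -e13 -e14 !addbb.
Qed.

(* Crossings of the ray from c in the first direction by the chain a :: s, mod 2. *)
Fixpoint wind c a s := if s is b :: s' then cross (a - c) (b - c) (+) wind c b s' else false.

Definition apart a s c t := {in a :: s & c :: t, forall p q, far (p - q)}.

Lemma near2W u v w z : 0 <= d -> near2 d u v -> near2 d w z -> near2 (2 * d) (u - w) (v - z).
Proof.
rewrite /near2 /= !ler_norml => d0 /andP[/andP[? ?] /andP[? ?]] /andP[/andP[? ?] /andP[? ?]].
by apply/andP; split; apply/andP; split; lra.
Qed.

Lemma near2xx u : 0 <= d -> near2 d u u.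
Proof. by rewrite /near2 !subrr normr0 => ->. Qed.

Lemma near2C u v : near2 d u v = near2 d v u.
Proof. by rewrite /near2 distrC [`|u.2 - _|]distrC. Qed.

(** The counterpart of [wind] in which the subtracted point moves. *)
Fixpoint dual p c t := if t is q :: t' then cross (p - c) (p - q) (+) dual p q t' else false.

Lemma dual_strip p p' c t : 0 <= d -> near2 d p p' -> path (near2 d) c t ->
  {in c :: t, forall q, far (p - q) /\ far (p' - q)} ->
  cross (p - c) (p' - c) (+) dual p' c t = dual p c t (+) cross (p - last c t) (p' - last c t).
Proof.
move=> d0 np; elim: t c => [c _ _|q t IH c /= /andP[cq pt] F] /=; first by rewrite addbF.
have [fc fc'] := F c (mem_head _ _).
have [fq fq'] : far (p - q) /\ far (p' - q) by apply: F; rewrite !inE eqxx orbT.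
have := IH q pt (fun z zi => F z (mem_behead (s := [:: c, q & t]) zi)).
have : cross (p - c) (p' - c) (+) cross (p' - c) (p' - q) =
       cross (p - c) (p - q) (+) cross (p - q) (p' - q).
  apply: cross_quad => x.
    have nn u : near2 d u u := near2xx u d0.
    have npp : near2 d p' p by rewrite near2C.
    have nq : near2 d q c by rewrite near2C.
    by move=> y; rewrite !inE => /or4P[] /eqP-> /or4P[] /eqP->; apply: near2W.
  by rewrite !inE => /or4P[] /eqP->.
case: (cross (p - c) (p' - c)); case: (cross (p' - c) (p' - q)); case: (cross (p - c) (p - q));
  case: (cross (p - q) (p' - q)) => //= _;
  by case: (dual p' q t); case: (dual p q t); case: (cross _ _).
Qed.

(** The differences between points of the two chains form a grid of small squares far from the
    origin. By [cross_quad] the two ways round its boundary have the same parity. *)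
Lemma wind_dual a s c t : 0 <= d -> path (near2 d) a s -> path (near2 d) c t -> apart a s c t ->
  wind c a s (+) dual (last a s) c t = dual a c t (+) wind (last c t) a s.
Proof.
move=> d0; elim: s a => [a _ _ _|b s IH a /= /andP[ab pb] pt F] /=; first by rewrite addbF.
have Fb : apart b s c t by move=> p q pi qi; apply: F => //; rewrite inE pi orbT.
have := IH b pb pt Fb.
have := @dual_strip a b c t d0 ab pt _.
move=> /(_ (fun q qi => conj (F a q (mem_head _ _) qi) (Fb b q (mem_head _ _) qi))).
by case: (cross (a - c) (b - c)); case: (dual b c t); case: (dual a c t);
  case: (cross _ _); case: (wind c b s); case: (wind _ b s); case: (dual _ _ _).
Qed.

Lemma far_neq u : 0 <= d -> far u -> u != 0.
Proof.
by move=> d0; apply: contraTneq => ->; rewrite /far normr0 orbb -leNgt mulr_ge0.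
Qed.

(** Negating a step exchanges the two halves of the first axis, and a change of [upper] crosses
    exactly one of them. *)
Lemma dual_wind p c t : 0 <= d -> path (near2 d) c t -> {in c :: t, forall q, far (p - q)} ->
  dual p c t = wind p c t (+) (upper (p - c) (+) upper (p - last c t)).
Proof.
move=> d0; elim: t c => [c _ _|q t IH c /= /andP[cq pt] F] /=; first by rewrite addbb.
have fc := F c (mem_head _ _).
have fq : far (p - q) by apply: F; rewrite !inE eqxx orbT.
rewrite (IH q pt (fun z zi => F z (mem_behead (s := [:: c, q & t]) zi))).
suff -> : cross (p - c) (p - q) = cross (c - p) (q - p) (+) (upper (p - c) (+) upper (p - q)).
  by case: (cross _ _); case: (wind _ _ _); case: (upper _); case: (upper _); case: (upper _).
rewrite /cross -(opprB p c) -(opprB p q) !upperN ?(far_neq d0) // [(- (p - c)).1]/= oppr_gt0.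
have [->|hn] := eqVneq (upper (p - c)) (upper (p - q)); first by rewrite !addbb.
have nn : near2 (2 * d) (p - c) (p - q) by apply: near2W; rewrite ?near2xx.
have := upper_far nn fc hn; case: (ltgtP (p - c).1 0) => h.
- by case: (upper _) (upper _) => [] [].
- by case: (upper _) (upper _) => [] [].
- by rewrite h normr0 ltNge mulr_ge0.
Qed.

(** Takes the place of counting intersections: as the chains stay apart, only the relative positions
    of their four end points appear on the right. *)
Lemma wind_grid a s c t : 0 <= d -> path (near2 d) a s -> path (near2 d) c t -> apart a s c t ->
  wind c a s (+) wind (last c t) a s (+) (wind a c t (+) wind (last a s) c t) =
  upper (a - c) (+) upper (a - last c t) (+) (upper (last a s - c) (+) upper (last a s - last c t)).
Proof.
move=> d0 ps pt F; have := wind_dual d0 ps pt F.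
rewrite !dual_wind //; first last.
- by move=> q qi; apply: F => //; apply: mem_last.
- by move=> q qi; apply: F => //; apply: mem_head.
by case: (wind c a s); case: (wind (last c t) a s); case: (wind a c t);
 case: (wind (last a s) c t); case: (upper (a - c)); case: (upper (a - last c t));
 case: (upper (last a s - c)); case: (upper (last a s - last c t)).
Qed.
Lemma addb_xorb (x y : bool) : x (+) y = xorb x y.
Proof. by case: x; case: y. Qed.

Lemma K5_parity (v : nat -> R * R) (s : nat -> nat -> seq (R * R)) : 0 <= d ->
  (forall i j, (i < j < 5)%N -> path (near2 d) (v i) (s i j) /\ last (v i) (s i j) = v j) ->
  (forall i j k l, (i < j < 5)%N -> (k < l < 5)%N -> uniq [:: i; j; k; l] ->
    apart (v i) (s i j) (v k) (s k l)) ->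
  (forall i k, (i < k < 5)%N -> upper (v k - v i) = ~~ upper (v i - v k)) -> False.
Proof.
move=> d0 hs ha hh.
(* In the sum over all pairs of independent edges every m i j k occurs twice, whereas an odd
   number of the g i k occur with reversed arguments. *)
pose m i j k := wind (v k) (v i) (s i j); pose g i k := upper (v i - v k).
have gN i k : (i < k < 5)%N -> g k i = negb (g i k) := hh i k.
have rel i j k l : (i < j < 5)%N -> (k < l < 5)%N -> uniq [:: i; j; k; l] ->
    xorb (xorb (m i j k) (m i j l)) (xorb (m k l i) (m k l j)) =
    xorb (xorb (g i k) (g i l)) (xorb (g j k) (g j l)).
  move=> ij kl u; have [p1 l1] := hs i j ij; have [p2 l2] := hs k l kl.
  have := wind_grid d0 p1 p2 (ha i j k l ij kl u); rewrite l1 l2 !addb_xorb; exact.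
have E0 := rel 0 1 2 3 isT isT isT.
have E1 := rel 0 1 2 4 isT isT isT.
have E2 := rel 0 1 3 4 isT isT isT.
have E3 := rel 0 2 1 3 isT isT isT.
have E4 := rel 0 2 1 4 isT isT isT.
have E5 := rel 0 2 3 4 isT isT isT.
have E6 := rel 0 3 1 2 isT isT isT.
have E7 := rel 0 3 1 4 isT isT isT.
have E8 := rel 0 3 2 4 isT isT isT.
have E9 := rel 0 4 1 2 isT isT isT.
have E10 := rel 0 4 1 3 isT isT isT.
have E11 := rel 0 4 2 3 isT isT isT.
have E12 := rel 1 2 3 4 isT isT isT.
have E13 := rel 1 3 2 4 isT isT isT.
have E14 := rel 1 4 2 3 isT isT isT.
have S1 := E0.
have {}S1 := f_equal2 xorb S1 E1.
have {}S1 := f_equal2 xorb S1 E2.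
have {}S1 := f_equal2 xorb S1 E3.
have {}S1 := f_equal2 xorb S1 E4.
have {}S1 := f_equal2 xorb S1 E5.
have {}S1 := f_equal2 xorb S1 E6.
have {}S1 := f_equal2 xorb S1 E7.
have {}S1 := f_equal2 xorb S1 E8.
have {}S1 := f_equal2 xorb S1 E9.
have {}S1 := f_equal2 xorb S1 E10.
have {}S1 := f_equal2 xorb S1 E11.
have {}S1 := f_equal2 xorb S1 E12.
have {}S1 := f_equal2 xorb S1 E13.
have {}S1 := f_equal2 xorb S1 E14.
rewrite ?(gN 1 2 isT) ?(gN 1 3 isT) ?(gN 1 4 isT) ?(gN 2 3 isT) ?(gN 2 4 isT) ?(gN 3 4 isT) in S1.
move: S1; set lhs := (X in X = _ -> _); set rhs := (X in _ = X -> _).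
have -> : lhs = false by rewrite /lhs; clear; move: m => ?; btauto.
have -> : rhs = true by rewrite /rhs; clear; move: g => ?; btauto.
by [].
Qed.

(** The same count as for [K5], over eighteen pairs of independent edges: each [m i j k] occurs
    twice, and an odd number of the [g i k] is reversed. *)
Lemma K33_parity (v : nat -> R * R) (s : nat -> nat -> seq (R * R)) : 0 <= d ->
  (forall i j, [&& i < 3, 3 <= j & j < 6]%N -> path (near2 d) (v i) (s i j) /\ last (v i) (s i j) = v j) ->
  (forall i j k l, [&& i < 3, 3 <= j & j < 6]%N -> [&& k < 3, 3 <= l & l < 6]%N -> uniq [:: i; j; k; l] ->
    apart (v i) (s i j) (v k) (s k l)) ->
  (forall i k, (i < k < 6)%N -> upper (v k - v i) = ~~ upper (v i - v k)) -> False.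
Proof.
move=> d0 hs ha hh.
pose m i j k := wind (v k) (v i) (s i j); pose g i k := upper (v i - v k).
have gN i k : (i < k < 6)%N -> g k i = negb (g i k) := hh i k.
have rel i j k l : [&& i < 3, 3 <= j & j < 6]%N -> [&& k < 3, 3 <= l & l < 6]%N -> uniq [:: i; j; k; l] ->
    xorb (xorb (m i j k) (m i j l)) (xorb (m k l i) (m k l j)) =
    xorb (xorb (g i k) (g i l)) (xorb (g j k) (g j l)).
  move=> ij kl u; have [p1 l1] := hs i j ij; have [p2 l2] := hs k l kl.
  have := wind_grid d0 p1 p2 (ha i j k l ij kl u); rewrite l1 l2 !addb_xorb; exact.
have E0 := rel 0 3 1 4 isT isT isT.
have E1 := rel 0 3 1 5 isT isT isT.
have E2 := rel 0 3 2 4 isT isT isT.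
have E3 := rel 0 3 2 5 isT isT isT.
have E4 := rel 0 4 1 3 isT isT isT.
have E5 := rel 0 4 1 5 isT isT isT.
have E6 := rel 0 4 2 3 isT isT isT.
have E7 := rel 0 4 2 5 isT isT isT.
have E8 := rel 0 5 1 3 isT isT isT.
have E9 := rel 0 5 1 4 isT isT isT.
have E10 := rel 0 5 2 3 isT isT isT.
have E11 := rel 0 5 2 4 isT isT isT.
have E12 := rel 1 3 2 4 isT isT isT.
have E13 := rel 1 3 2 5 isT isT isT.
have E14 := rel 1 4 2 3 isT isT isT.
have E15 := rel 1 4 2 5 isT isT isT.
have E16 := rel 1 5 2 3 isT isT isT.
have E17 := rel 1 5 2 4 isT isT isT.
have S1 := E0.
have {}S1 := f_equal2 xorb S1 E1.
have {}S1 := f_equal2 xorb S1 E2.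
have {}S1 := f_equal2 xorb S1 E3.
have {}S1 := f_equal2 xorb S1 E4.
have {}S1 := f_equal2 xorb S1 E5.
have {}S1 := f_equal2 xorb S1 E6.
have {}S1 := f_equal2 xorb S1 E7.
have {}S1 := f_equal2 xorb S1 E8.
have {}S1 := f_equal2 xorb S1 E9.
have {}S1 := f_equal2 xorb S1 E10.
have {}S1 := f_equal2 xorb S1 E11.
have {}S1 := f_equal2 xorb S1 E12.
have {}S1 := f_equal2 xorb S1 E13.
have {}S1 := f_equal2 xorb S1 E14.
have {}S1 := f_equal2 xorb S1 E15.
have {}S1 := f_equal2 xorb S1 E16.
have {}S1 := f_equal2 xorb S1 E17.
rewrite ?(gN 1 3 isT) ?(gN 1 4 isT) ?(gN 1 5 isT) ?(gN 2 3 isT) ?(gN 2 4 isT) ?(gN 2 5 isT) ?(gN 3 4 isT) ?(gN 3 5 isT) ?(gN 4 5 isT) in S1.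
move: S1; set lhs := (X in X = _ -> _); set rhs := (X in _ = X -> _).
have -> : lhs = false by rewrite /lhs; clear; move: m => ?; btauto.
have -> : rhs = true by rewrite /rhs; clear; move: g => ?; btauto.
by [].
Qed.
End Parity.

Require Import Defs.
From mathcomp Require Import all_classical all_reals all_analysis.
Import Order.TTheory GRing.Theory Num.Theory.
Import numFieldNormedType.Exports.
Local Open Scope classical_set_scope.
Local Open Scope card_scope.
Local Open Scope ring_scope.

(** * From plane drawings to excluded minors *)

Section Plane.
Variable R : realType.
Implicit Types (A B K : set (R * R)) (p q x y : R * R).

Lemma ball_near2 x r y : ball x r y -> near2 r x y.
Proof. by move=> [/= h1 h2]; rewrite /near2 !ltW. Qed.

Lemma not_far_ball d r x y : 2 * d < r -> ~~ far d (x - y) -> ball x r y.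
Proof.
rewrite /far negb_or -!leNgt => dr /andP[h1 h2].
by split; apply: le_lt_trans dr.
Qed.

(** The points that chains reach form a subset of [K] that is relatively open and relatively
    closed. *)
Lemma eps_chain K d p q : connected K -> 0 < d -> K p -> K q ->
  exists s, [/\ path (near2 d) p s, last p s = q & forall z, z \in s -> K z].
Proof.
move=> cK d0 Kp Kq.
pose A := [set z | K z /\ exists s, [/\ path (near2 d) p s, last p s = z &
  forall z, z \in s -> K z]].
have stepA x y : A x -> K y -> near2 d x y -> A y.
  move=> [Kx [s [ps ls Ks]]] Ky nxy; split=> //; exists (rcons s y).
  rewrite rcons_path ps ls nxy last_rcons; split=> // z.
  by rewrite mem_rcons inE => /orP[/eqP->|/Ks].
have nC x y : near2 d x y -> near2 d y x by rewrite near2C.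
suff AK : A = K by have [] : A q by rewrite AK.
apply: cK.
- by exists p; split=> //; exists [::].
- exists (\bigcup_(x in A) ball x d); first by apply: bigcup_open => x _; exact: ball_open.
  rewrite eqEsubset; split=> [x Ax|x [Kx [y Ay yx]]].
    by split; [case: Ax|exists x => //; exact: ballxx].
  by apply: stepA Ay Kx _; apply: ball_near2.
- exists (~` \bigcup_(x in K `\` A) ball x d).
    by apply: open_closedC; apply: bigcup_open => x _; exact: ball_open.
  rewrite eqEsubset; split=> [x Ax|x [Kx nx]].
    split; first by case: Ax.
    move=> [y [Ky nAy] yx]; apply: nAy; apply: stepA Ax Ky _.
    by apply: nC; apply: ball_near2.
  by apply: contrapT => nAx; apply: nx; exists x; [split|exact: ballxx].
Qed.

(** The filter form lets the finitely many pairs of edges share one [d] in [scale_ex]. *)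
Lemma compact_apart A B : compact A -> compact B -> A `&` B = set0 ->
  \forall d \near 0^'+, forall a b, A a -> B b -> far d (a - b).
Proof.
move=> cA cB AB.
have clB : closed B by apply: compact_closed => //; exact: norm_hausdorff.
have : \forall d \near (0:R)^'+, A `<=` [set a | forall b, B b -> far d (a - b)].
  apply: (iffLR (compact_near_coveringP A)) => // x Ax.
  have nB : nbhs x (~` B).
    apply: open_nbhs_nbhs; split; first exact: closed_openC.
    by move=> Bx; rewrite -[False]/(set0 x) -AB.
  have [r /= r0 rB] := (nbhs_ballP _ _).1 nB.
  near=> x' d => b Bb; apply: contraPT Bb => /(@not_far_ball d (r / 2) _ _) h.
  apply: rB; rewrite [r]splitr; apply: (@ball_triangle _ _ x').
    near: x'; by apply: nbhsx_ballx; rewrite divr_gt0.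
  apply: h; suff : d < r / 4 by lra.
  near: d; apply: nbhs_right_lt; lra.
by apply: filterS => d h a b Aa; apply: h.
Unshelve. all: by end_near.
Qed.
End Plane.

(** * Chains along the arcs of a drawing *)

Section Drawing.
Variables (R : realType) (G : sgraph) (pt : G -> R * R) (arc : G -> G -> set (R * R)).
Hypothesis dr : plane_drawing pt arc.
Implicit Types (X : {set G}) (u v x y : G).

Lemma arc_facts u v : adj u v ->
  [/\ compact (arc u v), connected (arc u v), arc u v (pt u) & arc u v (pt v)].
Proof.
move=> /(drawing_arc dr)[g [cg _ g0 g1 <-]]; split.
- by apply: continuous_compact => //; exact: segment_compact.
- by apply: connected_continuous_connected => //; exact: segment_connected.
- by rewrite -g0; exists 0; rewrite //= in_itv /= lexx ler01.
- by rewrite -g1; exists 1; rewrite //= in_itv /= lexx ler01.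
Qed.

Definition indep u v x y := [&& adj u v, adj x y, u != x, u != y, v != x & v != y].

Lemma arcs_disjoint u v x y : indep u v x y -> arc u v `&` arc x y = set0.
Proof.
move=> /and5P[uv xy ux uy /andP[vx vy]]; rewrite -subset0 => z zI.
have ne : [set u; v]%SET != [set x; y]%SET.
  apply/eqP => /setP/(_ u); rewrite !inE eqxx (negPf ux) (negPf uy) //.
have [w _ wz] := drawing_cross dr uv xy ne zI; case: zI; rewrite -wz.
move=> /(drawing_vertex dr uv)[->|->] /(drawing_vertex dr xy)[] h.
- by rewrite h eqxx in ux.
- by rewrite h eqxx in uy.
- by rewrite h eqxx in vx.
- by rewrite h eqxx in vy.
Qed.

Lemma scale_ex : exists d : R, 0 < d /\ forall u v x y, indep u v x y ->
  forall p q, arc u v p -> arc x y q -> far d (p - q).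
Proof.
have : \forall d \near (0 : R)^'+, forall t : G * G * (G * G), indep t.1.1 t.1.2 t.2.1 t.2.2 ->
    forall p q, arc t.1.1 t.1.2 p -> arc t.2.1 t.2.2 q -> far d (p - q).
  apply: filter_forall => -[[u v] [x y]] /=.
  have [h|h] := boolP (indep u v x y); last by near=> d.
  have [/arc_facts[cu _ _ _] /arc_facts[cx _ _ _]] : adj u v /\ adj x y.
    by case/and3P: h.
  by apply: filterS (compact_apart cu cx (arcs_disjoint h)) => d hd _.
move=> h; have [d [d0 hd]] := filter_ex (filterI (nbhs_right_gt (0 : R)) h).
exists d; split=> // u v x y; exact: (hd ((u, v), (x, y))).
Unshelve. all: by end_near.
Qed.

Definition on_arcs X (z : R * R) := exists u v, [/\ u \in X, v \in X, adj u v & arc u v z].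

Lemma arc_chain d X x y : 0 < d -> conn (@adj G) X -> x \in X -> y \in X -> x != y ->
  exists s, [/\ path (near2 d) (pt x) s, last (pt x) s = pt y &
    forall z, z \in pt x :: s -> on_arcs X z].
Proof.
move=> d0 cX xX yX xy.
have [s [ps ls os]] : exists s, [/\ path (near2 d) (pt x) s, last (pt x) s = pt y &
    forall z, z \in s -> on_arcs X z].
  have /connectP[p] := conn_connect cX xX yX.
  elim: p x xX {xy} => [x _ _ ->|w p IH x xX /= /andP[/and3P[xw _ wX] pp] lp].
    by exists [::].
  have [s [ps ls os]] := IH w wX pp lp.
  have [_ ca ax aw] := arc_facts xw.
  have [s' [ps' ls' os']] := eps_chain ca d0 ax aw.
  exists (s' ++ s); rewrite cat_path ps' ls' ps last_cat ls' ls; split=> // z.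
  by rewrite mem_cat => /orP[/os' az|/os //]; exists x, w.
exists s; split=> // z; rewrite inE => /orP[/eqP->|]; last exact: os.
have : (0 < #|nbr (@adj G) x X|)%N.
  by apply: nbr_gt0 => //; apply/card_gt1P; exists x, y.
move=> /card_gt0P[w]; rewrite inE => /andP[wX xw]; have [_ _ ax _] := arc_facts xw.
by exists x, w.
Qed.

Section Minor.
Variables (n : nat) (a : nat -> {set G}) (r : nat -> G) (lk : rel nat).
Hypothesis ha : forall i, (i < n)%N -> bag (@adj G) (a i).
Hypothesis hr : forall i, (i < n)%N -> r i \in a i.
Hypothesis hd : forall i j, (i < n)%N -> (j < n)%N -> i != j -> (fintype.disjoint (mem (a i)%SET) (mem (a j)%SET)).
Hypothesis hlk : forall i j, lk i j -> [/\ (i < n)%N, (j < n)%N, i != j & touch (@adj G) (a i) (a j)].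

(** A link of the minor becomes a chain along arcs inside the union of its two branch sets. Links
    with four distinct ends have disjoint unions, so their edges are independent and their arcs keep
    the distance given by [scale_ex]. *)
Lemma minor_chains : exists (d : R) (s : nat -> nat -> seq (R * R)), [/\ 0 <= d,
  forall i j, lk i j -> path (near2 d) (pt (r i)) (s i j) /\ last (pt (r i)) (s i j) = pt (r j) &
  forall i j k l, lk i j -> lk k l -> uniq [:: i; j; k; l] ->
    apart d (pt (r i)) (s i j) (pt (r k)) (s k l)].
Proof.
have [d [d0 hfar]] := scale_ex.
have : forall ij : nat * nat, exists s, lk ij.1 ij.2 ->
    [/\ path (near2 d) (pt (r ij.1)) s, last (pt (r ij.1)) s = pt (r ij.2) &
    forall z, z \in pt (r ij.1) :: s -> on_arcs (a ij.1 :|: a ij.2) z].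
  move=> [i j] /=; have [h|h] := boolP (lk i j); last by exists [::].
  have [ni nj ij t] := hlk h.
  have [_ ci] := andP (ha ni); have [_ cj] := andP (ha nj).
  have [||||s hs] := @arc_chain d (a i :|: a j) (r i) (r j) d0.
  - by apply: connU => //; exact: adj_sym.
  - by rewrite inE hr.
  - by rewrite inE hr ?orbT.
  - apply/eqP => e; apply: (disjE (hd ni nj ij) (hr ni)); rewrite e; exact: hr.
  by exists s.
move=> /choice[f hf]; exists d, (fun i j => f (i, j)); split; first exact: ltW.
  by move=> i j h; have [] := hf (i, j) h.
move=> i j k l h1 h2 u p q pi qi.
have [_ _ /(_ p pi)[u1 [v1 [u1i v1i uv1 ap]]]] := hf (i, j) h1.
have [_ _ /(_ q qi)[u2 [v2 [u2i v2i uv2 aq]]]] := hf (k, l) h2.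
apply: hfar ap aq; rewrite /indep uv1 uv2 /=.
have [ni nj _ _] := hlk h1; have [nk nl _ _] := hlk h2.
have dU : (fintype.disjoint (mem (a i :|: a j)%SET) (mem (a k :|: a l)%SET)).
  move: u; rewrite /= !inE !negb_or => /and4P[/and3P[_ ik il] /andP[jk jl] _ _].
  apply: disjP => z; rewrite !inE => /orP[zi|zi] /orP[zj|zj].
  - exact: (disjE (hd ni nk ik) zi zj).
  - exact: (disjE (hd ni nl il) zi zj).
  - exact: (disjE (hd nj nk jk) zi zj).
  - exact: (disjE (hd nj nl jl) zi zj).
have ne z w : z \in a i :|: a j -> w \in a k :|: a l -> z != w.
  by move=> zi wk; apply/eqP => zw; apply: (disjE dU zi); rewrite zw.
by rewrite !ne.
Qed.

Lemma minor_upper i k : (i < k < n)%N ->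
  upper (pt (r k) - pt (r i)) = ~~ upper (pt (r i) - pt (r k)).
Proof.
move=> /andP[ik kn]; have ni := ltn_trans ik kn.
rewrite -opprB upperN // subr_eq0; apply/eqP => /(drawing_inj dr) e.
have nik : i != k by rewrite neq_ltn ik.
by apply: (disjE (hd ni kn nik) (hr ni)); rewrite e; apply: hr.
Qed.
End Minor.

Lemma drawn_K5free : K5free (@adj G).
Proof.
move=> a1 a2 a3 a4 a5 hb hp.
pose L := [:: a1; a2; a3; a4; a5]; pose a i := nth finset.set0 L i.
have ha i : (i < 5)%N -> bag (@adj G) (a i).
  by move=> i5; apply: (allP hb); apply: mem_nth.
have [r hr] : exists r : nat -> G, forall i, (i < 5)%N -> r i \in a i.
  have [x0 _] : exists x0, x0 \in a1 by apply/set0Pn; have [] := andP (ha 0%N isT).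
  have : forall i, exists x, (i < 5)%N -> x \in a i.
    move=> i; have [i5|_] := ltnP i 5; last by exists x0.
    by have /andP[/set0Pn[x xa] _] := ha i i5; exists x.
  by move=> /choice[f hf]; exists f.
have hlt i j : (i < j < 5)%N -> (fintype.disjoint (mem (a i)%SET) (mem (a j)%SET)) && touch (@adj G) (a i) (a j).
  move=> /andP[ij j5]; apply: (pairwiseP finset.set0 hp) => //.
  by rewrite inE /=; apply: ltn_trans j5.
have hd i j : (i < 5)%N -> (j < 5)%N -> i != j -> (fintype.disjoint (mem (a i)%SET) (mem (a j)%SET)).
  move=> i5 j5; rewrite neq_ltn => /orP[ij|ij].
    by have := hlt i j; rewrite ij j5 => /(_ isT)/andP[].
  by rewrite disjoint_sym; have := hlt j i; rewrite ij i5 => /(_ isT)/andP[].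
have [|d [s [d0 h1 h2]]] := @minor_chains 5 a r (fun i j => (i < j < 5)%N) ha hr hd.
  move=> i j h; have /andP[_ t] := hlt i j h; have /andP[ij j5] := h.
  by split=> //; [apply: ltn_trans j5|rewrite neq_ltn ij].
apply: (K5_parity (v := fun i => pt (r i)) d0 h1 h2) => i k.
by have := @minor_upper 5 a r hr hd i k.
Qed.

Lemma drawn_K33free : K33free (@adj G).
Proof.
move=> a1 a2 a3 b1 b2 b3 hb hp ht.
pose L := [:: a1; a2; a3; b1; b2; b3]; pose a i := nth finset.set0 L i.
have ha i : (i < 6)%N -> bag (@adj G) (a i).
  by move=> i6; apply: (allP hb); apply: mem_nth.
have [r hr] : exists r : nat -> G, forall i, (i < 6)%N -> r i \in a i.
  have [x0 _] : exists x0, x0 \in a1 by apply/set0Pn; have [] := andP (ha 0%N isT).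
  have : forall i, exists x, (i < 6)%N -> x \in a i.
    move=> i; have [i6|_] := ltnP i 6; last by exists x0.
    by have /andP[/set0Pn[x xa] _] := ha i i6; exists x.
  by move=> /choice[f hf]; exists f.
have hlt i j : (i < j < 6)%N -> (fintype.disjoint (mem (a i)%SET) (mem (a j)%SET)).
  move=> /andP[ij j6]; apply: (pairwiseP finset.set0 hp) => //.
  by rewrite inE /=; apply: ltn_trans j6.
have hd i j : (i < 6)%N -> (j < 6)%N -> i != j -> (fintype.disjoint (mem (a i)%SET) (mem (a j)%SET)).
  move=> i6 j6; rewrite neq_ltn => /orP[ij|ij]; first by apply: hlt; rewrite ij.
  by rewrite disjoint_sym; apply: hlt; rewrite ij.
have [|d [s [d0 h1 h2]]] := @minor_chains 6 a r (fun i j => [&& i < 3, 3 <= j & j < 6]%N) ha hr hd.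
  move=> i j /and3P[i3 j3 j6]; have ij : (i < j)%N := leq_trans i3 j3.
  split; [exact: ltn_trans ij j6|exact: j6|by rewrite neq_ltn ij|].
  apply: (allrelP ht).
    by case: i i3 {ij} => [|[|[|]]] // _; rewrite !inE eqxx ?orbT.
  by case: j j3 j6 {ij} => [|[|[|[|[|[|]]]]]] // _ _; rewrite !inE eqxx ?orbT.
apply: (K33_parity (v := fun i => pt (r i)) d0 h1 h2) => i k.
by have := @minor_upper 6 a r hr hd i k.
Qed.
End Drawing.

(** * Arbitrary colour sets *)

Lemma card_le_pick (U : Type) n (B : set U) : `I_n #<= B ->
  exists2 g : 'I_n -> U, injective g & forall i, B (g i).
Proof.
move=> /card_leP[f]; pose g (i : 'I_n) := val (f (SigSub (mem_set (ltn_ord i : `I_n i)))).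
exists g; last by move=> i; exact: set_valP.
move=> i j /val_inj/(inj (f := f)) h; apply: val_inj.
by have := h (in_setT _) (in_setT _) => /(congr1 val).
Qed.

(** Keeping [f v] colours at each vertex leaves finitely many. Equal colours picked at different
    vertices have to be identified, which [rep] does by a canonical index. *)
Lemma finite_colours (G : sgraph) (f : G -> nat) :
  (forall (C : finType) (c0 : C) (La : G -> {set C}), (forall v, f v <= #|La v|)%N ->
    exists phi, lcol (@adj G) [set: G]%SET La phi) -> choosable f.
Proof.
move=> h C L hL.
have [g gi gL] : exists2 g : forall v, 'I_(f v) -> C, forall v, injective (g v) &
    forall v i, L v (g v i).
  have : forall v, exists g : 'I_(f v) -> C, injective g /\ forall i, L v (g i).
    by move=> v; have [g ? ?] := card_le_pick (hL v); exists g.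
  move=> H; exists (fun v => projT1 (cid (H v))) => v; by case: (projT2 (cid (H v))).
pose E := {v : G & 'I_(f v)}.
pose col (x : E) := g (tag x) (tagged x).
pose rep (x : E) := odflt x [pick y : E | `[< col y = col x >]].
have repc x : col (rep x) = col x.
  by rewrite /rep; case: pickP => //= y /asboolP.
have repE x y : col x = col y -> rep x = rep y.
  move=> e; rewrite /rep e; case: pickP => //= no.
  by have := no y; rewrite (asboolT (erefl (col y))).
pose La v := [set Some (rep (Tagged (fun v => 'I_(f v)) i)) | i : 'I_(f v)]%SET.
have sz v : (f v <= #|La v|)%N.
  rewrite card_imset ?card_ord // => i j [] /(congr1 col); rewrite !repc; exact: gi.
(* [None] serves as the default colour even when [E] is empty; it is in no list. *)
have [phi [p1 p2]] := h (option E) None La sz.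
have /choice[psi hpsi] : forall v, exists x : E, phi v = Some x /\ L v (col x).
  move=> v; have /imsetP[i _ e] := p1 v (finset.in_setT v).
  exists (rep (Tagged (fun v => 'I_(f v)) i)); split=> //; rewrite repc; exact: gL.
exists (fun v => col (psi v)); split=> [v|u v uv e]; first by case: (hpsi v).
have /negP[] := p2 u v (finset.in_setT u) (finset.in_setT v) uv; apply/eqP.
have rr w : exists x, psi w = rep x.
  have /imsetP[i _] := p1 w (finset.in_setT w); rewrite (hpsi w).1 => -[->]; by eexists.
have [x ex] := rr u; have [y ey] := rr v.
rewrite (hpsi u).1 (hpsi v).1; move: e; rewrite ex ey !repc => /repE ->; by [].
Qed.

Lemma truncated_choosable (R : realType) (G : sgraph) : k_connected 3 G -> ~ complete G ->
  planar R G -> degree_truncated_choosable 11 G.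
Proof.
move=> [_ con] ncomp [pt [arc dr]]; apply: finite_colours => C c0 La hL.
have H3 (S : {set G}) : (#|S| <= 2)%N -> conn (@adj G) (~: S)%SET.
  move=> S2; apply: connect_conn => x y; rewrite !finset.in_setC => xS yS.
  have := con S S2 x y xS yS; rewrite (@eq_connect _ _ [rel u v | [&& adj u v, u \in (~: S)%SET & v \in (~: S)%SET]]) //.
  by move=> u v; rewrite /= !finset.in_setC.
have nbrE z : #|nbr (@adj G) z [set: G]%SET| = degree z.
  by apply: eq_card => x; rewrite !inE.
apply: (@colour_graph _ _ _ c0 (@adj_sym G) (@adj_irrefl G) (drawn_K5free dr) (drawn_K33free dr)
  H3 [set z : G | (degree z <= 10)%N]%SET).
- move=> z; rewrite inE nbrE => d10; apply: leq_trans (hL z).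
  by rewrite (minn_idPr _) // ltnW.
- by move=> z; rewrite inE nbrE.
- move=> z; rewrite inE -ltnNge => d10; apply: leq_trans (hL z).
  by rewrite (minn_idPl _).
apply: contrapT => no; apply: ncomp => u v uv; apply: contrapT => /negP nuv.
by apply: no; exists u, v.
Qed.

Theorem theorem1 (R : realType) :
  (forall G : sgraph,
     k_connected 3 G -> ~ complete G -> planar R G ->
     degree_truncated_choosable 11 G) /\
  (ch_star_family R (planar_family R) <= 11%:R%:E)%E.
Proof.
split=> [G|]; first exact: truncated_choosable.
apply: ge_ereal_sup => _ [G [con ncomp pl] <-]; apply: ereal_inf_lbound.
by exists 11%N => //; split=> //; apply: truncated_choosable pl.
Qed.
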